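(* Let $\alpha_1,\ldots,\alpha_k\in(0,1)$ be distinct. Suppose that Assumption [A$^k$] holds: for each $m\in\{1,\ldots,k\}$ there are a deterministic sequence $(a_{m,n})_n$ of positive numbers with $a_{m,n}\to\infty$ and a function $\psi_{\alpha_m}:\mathbb{R}\to\overline{\mathbb{R}}$ with $\lim_{t\to\infty}\psi_{\alpha_m}(t)=\infty$, $\lim_{t\to-\infty}\psi_{\alpha_m}(t)=-\infty$ such that $$\lim_{n\to\infty}\sqrt n\,\bigl[F(q_{\alpha_m}+t/a_{m,n})-F(q_{\alpha_m})\bigr]=\psi_{\alpha_m}(t)\qquad\text{for all }t\in\mathbb{R}.$$ Suppose also that Assumption [B] holds: $\mathbb{E}[1_{Y\le 0}Y^2]<\infty$. Then, as $n\to\infty$, $$\Bigl(a_{1,n}(\widehat q_{n,\alpha_1}-q_{\alpha_1}),\sqrt n(\widehat{es}_{n,\alpha_1}-es_{\alpha_1}),\ldots,a_{k,n}(\widehat q_{n,\alpha_k}-q_{\alpha_k}),\sqrt n(\widehat{es}_{n,\alpha_k}-es_{\alpha_k})\Bigr)\Rightarrow(z_{1,1},z_{1,2},\ldots,z_{k,1},z_{k,2})$$ in distribution, where for $m=1,\ldots,k$ $$z_{m,1}=\psi_{\alpha_m}^{\leftrightarrow}(W_{m,1}),\qquad z_{m,2}=W_{m,2},$$ $$\psi_{\alpha_m}^{\leftrightarrow}(x)=\begin{cases}\inf\{t\le 0:\psi_{\alpha_m}(t)\ge x\}&\text{if }x<0,\\0&\text{if }x=0,\\\sup\{t\ge 0:\psi_{\alpha_m}(t)\le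 x\}&\text{if }x>0,\end{cases}$$ and the vector $(W_{1,1},W_{1,2},\ldots,W_{k,1},W_{k,2})$ is distributed according to $\mathcal{N}(0,\Sigma)$ with $\Sigma$ determined, for $s,t\in\{1,\ldots,k\}$, by $$\operatorname{Cov}(W_{s,1},W_{t,1})=\alpha_s\wedge\alpha_t-\alpha_s\alpha_t,$$ $$\operatorname{Cov}(W_{s,2},W_{t,2})=\frac{\alpha_s\wedge\alpha_t}{\alpha_s\alpha_t}\bigl(q_{\alpha_s}q_{\alpha_t}-(q_{\alpha_s}+q_{\alpha_t})\,es_{\alpha_s\wedge\alpha_t}\bigr)+\frac{1}{\alpha_s\alpha_t}\mathbb{E}\bigl[1_{Y\le q_{\alpha_s\wedge\alpha_t}}Y^2\bigr]+(es_{\alpha_s}-q_{\alpha_s})(es_{\alpha_t}-q_{\alpha_t}),$$ $$\operatorname{Cov}(W_{s,1},W_{t,2})=\frac{\alpha_s\wedge\alpha_t}{\alpha_t}\bigl(q_{\alpha_t}-es_{\alpha_s\wedge\alpha_t}\bigr)-\alpha_s\bigl(q_{\alpha_t}-es_{\alpha_t}\bigr).$$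
   Context: $Y$ is a real random variable with distribution function $F$ and $\mathbb{E}|Y|<\infty$, and $X_1,X_2,\ldots$ are i.i.d. with distribution function $F$. Standing assumption: for each level $\alpha\in\{\alpha_1,\ldots,\alpha_k\}$, $F$ is continuous and strictly increasing at its $\alpha$-quantile $q_\alpha$ (so that $q_\alpha$ is unique). The lower tail expected shortfall at level $\alpha$ is $es_\alpha=\frac1\alpha\int_0^\alpha F^{-1}(u)\,du=\frac1\alpha\int_{-\infty}^{q_\alpha}y\,dF(y)$. $\overline{\mathbb{R}}=\mathbb{R}\cup\{-\infty,\infty\}$, $a\wedge b=\min(a,b)$, and $\Rightarrow$ denotes convergence in distribution. Scoring function at level $\alpha$: let $\mathcal{G}:\mathbb{R}\to\mathbb{R}$ be three times continuously differentiable with $\mathcal{G}'=G$, $G'>0$ and $\lim_{x\to-\infty}G(x)=0$, and set $$S(x_1,x_2;y)=(1_{y\le x_1}-\alpha)(x_1-y)+G(x_2)\bigl(x_2+\alpha^{-1}(1_{y\le x_1}-\alpha)(x_1-y)\bigr)-\mathcal{G}(x_2)-G(x_2)\,y .$$ For each level $\alpha$ the minimum contrast estimator is any $$(\widehat q_{n,\alpha},\widehat{es}_{n,\alpha})\in\operatorname*{arg\,min}_{(x_1,x_2)\in\mathbb{R}^2}\sum_{i=1}^n S(x_1,x_2;X_i).$$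
   Formalization: In Cov(W_{s,2},W_{t,2}) the last term is taken with a minus sign, −(es_{α_s}−q_{α_s})(es_{α_t}−q_{α_t}); with the printed plus sign the claim fails, e.g. for Y uniform on [0,1] and α=1/2, where the limit variance is 1/6−1/16. *)

(* Defs.v *)
From HB Require Import structures.
From mathcomp Require Import all_boot all_order all_algebra finmap.
From mathcomp Require Import all_classical all_reals all_analysis.
Set Implicit Arguments.
Unset Strict Implicit.
Unset Printing Implicit Defensive.
Import Order.TTheory GRing.Theory Num.Theory.
Import numFieldNormedType.Exports.
Local Open Scope classical_set_scope.
Local Open Scope ring_scope.

Definition dist_fun d (T : measurableType d) (R : realType)
    (P : probability T R) (Y : {RV P >-> R}) (x : R) : R :=
  fine (cdf Y x).

Definition mutually_independent d (T : measurableType d) (R : realType)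
    (P : probability T R) (X : nat -> {RV P >-> R}) : Prop :=
  forall (J : {fset nat}) (B : nat -> set R),
    (forall i, i \in J -> measurable (B i)) ->
    P (\bigcap_(i in [set` J]) (X i @^-1` B i)) =
    (\prod_(i <- J) P (X i @^-1` B i))%E.

Definition quantile (R : realType) (F : R -> R) (u : R) : R :=
  inf [set x | u <= F x].

Definition strictly_increasing_at (R : realType) (F : R -> R) (q : R) : Prop :=
  (forall x, x < q -> F x < F q) /\ (forall x, q < x -> F q < F x).

(* The endpoint 0 is left out because the generalised inverse is -oo there
   in general, whereas the real-valued inf returns 0. *)
Definition lower_es (R : realType) (F : R -> R) (alpha : R) : R :=
  alpha^-1 * \int[lebesgue_measure]_(u in `]0, alpha]) quantile F u.

(* calG is the antiderivative; its derivative is the function written G in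
   the scoring function below. *)
Definition scoring_generator (R : realType) (calG : R -> R) : Prop :=
  [/\ forall j, (j < 3)%N -> forall x, derivable calG^`(j)%classic x 1,
      continuous calG^`(3)%classic,
      forall x, 0 < calG^`(2)%classic x &
      calG^`()%classic x @[x --> -oo] --> (0 : R)].

Definition score (R : realType) (calG : R -> R) (alpha x1 x2 y : R) : R :=
  let G : R -> R := calG^`()%classic in
  ((y <= x1)%R%:R - alpha) * (x1 - y)
  + G x2 * (x2 + alpha^-1 * ((y <= x1)%R%:R - alpha) * (x1 - y))
  - calG x2 - G x2 * y.

(* [x 0, ..., x n.-1] is the sample and (q, e) a global minimiser over R^2. *)
Definition min_contrast (R : realType) (calG : R -> R) (alpha : R)
    (n : nat) (x : nat -> R) (q e : R) : Prop :=
  forall x1 x2 : R,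
    \sum_(i < n) score calG alpha q e (x i) <=
    \sum_(i < n) score calG alpha x1 x2 (x i).

(* When psi tends to +oo at +oo and to -oo at -oo the two sets below are
   bounded on both sides, so that the real-valued inf and sup are meant. *)
Definition psi_inv (R : realType) (psi : R -> \bar R) (x : R) : R :=
  if x < 0 then inf [set t | t <= 0 /\ (x%:E <= psi t)%E]
  else if x == 0 then 0
  else sup [set t | 0 <= t /\ (psi t <= x%:E)%E].

Definition cvg_in_distribution d (T : measurableType d) d'
    (T' : measurableType d') (R : realType) (P : probability T R)
    (Q : probability T' R) (V : topologicalType)
    (Z_ : nat -> T -> V) (Z : T' -> V) : Prop :=
  forall f : V -> R, continuous f -> bounded_fun f ->
    ('E_P[fun w => f (Z_ n w)] @[n --> \oo] --> 'E_Q[fun w => f (Z w)])%E.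

(* [normal_prob 0 0] is not the point mass at 0, so the degenerate case is
   treated apart. *)
Definition centered_normal (R : realType) (v : R) (B : set R) : \bar R :=
  if v == 0 then \d_(0 : R) B else normal_prob 0 (Num.sqrt v) B.

(* W ~ N(0, Sigma): every linear combination sum_i u_i W_i is normal with
   mean 0 and variance sum_(i, j) u_i u_j Sigma_(i, j). *)
Definition centered_gaussian d (T : measurableType d) (R : realType)
    (P : probability T R) (I : finType) (W : I -> {RV P >-> R})
    (Sigma : I -> I -> R) : Prop :=
  (forall i j, Sigma i j = Sigma j i) /\
  forall u : I -> R,
    let v := \sum_i \sum_j u i * u j * Sigma i j in
    0 <= v /\
    forall B : set R, measurable B ->
      P [set w | B (\sum_i u i * W i w)] = centered_normal v B.

Section limit_covariance.
Context d (T : measurableType d) (R : realType) (P : probability T R).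
Variables (Y : {RV P >-> R}) (k : nat) (alpha : 'I_k -> R).

Local Notation q s := (quantile (dist_fun Y) (alpha s)).
Local Notation es a := (lower_es (dist_fun Y) a).

Definition cov_qq (s t : 'I_k) : R :=
  Num.min (alpha s) (alpha t) - alpha s * alpha t.

(* This is the covariance of alpha_s^-1 (q_s - Y)^+ and
   alpha_t^-1 (q_t - Y)^+, whose means are q_s - es_s and q_t - es_t. Being
   E[UV] - E[U]E[V], it carries a minus sign in front of the last product;
   with a plus sign it would not be the asymptotic covariance of the expected
   shortfall estimators. *)
Definition cov_ee (s t : 'I_k) : R :=
  let m := Num.min (alpha s) (alpha t) in
  m / (alpha s * alpha t) * (q s * q t - (q s + q t) * es m)
  + (alpha s * alpha t)^-1 *
    fine ('E_P[fun w => ((Y w <= quantile (dist_fun Y) m)%R%:R * Y w ^+ 2)%R])%E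
  - (es (alpha s) - q s) * (es (alpha t) - q t).

Definition cov_qe (s t : 'I_k) : R :=
  let m := Num.min (alpha s) (alpha t) in
  m / alpha t * (q t - es m) - alpha s * (q t - es (alpha t)).

(* An index (s, 0) stands for the quantile at level alpha_s, and (s, 1) for
   the expected shortfall at level alpha_s. *)
Definition limit_cov (i j : 'I_k * 'I_2) : R :=
  if i.2 == 0 then
    if j.2 == 0 then cov_qq i.1 j.1 else cov_qe i.1 j.1
  else
    if j.2 == 0 then cov_qe j.1 i.1 else cov_ee i.1 j.1.

End limit_covariance.

(* Main.v *)
Require Import Defs.
From HB Require Import structures.
From mathcomp Require Import all_boot all_order all_algebra finmap.
From mathcomp Require Import all_classical all_reals all_analysis.
From mathcomp Require Import measurable_realfun lebesgue_integral_under ring lra.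
Set Implicit Arguments.
Unset Strict Implicit.
Unset Printing Implicit Defensive.
Import Order.TTheory GRing.Theory Num.Theory.
Import numFieldNormedType.Exports.
Local Open Scope classical_set_scope.
Local Open Scope ring_scope.

(** Why the estimators are jointly asymptotically as described.

    The minimiser of the empirical score is nearly explicit. In its first
    argument the score is an increasing function of the pinball loss, so that
    qhat minimises a convex piecewise linear function whose slope at x is, up to
    a factor, F_n(x) - alpha with F_n the empirical distribution function; in its
    second argument it has the single critical point
    eshat = H_n(qhat), where H_n(x) = x - (alpha n)^-1 sum_i (x - X_i)^+. Hence
    qhat > x forces F_n(x) <= alpha and qhat <= x forces F_n(x) >= alpha
    ([min_contrast_lt], [min_contrast_le]), and the concave function H_n takes
    its maximum eshat at qhat ([min_contrast_es], [min_contrast_remainder]).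

    Both coordinates are then governed by normalised sums V_n of centred
    influence functions. Let Z_n = a_n (qhat - q). Increments of F_n between q
    and q + t / a_n concentrate, so Z_n <= t and V_n < psi(t) agree up to an
    event of small probability as soon as V_n stays away from psi(t)
    ([quantile_cut_lo], [quantile_cut_hi]). The same holds for the expected
    shortfall error, with the identity in place of psi, because its remainder is
    squeezed between 0 and a product of a consistent factor and a tight one
    ([es_cut_lo], [es_cut_hi]). The covariances of the influence functions come
    from the quantile transform ([expectR_hinge_quantile],
    [expectR_influenceM]).

    The central limit theorem is used in the form of convergence of the
    expectations of all waves cos(th + u . V_n). For one linear combination this
    is a recursion on the sample size with the addition formulas ([clt_cos]), and
    linear combinations of influence functions are again functions of one
    observation ([multivariate_clt]). On the Gaussian side the expectation of
    the wave solves a differential equation given by integration by parts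
    ([expectR_cos_normal], [gaussian_phase]).

    The function psi may jump, be flat and take infinite values, so that its
    generalised inverse is not continuous and cannot be composed with the limit
    of V_n. Instead, the waves are multiplied by the indicators of the events
    Z_n <= t, one coordinate and one threshold at a time. A sine times a wave is
    a sum of waves, so the class of bounded variables that converge jointly with
    V_n against all waves ([tested]) is stable under multiplication by Bernstein
    polynomials of sines of V_n, by ramps and, W having no atoms, by indicators
    of V_n < psi(t) and thus of Z_n <= t ([tested_cut]). So the probability that
    Z_n lies in a given cell of a grid converges to the probability that the
    coordinates of W lie between the values of psi at its corners. A bounded
    continuous function is uniformly continuous on a box, and on a fine grid its
    expectation is a combination of probabilities of cells ([cvg_by_cells]). In
    the limit only the two inequalities of [psi_inv_gt] and [psi_inv_lt] are
    needed to see that psi_inv(W) lies in the cell that W selects. *)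

(** * Expectations of real functions *)

Definition integrableR d (T : measurableType d) (R : realType)
  (P : probability T R) (f : T -> R) := P.-integrable setT (EFin \o f).

Section expectation_of_real_functions.
Context d (T : measurableType d) (R : realType) {P : probability T R}.
Implicit Types (f g : T -> R) (a c : R).

Local Notation integrableR := (integrableR P).

Local Notation E f := (Rintegral P setT f).

Lemma integrableR_measurable f : integrableR f -> measurable_fun setT f.
Proof. by move=> /integrableP[/measurable_EFinP]. Qed.

Lemma le_integrableR f g : measurable_fun setT f -> integrableR g ->
  (forall w, `|f w| <= g w) -> integrableR f.
Proof.
move=> mf ig fg; apply: le_integrable ig => //; first exact/measurable_EFinP.
move=> w _ /=; rewrite lee_fin (le_trans (fg w))//; exact: ler_norm.
Qed.

Lemma integrableR_cst c : integrableR (fun=> c).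
Proof. exact: finite_measure_integrable_cst. Qed.

Lemma bounded_integrableR f c : measurable_fun setT f ->
  (forall w, `|f w| <= c) -> integrableR f.
Proof. by move=> mf fc; apply: le_integrableR mf (integrableR_cst c) _. Qed.

Lemma integrableRD f g : integrableR f -> integrableR g ->
  integrableR (fun w => f w + g w).
Proof. by move=> fi gi; exact: integrableD fi gi. Qed.

Lemma integrableRB f g : integrableR f -> integrableR g ->
  integrableR (fun w => f w - g w).
Proof. by move=> fi gi; exact: integrableB fi gi. Qed.

Lemma integrableRZ c f : integrableR f -> integrableR (fun w => c * f w).
Proof. by move=> fi; exact: integrableZl fi. Qed.

Lemma integrableR_norm f : integrableR f -> integrableR (fun w => `|f w|).
Proof. by move=> fi; exact: integrable_norm fi. Qed.

Lemma integrableR_sum I (s : seq I) (f : I -> T -> R) :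
  (forall i, integrableR (f i)) ->
  integrableR (fun w => \sum_(i <- s) f i w).
Proof.
move=> fi; elim: s => [|i s ih].
  by under eq_fun do rewrite big_nil; exact: integrableR_cst.
by under eq_fun do rewrite big_cons; exact: integrableRD.
Qed.

Lemma integrableRM_bounded f g c : integrableR f -> measurable_fun setT g ->
  (forall w, `|g w| <= c) -> integrableR (fun w => f w * g w).
Proof.
move=> fi mg gc.
apply: (@le_integrableR _ (fun w => c * `|f w|)).
- by apply: measurable_funM => //; exact: integrableR_measurable.
- by apply: integrableRZ; exact: integrableR_norm.
- by move=> w; rewrite normrM mulrC ler_wpM2r.
Qed.

Lemma integrableRM_sqr f g : measurable_fun setT f -> measurable_fun setT g ->
  integrableR (fun w => f w ^+ 2) -> integrableR (fun w => g w ^+ 2) ->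
  integrableR (fun w => f w * g w).
Proof.
move=> mf mg f2 g2.
apply: (@le_integrableR _ (fun w => f w ^+ 2 + g w ^+ 2)).
- exact: measurable_funM.
- exact: integrableRD.
- move=> w; rewrite normrM -[f w ^+ 2]real_normK ?num_real//.
  rewrite -[g w ^+ 2]real_normK ?num_real//.
  by have := sqr_ge0 (`|f w| - `|g w|); nra.
Qed.

Lemma integrableR_sqr f : measurable_fun setT f ->
  integrableR (fun w => f w ^+ 2) -> integrableR f.
Proof.
move=> mf f2; apply: (@le_integrableR _ (fun w => 1 + f w ^+ 2)) => //.
  by apply: integrableRD => //; exact: integrableR_cst.
move=> w; rewrite -[f w ^+ 2]real_normK ?num_real//.
by have := sqr_ge0 (`|f w| - 1); have := normr_ge0 (f w); nra.
Qed.

Lemma expectR_cst c : E (fun=> c) = c.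
Proof. by rewrite Rintegral_cst//= probability_setT mulr1. Qed.

Lemma expectRD f g : integrableR f -> integrableR g ->
  E (fun w => f w + g w) = E f + E g.
Proof. by move=> fi gi; exact: RintegralD. Qed.

Lemma expectRB f g : integrableR f -> integrableR g ->
  E (fun w => f w - g w) = E f - E g.
Proof. by move=> fi gi; exact: RintegralB. Qed.

Lemma expectRZ c f : integrableR f -> E (fun w => c * f w) = c * E f.
Proof. by move=> fi; exact: RintegralZl. Qed.

Lemma eq_expectR f g : f =1 g -> E f = E g.
Proof. by move=> fg; congr Rintegral; exact/funext. Qed.

Lemma le_expectR f g : integrableR f -> integrableR g ->
  (forall w, f w <= g w) -> E f <= E g.
Proof. by move=> fi gi fg; apply: le_Rintegral. Qed.

Lemma expectR_ge0 f : (forall w, 0 <= f w) -> 0 <= E f.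
Proof. by move=> f0; exact: Rintegral_ge0. Qed.

Lemma le_norm_expectR f g : measurable_fun setT f -> integrableR g ->
  (forall w, `|f w| <= g w) -> `|E f| <= E g.
Proof.
move=> mf gi fg; have fi := le_integrableR mf gi fg.
apply: (le_trans (le_normr_Rintegral measurableT fi)).
by apply: le_expectR => //; exact: integrableR_norm.
Qed.

Lemma norm_expectR_le f c : measurable_fun setT f ->
  (forall w, `|f w| <= c) -> `|E f| <= c.
Proof.
move=> mf fc; rewrite -[leRHS]expectR_cst.
exact: le_norm_expectR (integrableR_cst _) fc.
Qed.

Lemma expectR_sum I (s : seq I) (f : I -> T -> R) :
  (forall i, integrableR (f i)) ->
  E (fun w => \sum_(i <- s) f i w) = \sum_(i <- s) E (f i).
Proof.
move=> fi; elim: s => [|i s ih].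
  by rewrite big_nil; under eq_expectR do rewrite big_nil; rewrite expectR_cst.
rewrite big_cons -ih -expectRD//; last exact: integrableR_sum.
by apply: eq_expectR => w; rewrite big_cons.
Qed.

Lemma expectR_EFin f : integrableR f ->
  ((E f)%:E = \int[P]_w (f w)%:E)%E.
Proof. by move=> fi; rewrite /Rintegral fineK//; exact: integrable_fin_num fi. Qed.

Lemma dominated_cvgR (f_ : nat -> T -> R) f g :
  (forall n, measurable_fun setT (f_ n)) -> integrableR g ->
  (forall n w, `|f_ n w| <= g w) ->
  (forall w, f_ n w @[n --> \oo] --> f w) ->
  E (f_ n) @[n --> \oo] --> E f.
Proof.
move=> mf gi fg ff.
have mF : measurable_fun setT f.
  by apply: (measurable_fun_cvg mf) => w _; exact: ff.
have bf w : `|f w| <= g w.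
  have /cvg_norm nf := ff w.
  rewrite -(cvg_lim (@Rhausdorff R) nf).
  apply: limr_le; first by apply/cvg_ex; eexists; exact: nf.
  by apply: nearW => n; exact: fg.
have fi : integrableR f by exact: le_integrableR gi bf.
apply: fine_cvg; rewrite -/(E f) expectR_EFin//.
apply: (@dominated_cvg _ _ _ P setT measurableT _ _ (EFin \o g)) => //.
- by move=> n; exact/measurable_EFinP.
- by move=> w _; apply: cvg_EFin; [exact: nearW|exact: ff].
- by move=> n w _; rewrite lee_fin.
Qed.

Lemma integrableR_pred (b : T -> bool) : measurable_fun setT b ->
  integrableR (fun w => (b w)%:R).
Proof.
move=> mb; apply: (@bounded_integrableR _ 1).
  rewrite (_ : (fun w => _) = (fun w => if b w then 1 else 0)).
    exact: measurable_fun_ifT.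
  by apply/funext => w; case: (b w).
by move=> w; case: (b w); rewrite ?normr1 ?normr0.
Qed.

Lemma expectR_pred (b : T -> bool) : measurable_fun setT b ->
  ((E (fun w => (b w)%:R))%:E = P [set w | b w])%E.
Proof.
move=> mb.
have mB : measurable [set w | b w].
  by rewrite -[X in measurable X]setTI; exact: mb.
transitivity (\int[P]_w (\1_[set w | b w] w)%:E)%E.
  rewrite expectR_EFin//; last exact: integrableR_pred.
  apply: eq_integral => w _; rewrite indicE; congr (_%:R%:E).
  congr nat_of_bool.
  by apply/idP/idP => [bw|/set_mem//]; rewrite ?inE.
by rewrite integral_indic// setIT.
Qed.

Lemma expectR_markov f a : 0 < a -> integrableR f -> (forall w, 0 <= f w) ->
  E (fun w => (a <= f w)%R%:R) <= E f / a.
Proof.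
move=> a0 fi f0; rewrite mulrC -expectRZ//.
apply: le_expectR; [|exact: integrableRZ|].
  apply/integrableR_pred/measurable_fun_ler => //.
  exact: integrableR_measurable.
move=> w; have [afw|_] := leP a (f w); last by rewrite mulr_ge0// invr_ge0 ltW.
by rewrite mulrC ler_pdivlMr// mul1r.
Qed.

End expectation_of_real_functions.

(** * Factorisation of expectations *)

Section independence.
Import HBNNSimple.
Context d (T : measurableType d) (R : realType) (P : probability T R).

Local Notation E f := (Rintegral P setT f).

(** The factorisation passes from indicators to simple functions by linearity,
    and from these to nonnegative functions by dominated convergence along an
    increasing sequence of simple functions. *)
Lemma ge0_expectR_factor (Psi : T -> R) (X : {RV P >-> R}) (c : R)
    (phi : R -> R) :
  integrableR P Psi ->
  (forall B, measurable B ->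
    E (fun w => Psi w * \1_B (X w)) = c * E (fun w => \1_B (X w))) ->
  measurable_fun setT phi -> (forall x, 0 <= phi x) ->
  integrableR P (phi \o X) -> integrableR P (fun w => Psi w * phi (X w)) ->
  E (fun w => Psi w * phi (X w)) = c * E (phi \o X).
Proof.
move=> iPsi factor mphi phi0 iphi iPphi.
have mephi : measurable_fun setT (EFin \o phi) by exact/measurable_EFinP.
pose g n : R -> R := nnsfun_approx measurableT mephi n.
have g_phi n x : 0 <= g n x <= phi x.
  apply/andP; split; first by rewrite /g.
  by rewrite -lee_fin /g nnsfun_approxE; apply: le_approx => // y _; rewrite lee_fin.
have cvg_g x : g n x @[n --> \oo] --> phi x.
  have := @cvg_nnsfun_approx _ _ _ setT measurableT _ mephi _ x I.
  move=> /(_ (fun y _ => phi0 y)).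
  by move=> /fine_cvg.
have mX := @measurable_funPT _ _ _ _ X.
have mg n : measurable_fun setT (g n) by exact: measurable_funPT.
have mi (B : set R) : measurable B -> measurable_fun setT (fun w => \1_B (X w) : R).
  by move=> mB; apply: measurableT_comp => //; exact: measurable_indic.
have ii (B : set R) w : `|\1_B (X w)| <= 1 :> R.
  by rewrite indicE; case: (_ \in _); rewrite ?normr1 ?normr0.
have factor_g n : E (fun w => Psi w * g n (X w)) = c * E (g n \o X).
  have gE x : g n x = \sum_(y <- fset_set (range (g n)))
      y * \1_(g n @^-1` [set y]) x.
    by rewrite {1}/g fimfunE fsbig_finite.
  have mB y : measurable (g n @^-1` [set y]).
    by rewrite -[X in measurable X]setTI; exact: mg.
  transitivity (E (fun w => \sum_(y <- fset_set (range (g n)))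
      y * (Psi w * \1_(g n @^-1` [set y]) (X w)))).
    apply: eq_expectR => w; rewrite gE mulr_sumr.
    by apply: eq_bigr => y _; rewrite mulrCA.
  transitivity (c * E (fun w => \sum_(y <- fset_set (range (g n)))
      y * \1_(g n @^-1` [set y]) (X w))); last first.
    by congr (c * _); apply: eq_expectR => w /=; rewrite [RHS]gE.
  have i1 y : integrableR P (fun w => Psi w * \1_(g n @^-1` [set y]) (X w)).
    by apply: (@integrableRM_bounded _ _ _ _ _ _ 1) => //; exact: mi.
  have i2 y : integrableR P (fun w => \1_(g n @^-1` [set y]) (X w) : R).
    by apply: (@bounded_integrableR _ _ _ _ _ 1) => //; exact: mi.
  rewrite !expectR_sum; [|by move=> y; exact: integrableRZ..].
  rewrite mulr_sumr; apply: eq_bigr => y _.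
  by rewrite !expectRZ// factor// mulrCA.
have cvg1 : E (fun w => Psi w * g n (X w)) @[n --> \oo] -->
    E (fun w => Psi w * phi (X w)).
  apply: (@dominated_cvgR _ _ _ _ _ _ (fun w => `|Psi w * phi (X w)|)).
  - move=> n; apply: measurable_funM; first exact: integrableR_measurable iPsi.
    exact: measurableT_comp (mg n) mX.
  - exact: integrableR_norm.
  - move=> n w; rewrite !normrM ler_wpM2l//.
    by have /andP[g0 gp] := g_phi n (X w); rewrite !ger0_norm.
  - by move=> w; apply: cvgM; [exact: cvg_cst|exact: cvg_g].
have cvg2 : c * E (g n \o X) @[n --> \oo] --> c * E (phi \o X).
  apply: cvgM; first exact: cvg_cst.
  apply: (@dominated_cvgR _ _ _ _ _ _ (phi \o X)) => //.
  - by move=> n w /=; have /andP[g0 gp] := g_phi n (X w); rewrite ger0_norm.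
  - by move=> w; exact: cvg_g.
rewrite -(cvg_lim (@Rhausdorff R) cvg1) -(cvg_lim (@Rhausdorff R) cvg2).
by congr (limn _); apply/funext => n; exact: factor_g.
Qed.

(** The positive and the negative part of phi are treated separately. *)
Lemma expectR_factor (Psi : T -> R) (X : {RV P >-> R}) (c : R)
    (phi : R -> R) :
  integrableR P Psi ->
  (forall B, measurable B ->
    E (fun w => Psi w * \1_B (X w)) = c * E (fun w => \1_B (X w))) ->
  measurable_fun setT phi ->
  integrableR P (phi \o X) -> integrableR P (fun w => Psi w * phi (X w)) ->
  E (fun w => Psi w * phi (X w)) = c * E (phi \o X).
Proof.
move=> iPsi factor mphi iphi iPphi.
have mX := @measurable_funPT _ _ _ _ X.
have mPsi := integrableR_measurable iPsi.
pose p x := Num.max (phi x) 0; pose m x := Num.max (- phi x) 0.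
have mp : measurable_fun setT p by exact: measurable_maxr.
have mm : measurable_fun setT m.
  by apply: measurable_maxr => //; exact: measurable_funN.
have p0 x : 0 <= p x by rewrite le_max lexx orbT.
have m0 x : 0 <= m x by rewrite le_max lexx orbT.
have pmE x : phi x = p x - m x.
  rewrite /p /m; have [h|h] := leP (phi x) 0.
    by rewrite (max_idPl _) ?oppr_ge0// sub0r opprK.
  by rewrite (max_idPr _) ?oppr_le0 ?ltW// subr0.
have ple x : p x <= `|phi x| by rewrite /p ge_max ler_norm normr_ge0.
have mle x : m x <= `|phi x| by rewrite /m ge_max -normrN ler_norm normr_ge0.
have ip : integrableR P (p \o X).
  apply: (le_integrableR (measurableT_comp mp mX) (integrableR_norm iphi)) => w /=.
  by rewrite ger0_norm.
have im : integrableR P (m \o X).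
  apply: (le_integrableR (measurableT_comp mm mX) (integrableR_norm iphi)) => w /=.
  by rewrite ger0_norm.
have iPp : integrableR P (fun w => Psi w * p (X w)).
  apply: (le_integrableR _ (integrableR_norm iPphi)) => [|w].
    by apply: measurable_funM => //; exact: measurableT_comp mp mX.
  by rewrite !normrM ler_wpM2l// ger0_norm.
have iPm : integrableR P (fun w => Psi w * m (X w)).
  apply: (le_integrableR _ (integrableR_norm iPphi)) => [|w].
    by apply: measurable_funM => //; exact: measurableT_comp mm mX.
  by rewrite !normrM ler_wpM2l// ger0_norm.
transitivity (E (fun w => Psi w * p (X w) - Psi w * m (X w))).
  by apply: eq_expectR => w; rewrite -mulrBr -pmE.
rewrite expectRB// !(@ge0_expectR_factor _ _ c)// -mulrBr -expectRB//.
by congr (c * _); apply: eq_expectR => w /=; rewrite -pmE.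
Qed.

Lemma expectR_indic (X : {RV P >-> R}) B : measurable B ->
  ((E (fun w => \1_B (X w)))%:E = P (X @^-1` B))%E.
Proof.
move=> mB; have mXB : measurable (X @^-1` B).
  by rewrite -[X in measurable X]setTI; exact: measurable_funPT.
rewrite expectR_EFin.
  rewrite -(setIT (X @^-1` B)) -integral_indic//.
apply: (@bounded_integrableR _ _ _ _ _ 1).
  exact: measurable_indic mXB.
by move=> w; rewrite indicE; case: (_ \in _); rewrite ?normr1 ?normr0.
Qed.

Lemma indep_expectR_indic (X : nat -> {RV P >-> R}) (J : {fset nat})
    (B : nat -> set R) :
  mutually_independent X -> (forall i, i \in J -> measurable (B i)) ->
  E (fun w => \prod_(i <- J) \1_(B i) (X i w)) =
  \prod_(i <- J) E (fun w => \1_(B i) (X i w)).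
Proof.
move=> indep mB; apply: EFin_inj; rewrite -prodEFin.
rewrite [RHS](eq_big_seq (fun i => P (X i @^-1` B i))); last first.
  by move=> i iJ; rewrite expectR_indic//; exact: mB.
rewrite -indep//.
have prodE w : \prod_(i <- J) \1_(B i) (X i w) =
    \1_(\bigcap_(i in [set` J]) (X i @^-1` B i)) w :> R.
  rewrite indicE; have [wJ|wJ] := boolP (w \in _).
    rewrite big_seq big1// => i iJ; rewrite indicE mem_set//.
    by move/set_mem : wJ; exact.
  move: wJ; rewrite notin_setE => wJ.
  have [i iJ wi] : exists2 i, i \in J & ~ B i (X i w).
    apply: contrapT => h; apply: wJ => i /= iJ.
    by apply: contrapT => nBi; apply: h; exists i.
  by rewrite (big_rem i)//= indicE memNset// mul0r.
have mI : measurable (\bigcap_(i in [set` J]) (X i @^-1` B i)).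
  apply: fin_bigcap_measurable => // i iJ.
  by rewrite -[X in measurable X]setTI; apply: measurable_funPT => //; exact: mB.
under eq_expectR do rewrite prodE.
rewrite expectR_EFin; last exact: integrable_indic.
by rewrite integral_indic// setIT.
Qed.

End independence.

(** * Variables independent of the future *)

Section independent_of_the_future.
Context d (T : measurableType d) (R : realType) (P : probability T R).
Variable X : nat -> {RV P >-> R}.

Local Notation E f := (Rintegral P setT f).

(** Bounded measurable functions of X_0, ..., X_(j-1) have this property. Working
    with it in place of the sigma-algebra generated by these variables avoids
    products of measures and monotone classes of sets. *)
Definition indep_from (j : nat) (Phi : T -> R) :=
  [/\ measurable_fun setT Phi, exists c : R, forall w, `|Phi w| <= c &
    forall (J : {fset nat}) (B : nat -> set R),
      (forall i, i \in J -> (j <= i)%N) -> (forall i, measurable (B i)) ->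
      E (fun w => Phi w * \prod_(i <- J) \1_(B i) (X i w)) =
      E Phi * \prod_(i <- J) E (fun w => \1_(B i) (X i w))].

Let mX i : measurable_fun setT (X i) := @measurable_funPT _ _ _ _ (X i).

Let mprod (J : {fset nat}) (B : nat -> set R) :
  (forall i, measurable (B i)) ->
  measurable_fun setT (fun w => \prod_(i <- J) \1_(B i) (X i w) : R).
Proof.
move=> mB; apply: measurable_prod => i _.
by apply: measurableT_comp => //; exact: measurable_indic.
Qed.

Let prod_le1 (J : {fset nat}) (B : nat -> set R) w :
  `|\prod_(i <- J) \1_(B i) (X i w)| <= 1 :> R.
Proof.
suff /andP[p0 p1] : 0 <= \prod_(i <- J) (\1_(B i) (X i w) : R) <= 1 by rewrite ger0_norm.
elim/big_rec: _ => [|i x _ /andP[x0 x1]]; first by rewrite ler01 lexx.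
by rewrite indicE; case: (_ \in _); rewrite ?mul1r ?x0 ?x1// mul0r lexx ler01.
Qed.

Lemma indep_from0 : mutually_independent X -> indep_from 0 (fun=> 1).
Proof.
move=> indep; split => //; first by exists 1 => _; rewrite normr1.
move=> J B _ mB; rewrite expectR_cst mul1r -indep_expectR_indic//.
by apply: eq_expectR => w; rewrite mul1r.
Qed.

Lemma indep_fromD j Phi Psi : indep_from j Phi -> indep_from j Psi ->
  indep_from j (fun w => Phi w + Psi w).
Proof.
move=> [mPhi [c1 bPhi] h1] [mPsi [c2 bPsi] h2]; split.
- exact: measurable_funD.
- by exists (c1 + c2) => w; rewrite (le_trans (ler_normD _ _))// lerD.
- move=> J B jJ mB; under eq_expectR do rewrite mulrDl.
  have iPhi : integrableR P Phi := bounded_integrableR mPhi bPhi.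
  have iPsi : integrableR P Psi := bounded_integrableR mPsi bPsi.
  by rewrite !expectRD ?mulrDl ?h1 ?h2//; apply: (@integrableRM_bounded _ _ _ _ _ _ 1) => //; exact: mprod.
Qed.

Lemma indep_fromZ j a Phi : indep_from j Phi ->
  indep_from j (fun w => a * Phi w).
Proof.
move=> [mPhi [c1 bPhi] h1]; split.
- exact: measurable_funM.
- by exists (`|a| * c1) => w; rewrite normrM ler_wpM2l.
- move=> J B jJ mB; under eq_expectR do rewrite -mulrA.
  have iPhi : integrableR P Phi := bounded_integrableR mPhi bPhi.
  rewrite !expectRZ ?h1 ?mulrA//.
  by apply: (@integrableRM_bounded _ _ _ _ _ _ 1) => //; exact: mprod.
Qed.

Lemma eq_indep_from j Phi Psi : Phi =1 Psi -> indep_from j Phi ->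
  indep_from j Psi.
Proof. by move=> /funext ->. Qed.

(** The set of observations tested in [indep_from] is enlarged by X_j, and the
    indicator of X_j is then replaced by phi(X_j). *)
Lemma indep_fromM j Phi (phi : R -> R) (c : R) : indep_from j Phi ->
  measurable_fun setT phi -> (forall x, `|phi x| <= c) ->
  indep_from j.+1 (fun w => Phi w * phi (X j w)) /\
  E (fun w => Phi w * phi (X j w)) = E Phi * E (phi \o X j).
Proof.
move=> [mPhi [c1 bPhi] h1] mphi bphi.
have mphiX := measurableT_comp mphi (mX j).
have iphi : integrableR P (phi \o X j).
  by apply: (bounded_integrableR mphiX) => w; exact: bphi.
have iPhi : integrableR P Phi := bounded_integrableR mPhi bPhi.
have step (J : {fset nat}) (B : nat -> set R) :
    (forall i, i \in J -> (j < i)%N) -> (forall i, measurable (B i)) ->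
    E (fun w => Phi w * \prod_(i <- J) \1_(B i) (X i w) * phi (X j w)) =
    E Phi * \prod_(i <- J) E (fun w => \1_(B i) (X i w)) * E (phi \o X j).
  move=> jJ mB.
  have iPhiJ : integrableR P (fun w => Phi w * \prod_(i <- J) \1_(B i) (X i w)).
    by apply: (@integrableRM_bounded _ _ _ _ _ _ 1) => //; exact: mprod.
  apply: expectR_factor => //; last first.
    by apply: (@integrableRM_bounded _ _ _ _ _ _ c).
  move=> C mC; have jNJ : j \notin J.
    by apply/negP => /jJ; rewrite ltnn.
  pose B' i := if i == j then C else B i.
  have J'E (F : nat -> R) : \prod_(i <- (j |` J)%fset) F i =
      F j * \prod_(i <- J) F i by rewrite big_fsetU1.
  have B'E i : i \in J -> B' i = B i.
    by move=> iJ; rewrite /B'; case: eqP => // ij; move: jNJ; rewrite -ij iJ.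
  have := h1 (j |` J)%fset B'.
  rewrite J'E {3}/B' eqxx => h.
  transitivity (E (fun w => Phi w * \prod_(i <- (j |` J)%fset) \1_(B' i) (X i w))).
    apply: eq_expectR => w; rewrite J'E {1}/B' eqxx -mulrA; congr (_ * _).
    by rewrite mulrC; congr (_ * _); apply: eq_big_seq => i iJ; rewrite B'E.
  rewrite h; last first.
  - by move=> i; rewrite /B'; case: ifP.
  - by move=> i; rewrite !inE => /orP[/eqP ->//|/jJ/ltnW].
  rewrite -mulrA; congr (_ * _); rewrite mulrC; congr (_ * _).
  by apply: eq_big_seq => i iJ; rewrite B'E.
have E1 : E (fun w => Phi w * phi (X j w)) = E Phi * E (phi \o X j).
  have := step fset0 (fun=> setT); rewrite !big_seq_fset0 mulr1 => <- //.
  by apply: eq_expectR => w; rewrite big_seq_fset0 mulr1.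
split => //; split.
- exact: measurable_funM.
- by exists (c1 * c) => w; rewrite normrM ler_pM.
- move=> J B jJ mB; rewrite E1 mulrAC -step//.
  by apply: eq_expectR => w; rewrite mulrAC.
Qed.

End independent_of_the_future.

(** * Equality in law and sums of independent copies *)

Section equality_in_law.
Context d1 (T1 : measurableType d1) (R : realType) {P1 : probability T1 R}
        d2 (T2 : measurableType d2) {P2 : probability T2 R}.
Variables (X : {RV P1 >-> R}) (Y : {RV P2 >-> R}).

(** The half-lines ]x, +oo[ form a generating pi-system. *)
Lemma eq_cdf_law :
  (forall x, P1 (X @^-1` `]-oo, x]%classic) = P2 (Y @^-1` `]-oo, x]%classic)) ->
  forall B, measurable B -> P1 (X @^-1` B) = P2 (Y @^-1` B).
Proof.
move=> XY B mB.
apply: (@measure_unique _ R _ (@RGenOInfty.G R)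
  (fun n => `](- n%:R), +oo[%classic) _ _ _ _
  (distribution P1 X) (distribution P2 Y) _ _ B mB).
- exact: RGenOInfty.measurableE.
- move=> _ _ [x ->] [y ->]; exists (Num.max x y).
  apply/seteqP; split => z /=; rewrite !in_itv/= !andbT gt_max.
    by move=> [-> ->].
  by move=> /andP.
- by move=> n; eexists.
- apply/seteqP; split => // x _; exists (Num.Def.archi_bound `|x|) => //=.
  rewrite in_itv/= andbT ltrNl (le_lt_trans _ (archi_boundP _))//.
  by rewrite -normrN ler_norm.
- move=> _ [x ->]; rewrite -setCitvl.
  transitivity (P1 (~` (X @^-1` `]-oo, x]%classic))) => //.
  transitivity (P2 (~` (Y @^-1` `]-oo, x]%classic))) => //.
  rewrite !probability_setC ?XY// -[X in measurable X]setTI;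
    exact: measurable_funPT.
- by move=> n; rewrite (le_lt_trans (probability_le1 _ _))// ltry.
Qed.

Hypothesis XY : forall B, measurable B -> P1 (X @^-1` B) = P2 (Y @^-1` B).

Let eq_ge0 (phi : R -> \bar R) : measurable_fun setT phi ->
  (forall x, (0 <= phi x)%E) ->
  (\int[P1]_w phi (X w) = \int[P2]_w phi (Y w))%E.
Proof.
move=> mphi phi0.
rewrite -[LHS](ge0_integral_distribution X mphi phi0).
rewrite -[RHS](ge0_integral_distribution Y mphi phi0).
by apply: eq_measure_integral => A mA _; exact: XY.
Qed.

Lemma eq_law_integrableR (phi : R -> R) : measurable_fun setT phi ->
  integrableR P2 (phi \o Y) -> integrableR P1 (phi \o X).
Proof.
move=> mphi /integrableP[_ fin]; apply/integrableP; split.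
  by apply/measurable_EFinP; exact: measurableT_comp.
rewrite (le_lt_trans _ fin)//.
rewrite (eq_ge0 (phi := fun x => `|(phi x)%:E|%E))//.
by apply: measurableT_comp => //; exact/measurable_EFinP.
Qed.

Lemma eq_law_expectR (phi : R -> R) : measurable_fun setT phi ->
  integrableR P2 (phi \o Y) ->
  Rintegral P1 setT (phi \o X) = Rintegral P2 setT (phi \o Y).
Proof.
move=> mphi iphi; have iphiX := eq_law_integrableR mphi iphi.
have mephi : measurable_fun setT (EFin \o phi) by exact/measurable_EFinP.
congr fine.
rewrite -[LHS](integral_distribution (X := X) mephi iphiX).
rewrite -[RHS](integral_distribution (X := Y) mephi iphi).
by apply: eq_measure_integral => A mA _; exact: XY.
Qed.

End equality_in_law.

Section iid_sums.
Context d (T : measurableType d) (R : realType) {P : probability T R}.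
Variables (Y : {RV P >-> R}) (X : nat -> {RV P >-> R}).
Hypothesis indep : mutually_independent X.
Hypothesis law : forall i x, cdf (X i) x = cdf Y x.

Local Notation E f := (Rintegral P setT f).

Let lawB i B : measurable B -> P (X i @^-1` B) = P (Y @^-1` B).
Proof. by apply: eq_cdf_law => x; exact: law. Qed.

Let mX i : measurable_fun setT (X i) := @measurable_funPT _ _ _ _ (X i).

Lemma iid_integrableR i (phi : R -> R) : measurable_fun setT phi ->
  integrableR P (phi \o Y) -> integrableR P (phi \o X i).
Proof. by apply: eq_law_integrableR; exact: lawB. Qed.

Lemma iid_expectR i (phi : R -> R) : measurable_fun setT phi ->
  integrableR P (phi \o Y) -> E (phi \o X i) = E (phi \o Y).
Proof. by apply: eq_law_expectR; exact: lawB. Qed.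

(** Independence is first used for indicators, then one factor is replaced at
    a time. *)
Lemma indep_expectRM i j (f g : R -> R) : i != j ->
  measurable_fun setT f -> measurable_fun setT g ->
  integrableR P (f \o X i) -> integrableR P (g \o X j) ->
  integrableR P (fun w => f (X i w) * g (X j w)) ->
  E (fun w => f (X i w) * g (X j w)) = E (f \o X i) * E (g \o X j).
Proof.
move=> ij mf mg fi gi fgi.
have iI k (B : set R) : measurable B -> integrableR P (fun w => \1_B (X k w)).
  move=> mB; apply: (@bounded_integrableR _ _ _ _ _ 1).
    by apply: measurableT_comp => //; exact: measurable_indic.
  by move=> w; rewrite indicE; case: (_ \in _); rewrite ?normr1 ?normr0.
have b1 (B : set R) (x : R) : `|\1_B x| <= 1 :> R.
  by rewrite indicE; case: (_ \in _); rewrite ?normr1 ?normr0.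
have step1 (A B : set R) : measurable A -> measurable B ->
    E (fun w => \1_A (X i w) * \1_B (X j w)) =
    E (fun w => \1_A (X i w)) * E (fun w => \1_B (X j w)).
  move=> mA mB; pose C k := if k == i then A else B.
  have ji : j != i by rewrite eq_sym.
  have prodE (F : nat -> R) : \prod_(k <- [fset i; j]%fset) F k = F i * F j.
    by rewrite big_fsetU1 ?inE//= big_seq_fset1.
  have := @indep_expectR_indic _ _ _ _ X [fset i; j]%fset C indep.
  rewrite prodE /C eqxx (negbTE ji) => <-; last by move=> k _; case: ifP.
  by apply: eq_expectR => w; rewrite prodE eqxx (negbTE ji).
have step2 (B : set R) : measurable B ->
    E (fun w => f (X i w) * \1_B (X j w)) =
    E (f \o X i) * E (fun w => \1_B (X j w)).
  move=> mB; rewrite mulrC; under eq_expectR do rewrite mulrC.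
  apply: expectR_factor => //; first exact: iI.
    move=> A mA; rewrite mulrC -step1//.
    by apply: eq_expectR => w; rewrite mulrC.
  under eq_fun do rewrite mulrC.
  apply: (@integrableRM_bounded _ _ _ _ _ _ 1) => //.
  exact: integrableR_measurable (iI _ _ mB).
exact: expectR_factor.
Qed.

Variables (h : R -> R).
Hypothesis mh : measurable_fun setT h.
Hypothesis h2 : integrableR P (fun w => h (Y w) ^+ 2).

Let mhY : measurable_fun setT (h \o Y) := measurableT_comp mh (@measurable_funPT _ _ _ _ Y).
Let mhX i : measurable_fun setT (h \o X i) := measurableT_comp mh (mX i).

Lemma integrableR_iid i : integrableR P (h \o X i).
Proof. by apply: iid_integrableR => //; exact: integrableR_sqr. Qed.

Lemma integrableR_iidM i j : integrableR P (fun w => h (X i w) * h (X j w)).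
Proof.
have mh2 : measurable_fun setT (fun x => h x ^+ 2) by exact: measurable_funX.
by apply: integrableRM_sqr; [exact: mhX|exact: mhX|
  exact: (@iid_integrableR i _ mh2)|exact: (@iid_integrableR j _ mh2)].
Qed.

Lemma integrableR_iid_sum_sqr n :
  integrableR P (fun w => (\sum_(i < n) h (X i w)) ^+ 2).
Proof.
under eq_fun do rewrite expr2 big_distrlr/=.
by apply: integrableR_sum => i; apply: integrableR_sum => j; exact: integrableR_iidM.
Qed.

(** The cross terms vanish, the summands being centred and independent. *)
Lemma expectR_iid_sum_sqr n : E (h \o Y) = 0 ->
  E (fun w => (\sum_(i < n) h (X i w)) ^+ 2) = n%:R * E (fun w => h (Y w) ^+ 2).
Proof.
move=> h0; under eq_expectR do rewrite expr2 big_distrlr/=.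
rewrite expectR_sum; last by move=> i; apply: integrableR_sum => j; exact: integrableR_iidM.
transitivity (\sum_(i < n) E (fun w => h (Y w) ^+ 2)); last first.
  by rewrite sumr_const card_ord mulr_natl.
apply: eq_bigr => i _; rewrite expectR_sum; last by move=> j; exact: integrableR_iidM.
have mh2 : measurable_fun setT (fun x => h x ^+ 2) by exact: measurable_funX.
rewrite (bigD1 i)//= big1 ?addr0.
  by under eq_expectR do rewrite -expr2; exact: (@iid_expectR i _ mh2).
move=> j ji; rewrite indep_expectRM//; last 3 first.
- exact: integrableR_iid.
- exact: integrableR_iid.
- exact: integrableR_iidM.
- by rewrite (@iid_expectR i h)// ?h0 ?mul0r//; exact: integrableR_sqr.
- by rewrite eq_sym.
Qed.

End iid_sums.

(** * Taylor bounds for sine, cosine and exponential *)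

Section taylor_of_sin_and_cos.
Context {R : realType}.
Implicit Types x : R.

Lemma measurable_sin : measurable_fun setT (@sin R).
Proof. by apply: continuous_measurable_fun; exact: continuous_sin. Qed.

Lemma measurable_cos : measurable_fun setT (@cos R).
Proof. by apply: continuous_measurable_fun; exact: continuous_cos. Qed.

Lemma MVT_real (f df : R -> R) a b : (forall x, is_derive x 1 f (df x)) ->
  a < b -> exists2 c, a < c < b & f b - f a = df c * (b - a).
Proof.
move=> fdf ab; have [|c] := @MVT R f df a b ab.
  by apply: derivable_within_continuous => x _; exact: ex_derive.
by rewrite in_itv/= => abc e; exists c.
Qed.

Lemma sin_ge0_le x : 0 <= x -> sin x <= x.
Proof.
rewrite le_eqVlt => /predU1P[<-|x0]; first by rewrite sin0.
have [c _] := @MVT_real (fun y => y - sin y) (fun y => 1 - cos y) 0 x _ x0.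
rewrite sin0 !subr0 => e.
by rewrite -subr_ge0 e mulr_ge0 ?subr_ge0 ?cos_le1// ltW.
Qed.

Lemma normr_sin_le x : `|sin x| <= `|x|.
Proof.
wlog x0 : x / 0 <= x => [h|].
  have [/h//|/ltW x0] := leP 0 x.
  by rewrite -normrN -sinN -[leRHS]normrN; apply: h; rewrite oppr_ge0.
rewrite (ger0_norm x0) ler_norml sin_ge0_le// andbT.
have [x1|x1] := leP x 1; last by rewrite (le_trans _ (sin_geN1 x))// lerN2 ltW.
rewrite (@le_trans _ _ 0)// ?oppr_le0//.
have [->|xN0] := eqVneq x 0; first by rewrite sin0.
by rewrite ltW// sin2_gt0// lt_neqAle eq_sym xN0 x0/= (le_lt_trans x1)// ltr1n.
Qed.

Lemma cos_halfE x : 1 - cos x = 2 * sin (x / 2) ^+ 2.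
Proof.
rewrite sin2cos2 [in LHS](_ : x = (x / 2) *+ 2) ?cos_mulr2n; first by ring.
by rewrite -mulr_natr divfK.
Qed.

Lemma cos_ge x : 1 - x ^+ 2 / 2 <= cos x.
Proof.
have := cos_halfE x; have := normr_sin_le (x / 2).
rewrite -ler_sqr ?nnegrE// !real_normK ?num_real// => h.
have -> : x ^+ 2 / 2 = 2 * (x / 2) ^+ 2 by field.
by lra.
Qed.

Lemma normr_sinB_le_cube x : `|sin x - x| <= `|x| ^+ 3.
Proof.
wlog x0 : x / 0 <= x => [h|].
  have [/h//|/ltW x0] := leP 0 x.
  rewrite -normrN -(normrN x) opprB addrC -sinN.
  by rewrite -[X in _ + X]opprK; apply: h; rewrite oppr_ge0.
rewrite (ger0_norm x0) ler0_norm ?subr_le0 ?sin_ge0_le//.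
move: x0; rewrite le_eqVlt => /predU1P[<-|x0].
  by rewrite sin0 subr0 oppr0 expr0n.
have dD (y : R) : is_derive y 1 (fun y : R => sin y - y + y ^+ 3) (cos y - 1 + 3 * y ^+ 2).
  by apply: is_derive_eq; rewrite /GRing.scale/=; ring.
have [c /andP[c0 cx]] := @MVT_real _ _ 0 x dD x0.
rewrite sin0 !subr0 expr0n addr0 subr0 => e.
rewrite -subr_ge0 opprB addrC (_ : _ + _ = sin x - x + x ^+ 3); last by ring.
rewrite e mulr_ge0 ?ltW//; have := cos_ge c; have := sqr_ge0 c; nra.
Qed.

Lemma normr_sinB_le_sqr x : `|sin x - x| <= 2 * x ^+ 2.
Proof.
rewrite -[x ^+ 2]real_normK ?num_real//.
have [x1|x1] := leP `|x| 1.
  rewrite (le_trans (normr_sinB_le_cube x))//; have := normr_ge0 x; nra.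
rewrite (le_trans (ler_normB _ _))//; have := normr_sin_le x; nra.
Qed.

Lemma cosB_ge0_le x : 0 <= cos x - 1 + x ^+ 2 / 2 <= x ^+ 2 / 2.
Proof. by have := cos_ge x; have := cos_le1 x; move=> ? ?; apply/andP; split; lra. Qed.

(** By 1 - cos(2y) = 2 sin(y)^2, this is a bound on y^2 - sin(y)^2, which factors. *)
Lemma cosB_le_pow4 x : cos x - 1 + x ^+ 2 / 2 <= `|x| ^+ 4.
Proof.
have e := cos_halfE x; set y := x / 2 in e.
have -> : x = 2 * y by rewrite /y; field.
have := normr_sinB_le_cube y; have := normr_sin_le y.
rewrite -(_ : - 2 * sin y ^+ 2 = cos (2 * y) - 1)//; last first.
  have -> : 2 * y = x by rewrite /y; field.
  by move: e; lra.
rewrite (normrM 2 y) (ger0_norm (ler0n R 2)) => h1 h2.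
have -> : - 2 * sin y ^+ 2 + (2 * y) ^+ 2 / 2 = 2 * ((y - sin y) * (y + sin y)) by field.
have h3 : (y - sin y) * (y + sin y) <= `|y| ^+ 3 * (2 * `|y|).
  rewrite (le_trans (ler_norm _))// normrM ler_pM// 1?distrC//.
  by rewrite (le_trans (ler_normD _ _))//; lra.
rewrite (le_trans (ler_wpM2l _ h3))// exprMn.
have -> : 2 * (`|y| ^+ 3 * (2 * `|y|)) = 4 * `|y| ^+ 4 by ring.
by rewrite ler_wpM2r ?exprn_ge0//; lra.
Qed.

(** The upper bound follows from exp(-x) (1 + x) <= 1. *)
Lemma expRB_ge0_le x : 0 <= x -> 0 <= expR (- x) - 1 + x <= x ^+ 2.
Proof.
move=> x0; have h1 := expR_ge1Dx (- x); have h2 := expR_ge1Dx x.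
have h3 : expR (- x) * (1 + x) <= 1.
  by rewrite expRN mulrC ler_pdivrMr ?expR_gt0// mul1r.
have h4 := expR_gt0 (- x).
by apply/andP; split; nra.
Qed.

End taylor_of_sin_and_cos.

(** * The one-dimensional central limit theorem against cosines *)

Section one_dimensional_clt.
Context d (T : measurableType d) (R : realType) {P : probability T R}.
Variables (Y : {RV P >-> R}) (X : nat -> {RV P >-> R}).
Hypothesis indep : mutually_independent X.
Hypothesis law : forall i x, cdf (X i) x = cdf Y x.

Local Notation E f := (Rintegral P setT f).

Let mY : measurable_fun setT Y := @measurable_funPT _ _ _ _ Y.

Variables (g : R -> R).
Hypothesis mg : measurable_fun setT g.

Let mcos (s : R) : measurable_fun setT (fun x => cos (s * g x)).
Proof.
by apply: measurableT_comp; [exact: measurable_cos|exact: measurable_funM].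
Qed.

Let msin (s : R) : measurable_fun setT (fun x => sin (s * g x)).
Proof.
by apply: measurableT_comp; [exact: measurable_sin|exact: measurable_funM].
Qed.

(** The addition formulas express the cosine and the sine of the sum of n + 1
    terms by those of the sum of n terms. *)
Let indep_cos_sin (s th : R) n :
  let S w := th + \sum_(i < n) s * g (X i w) in
  indep_from X n (fun w => cos (S w)) /\ indep_from X n (fun w => sin (S w)).
Proof.
move=> S; rewrite {}/S; elim: n => [|n [ihc ihs]].
  split; under eq_fun do rewrite big_ord0 addr0 -[_ th]mulr1;
    by apply: indep_fromZ; exact: indep_from0.
have c1 := proj1 (indep_fromM ihc (mcos s) (fun x => cos_max (s * g x))).
have c2 := proj1 (indep_fromM ihs (mcos s) (fun x => cos_max (s * g x))).
have s1 := proj1 (indep_fromM ihc (msin s) (fun x => sin_max (s * g x))).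
have s2 := proj1 (indep_fromM ihs (msin s) (fun x => sin_max (s * g x))).
split.
- apply: eq_indep_from (indep_fromD c1 (indep_fromZ (-1) s2)) => w /=.
  by rewrite mulN1r [in RHS]big_ord_recr/= addrA [RHS]cosD.
- apply: eq_indep_from (indep_fromD c2 s1) => w /=.
  by rewrite addrC [in RHS]big_ord_recr/= addrA [RHS]sinD addrC.
Qed.

(** One step multiplies the expectation by E cos (s g(Y)), up to the term with
    the sine; comparing it with a multiplication by b costs an error that is
    the same at each step. *)
Lemma expectR_cos_sum_le (s th b : R) n : 0 <= b <= 1 ->
  `|E (fun w => cos (th + \sum_(i < n) s * g (X i w))) - b ^+ n * cos th| <=
  n%:R * (`|E (fun w => cos (s * g (Y w))) - b| +
          `|E (fun w => sin (s * g (Y w)))|).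
Proof.
move=> /andP[b0 b1]; elim: n => [|n ih].
  under eq_expectR do rewrite big_ord0 addr0.
  by rewrite expectR_cst expr0 mul1r subrr normr0 mul0r.
have [ic is_] := indep_cos_sin s th n.
set c := E (fun w => cos (s * g (Y w))) in ih *.
set sg := E (fun w => sin (s * g (Y w))) in ih *.
set C := E (fun w => cos (th + \sum_(i < n) s * g (X i w))) in ih *.
pose S := E (fun w => sin (th + \sum_(i < n) s * g (X i w))).
have bcos (f : T -> R) : measurable_fun setT f -> `|E (fun w => cos (f w))| <= 1.
  move=> mf; apply: norm_expectR_le => [|w]; last exact: cos_max.
  by apply: measurableT_comp => //; exact: measurable_cos.
have [mc [kc bc] _] := ic; have [ms [ks bs] _] := is_.
have C1 : `|C| <= 1 by apply: norm_expectR_le => // w; exact: cos_max.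
have S1 : `|S| <= 1 by apply: norm_expectR_le => // w; exact: sin_max.
have iY (f : R -> R) : measurable_fun setT f -> (forall x, `|f x| <= 1) ->
    integrableR P (f \o Y).
  move=> mf f1; apply: (@bounded_integrableR _ _ _ _ _ 1) => [|w]; last exact: f1.
  exact: measurableT_comp.
have [d1 e1] := indep_fromM ic (mcos s) (fun x => cos_max (s * g x)).
have [d2 e2] := indep_fromM is_ (msin s) (fun x => sin_max (s * g x)).
have -> : E (fun w => cos (th + \sum_(i < n.+1) s * g (X i w))) = C * c - S * sg.
  have -> : c = E ((fun x => cos (s * g x)) \o X n).
    by rewrite (iid_expectR law n (mcos s))//; apply: iY => // x; exact: cos_max.
  have -> : sg = E ((fun x => sin (s * g x)) \o X n).
    by rewrite (iid_expectR law n (msin s))//; apply: iY => // x; exact: sin_max.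
  rewrite -e1 -e2 -expectRB.
  - by apply: eq_expectR => w; rewrite [in LHS]big_ord_recr/= addrA [LHS]cosD.
  - by have [m1 [k1 b1'] _] := d1; exact: bounded_integrableR m1 b1'.
  - by have [m1 [k1 b1'] _] := d2; exact: bounded_integrableR m1 b1'.
have -> : C * c - S * sg - b ^+ n.+1 * cos th =
    b * (C - b ^+ n * cos th) + C * (c - b) - S * sg by rewrite exprS; ring.
rewrite (le_trans (ler_normB _ _))// -natr1 mulrDl mul1r addrA lerD//; last first.
  by rewrite normrM ler_piMl.
rewrite (le_trans (ler_normD _ _))// lerD//.
  rewrite normrM (ger0_norm b0) (le_trans _ ih)// ler_piMl//.
by rewrite normrM ler_piMl.
Qed.

Hypothesis g2 : integrableR P (fun w => g (Y w) ^+ 2).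
Hypothesis g0 : E (g \o Y) = 0.

Let mgY : measurable_fun setT (fun w => g (Y w)).
Proof. exact: measurableT_comp mg mY. Qed.

Let sq n : (Num.sqrt n.+1%:R)^-1 ^+ 2 = n.+1%:R^-1 :> R.
Proof. by rewrite exprVn sqr_sqrtr// ler0n. Qed.

Let isq_cvg0 : (Num.sqrt n.+1%:R)^-1 @[n --> \oo] --> (0 : R).
Proof.
rewrite (_ : (fun n => _) = (fun n => Num.sqrt (harmonic n))); last first.
  by apply/funext => n; rewrite /harmonic/= sqrtrV.
rewrite -[X in _ --> X]sqrtr0.
by apply: continuous_cvg; [exact: sqrt_continuous|exact: cvg_harmonic].
Qed.

Let inv_cvg0 (c : R) : c * (Num.sqrt n.+1%:R)^-1 @[n --> \oo] --> (0 : R).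
Proof. by rewrite -(mulr0 c); apply: cvgM => //; exact: cvg_cst. Qed.

(** The second order Taylor remainder, multiplied by n, tends to 0 pointwise and
    is dominated by the square of g. *)
Let cos_cvg : n.+1%:R * (E (fun w => cos ((Num.sqrt n.+1%:R)^-1 * g (Y w))) - 1
    + E (fun w => g (Y w) ^+ 2) / 2 / n.+1%:R) @[n --> \oo] --> (0 : R).
Proof.
pose r n w := n.+1%:R * (cos ((Num.sqrt n.+1%:R)^-1 * g (Y w)) - 1 +
   ((Num.sqrt n.+1%:R)^-1 * g (Y w)) ^+ 2 / 2).
have mc n : measurable_fun setT (fun w => cos ((Num.sqrt n.+1%:R)^-1 * g (Y w))).
  exact: measurableT_comp (mcos _) mY.
have ic n : integrableR P (fun w => cos ((Num.sqrt n.+1%:R)^-1 * g (Y w))).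
  by apply: (@bounded_integrableR _ _ _ _ _ 1) => // w; exact: cos_max.
have rE n w : r n w = n.+1%:R * (cos ((Num.sqrt n.+1%:R)^-1 * g (Y w)) - 1)
    + 2^-1 * g (Y w) ^+ 2.
  rewrite /r exprMn sq; field.
  by rewrite nat1r pnatr_eq0.
rewrite (_ : (fun n => _) = (fun n => E (r n))); last first.
  apply/funext => n; under [RHS]eq_expectR do rewrite rE.
  rewrite expectRD; last 2 first.
  - by apply: integrableRZ; apply: integrableRB => //; exact: integrableR_cst.
  - exact: integrableRZ.
  rewrite !expectRZ//; last by apply: integrableRB => //; exact: integrableR_cst.
  rewrite expectRB//; last exact: integrableR_cst.
  by rewrite expectR_cst; field; rewrite nat1r pnatr_eq0.
rewrite -[X in _ --> X](@expectR_cst _ _ _ P).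
apply: (@dominated_cvgR _ _ _ _ _ _ (fun w => g (Y w) ^+ 2)) => //.
- move=> n; rewrite (_ : r n = fun w => n.+1%:R * (cos ((Num.sqrt n.+1%:R)^-1 * g (Y w)) - 1) + 2^-1 * g (Y w) ^+ 2); last exact/funext.
  apply: measurable_funD; apply: measurable_funM => //; last exact: measurable_funX.
  exact: measurable_funB.
- move=> n w; have /andP[h1 h2] := cosB_ge0_le ((Num.sqrt n.+1%:R)^-1 * g (Y w)).
  rewrite ger0_norm /r ?mulr_ge0//.
  rewrite (le_trans (ler_wpM2l _ h2))// exprMn sq.
  have := sqr_ge0 (g (Y w)); rewrite -mulrA mulVKf ?pnatr_eq0//; lra.
- move=> w; pose c := `|g (Y w)| ^+ 4.
  have c_cvg : c * (Num.sqrt n.+1%:R)^-1 * (Num.sqrt n.+1%:R)^-1 @[n --> \oo] --> (0 : R).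
    by rewrite -(mulr0 0); apply: cvgM.
  apply: (@squeeze_cvgr _ _ _ _ (fun=> 0) _ _ _ _ _ c_cvg); last exact: cvg_cst.
  apply: nearW => n; rewrite /r.
  have /andP[h1 _] := cosB_ge0_le ((Num.sqrt n.+1%:R)^-1 * g (Y w)).
  rewrite mulr_ge0//=; have := cosB_le_pow4 ((Num.sqrt n.+1%:R)^-1 * g (Y w)).
  move=> /(ler_wpM2l (ler0n R n.+1)) /le_trans; apply.
  rewrite normrM exprMn -/c ger0_norm ?invr_ge0 ?sqrtr_ge0//.
  have -> : (Num.sqrt n.+1%:R)^-1 ^+ 4 = n.+1%:R^-1 * n.+1%:R^-1 :> R.
    by rewrite (exprM _ 2 2) sq expr2.
  have ss : (Num.sqrt n.+1%:R)^-1 * (Num.sqrt n.+1%:R)^-1 = n.+1%:R^-1 :> R.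
    by rewrite -expr2 sq.
  by rewrite -[leRHS]mulrA ss -[X in _ * X]mulrA mulVKf ?pnatr_eq0// mulrC.
Qed.

Let sin_cvg : n.+1%:R * E (fun w => sin ((Num.sqrt n.+1%:R)^-1 * g (Y w)))
  @[n --> \oo] --> (0 : R).
Proof.
pose r n w := n.+1%:R * (sin ((Num.sqrt n.+1%:R)^-1 * g (Y w)) -
   (Num.sqrt n.+1%:R)^-1 * g (Y w)).
have ms n : measurable_fun setT (fun w => sin ((Num.sqrt n.+1%:R)^-1 * g (Y w))).
  exact: measurableT_comp (msin _) mY.
have is_ n : integrableR P (fun w => sin ((Num.sqrt n.+1%:R)^-1 * g (Y w))).
  by apply: (@bounded_integrableR _ _ _ _ _ 1) => // w; exact: sin_max.
have ig : integrableR P (fun w => g (Y w)) by exact: integrableR_sqr.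
rewrite (_ : (fun n => _) = (fun n => E (r n))); last first.
  apply/funext => n; rewrite expectRZ; last first.
    by apply: integrableRB => //; exact: integrableRZ.
  rewrite expectRB//; last exact: integrableRZ.
  by rewrite expectRZ// [E (fun w => g _)]g0 mulr0 subr0.
rewrite -[X in _ --> X](@expectR_cst _ _ _ P).
apply: (@dominated_cvgR _ _ _ _ _ _ (fun w => 2 * g (Y w) ^+ 2)) => //.
- move=> n; apply: measurable_funM => //; apply: measurable_funB => //.
  exact: measurable_funM.
- exact: integrableRZ.
- move=> n w; rewrite /r normrM ger0_norm//.
  have /(ler_wpM2l (ler0n R n.+1)) := normr_sinB_le_sqr ((Num.sqrt n.+1%:R)^-1 * g (Y w)).
  move=> /le_trans; apply; rewrite exprMn sq mulrCA [X in _ * X]mulrA divff ?pnatr_eq0//.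
  by rewrite mul1r.
- move=> w; pose c := `|g (Y w)| ^+ 3.
  apply: norm_cvg0.
  apply: (@squeeze_cvgr _ _ _ _ (fun=> 0) _ _ _ _ _ (inv_cvg0 c)); last exact: cvg_cst.
  apply: nearW => n; rewrite /r normr_ge0/= normrM ger0_norm//.
  have := normr_sinB_le_cube ((Num.sqrt n.+1%:R)^-1 * g (Y w)).
  move=> /(ler_wpM2l (ler0n R n.+1)) /le_trans; apply.
  rewrite normrM exprMn -/c ger0_norm ?invr_ge0 ?sqrtr_ge0//.
  rewrite exprS sq -[X in _ * X]mulrA mulrCA mulVKf ?pnatr_eq0//.
  by rewrite mulrC.
Qed.

(** The factor b_n = exp(- v / (2n)) has n-th power exp(- v / 2), while the errors
    of one step, compared with b_n, are o(1/n). *)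
Theorem clt_cos th : E (fun w => cos (th + \sum_(i < n) (Num.sqrt n%:R)^-1 * g (X i w)))
  @[n --> \oo] --> cos th * expR (- E (fun w => g (Y w) ^+ 2) / 2).
Proof.
set v := E _; have v0 : 0 <= v by apply: expectR_ge0 => w; exact: sqr_ge0.
rewrite -(cvg_shiftS (fun n => E (fun w => cos (th + \sum_(i < n) (Num.sqrt n%:R)^-1 * g (X i w))))) /=.
pose b n := expR (- (v / 2 / n.+1%:R)).
have vn0 n : 0 <= v / 2 / n.+1%:R by rewrite !mulr_ge0.
have b01 n : 0 <= b n <= 1 by rewrite expR_ge0/= -[leRHS]expR0 ler_expR oppr_le0.
have bE n : b n ^+ n.+1 * cos th = cos th * expR (- v / 2).
  rewrite -expRM_natl mulrC mulrN; congr (_ * expR _).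
  by field; rewrite nat1r pnatr_eq0.
have b_cvg : n.+1%:R * (b n - 1 + v / 2 / n.+1%:R) @[n --> \oo] --> (0 : R).
  apply: (@squeeze_cvgr _ _ _ _ (fun=> 0) (fun n => (v / 2) ^+ 2 * harmonic n)).
  - apply: nearW => n; have /andP[h1 h2] := expRB_ge0_le (vn0 n).
    rewrite mulr_ge0//= (le_trans (ler_wpM2l _ h2))//.
    rewrite [X in _ * X]expr2 [X in X <= _](_ : _ = (v / 2) ^+ 2 / n.+1%:R)//.
    by field; rewrite nat1r pnatr_eq0.
  - exact: cvg_cst.
  - by rewrite -(mulr0 ((v / 2) ^+ 2)); apply: cvgM; [exact: cvg_cst|exact: cvg_harmonic].
apply/subr_cvg0; apply: norm_cvg0.
pose er n := `|n.+1%:R * (E (fun w => cos ((Num.sqrt n.+1%:R)^-1 * g (Y w))) - 1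
    + v / 2 / n.+1%:R)| + `|n.+1%:R * (b n - 1 + v / 2 / n.+1%:R)| +
   `|n.+1%:R * E (fun w => sin ((Num.sqrt n.+1%:R)^-1 * g (Y w)))|.
have er0 : er n @[n --> \oo] --> (0 : R).
  rewrite -(addr0 0) -[X in X + _](addr0 0); apply: cvgD; first apply: cvgD.
  - by rewrite -[X in _ --> X](@normr0 R R); apply: cvg_norm; exact: cos_cvg.
  - by rewrite -[X in _ --> X](@normr0 R R); apply: cvg_norm.
  - by rewrite -[X in _ --> X](@normr0 R R); apply: cvg_norm.
apply: (@squeeze_cvgr _ _ _ _ (fun=> 0) _ _ _ _ _ er0); last exact: cvg_cst.
apply: nearW => n; rewrite normr_ge0/= /cst -(bE n).
apply: (le_trans (expectR_cos_sum_le _ _ _ (b01 n))).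
rewrite /er !normrM (ger0_norm (ler0n R n.+1)) -!mulrDr ler_wpM2l// lerD2r.
apply: (le_trans _ (ler_normB _ _)).
by rewrite le_eqVlt; apply/orP; left; apply/eqP; congr `|_|; ring.
Qed.

End one_dimensional_clt.

(** * The characteristic function of the normal law *)

Section characteristic_function_of_the_normal_law.
Context {R : realType} (sigma th : R).
Hypothesis s0 : sigma != 0.

Local Notation mu := (@lebesgue_measure R).
Local Notation p := (normal_pdf 0 sigma).

Let s2 : 0 < sigma ^+ 2. Proof. by rewrite exprn_even_gt0. Qed.

Let pE x : p x = normal_peak sigma * expR (- x ^+ 2 / (sigma ^+ 2 *+ 2)).
Proof. by rewrite normal_pdfE//= /normal_fun subr0. Qed.

Let is_derive_p (x : R) : is_derive x 1 p (- (x / sigma ^+ 2) * p x).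
Proof.
rewrite (_ : p = fun x => normal_peak sigma * expR (- x ^+ 2 / (sigma ^+ 2 *+ 2))); last first.
  by apply/funext => y; exact: pE.
apply: is_derive_eq; rewrite /GRing.scale/=.
by field.
Qed.

Let mp : measurable_fun setT p. Proof. exact: measurable_normal_pdf. Qed.

Let p0 x : 0 <= p x. Proof. exact: normal_pdf_ge0. Qed.

Let ip : mu.-integrable setT (EFin \o p). Proof. exact: integrable_normal_pdf. Qed.

Let integrable_bounded (f : R -> R) c : measurable_fun setT f ->
  (forall x, `|f x| <= c * p x) -> mu.-integrable setT (EFin \o f).
Proof.
move=> mf fc; apply: (@le_integrable _ _ _ mu setT measurableT _ (fun x => c%:E * (p x)%:E)%E).
- exact/measurable_EFinP.
- move=> x _ /=; rewrite lee_fin (le_trans (fc x))//; exact: ler_norm.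
- exact: integrableZl.
Qed.

(** The factor x is absorbed by half of the exponent, which leaves the density
    of a normal law with twice the variance. *)
Let integrable_xp : mu.-integrable setT (EFin \o (fun x => `|x| * p x)).
Proof.
pose s' := Num.sqrt 2 * sigma.
have s'0 : s' != 0 by rewrite mulf_neq0// gt_eqF// sqrtr_gt0.
have s'2 : s' ^+ 2 = 2 * sigma ^+ 2 by rewrite exprMn sqr_sqrtr.
pose c := (1 + 4 * sigma ^+ 2) * normal_peak sigma / normal_peak s'.
apply: (@le_integrable _ _ _ mu setT measurableT _ (fun x => c%:E * (normal_pdf 0 s' x)%:E)%E).
- apply/measurable_EFinP; exact: measurable_funM.
- move=> x _ /=; rewrite lee_fin normrM normr_id (ger0_norm (p0 x)).
  apply: (le_trans _ (ler_norm _)).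
  rewrite pE normal_pdfE//= /normal_fun subr0 s'2.
  rewrite [leRHS](_ : _ = normal_peak sigma * ((1 + 4 * sigma ^+ 2) * expR (- x ^+ 2 / (2 * sigma ^+ 2 *+ 2)))); last first.
    rewrite /c; field.
    by rewrite gt_eqF// normal_peak_gt0.
  rewrite mulrCA ler_wpM2l ?normal_peak_ge0//.
  have -> : - x ^+ 2 / (sigma ^+ 2 *+ 2) = - (x ^+ 2 / (4 * sigma ^+ 2)) + (- x ^+ 2 / (2 * sigma ^+ 2 *+ 2)) by field.
  rewrite expRD mulrA ler_wpM2r ?expR_ge0// expRN ler_pdivrMr ?expR_gt0//.
  have y0 : 0 <= x ^+ 2 / (4 * sigma ^+ 2) by rewrite mulr_ge0 ?sqr_ge0// invr_ge0 mulr_ge0// ltW.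
  apply: (@le_trans _ _ ((1 + 4 * sigma ^+ 2) * (1 + x ^+ 2 / (4 * sigma ^+ 2)))).
    have -> : (1 + 4 * sigma ^+ 2) * (1 + x ^+ 2 / (4 * sigma ^+ 2)) =
      1 + 4 * sigma ^+ 2 + x ^+ 2 / (4 * sigma ^+ 2) + x ^+ 2 by field.
    have := sqr_ge0 (`|x| - 1); rewrite -[x ^+ 2]real_normK ?num_real// in y0 *.
    by nra.
  rewrite ler_wpM2l//; last exact: expR_ge1Dx.
  by rewrite addr_ge0// mulr_ge0// ltW.
- by apply: integrableZl => //; exact: integrable_normal_pdf.
Qed.

Let mcos (t : R) : measurable_fun setT (fun x => cos (th + t * x)).
Proof. by apply: measurableT_comp; [exact: measurable_cos|apply: measurable_funD => //; exact: measurable_funM]. Qed.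

Let msin (t : R) : measurable_fun setT (fun x => sin (th + t * x)).
Proof. by apply: measurableT_comp; [exact: measurable_sin|apply: measurable_funD => //; exact: measurable_funM]. Qed.

Let icos (t : R) : mu.-integrable setT (EFin \o (fun x => cos (th + t * x) * p x)).
Proof.
apply: (@integrable_bounded _ 1); first exact: measurable_funM.
by move=> x; rewrite normrM (ger0_norm (p0 x)) ler_wpM2r// cos_max.
Qed.

Let ixsin (t : R) : mu.-integrable setT (EFin \o (fun x => x * sin (th + t * x) * p x)).
Proof.
apply: (@le_integrable _ _ _ mu setT measurableT _ (EFin \o (fun x => `|x| * p x))) => //.
- have mxs : measurable_fun setT (fun x : R => x * sin (th + t * x)).
    exact: measurable_funM.
  by apply/measurable_EFinP; exact: measurable_funM.
- move=> x _ /=; rewrite lee_fin !normrM normr_id ler_wpM2r//.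
  by rewrite ler_piMr// sin_max.
Qed.

(** Boundary terms of the integration by parts. *)
Let p_cvg0 : p n.+1%:R @[n --> \oo] --> (0 : R).
Proof.
pose c := normal_peak sigma * (sigma ^+ 2 *+ 2).
have c_cvg : c * harmonic n @[n --> \oo] --> (0 : R).
  by rewrite -(mulr0 c); apply: cvgM; [exact: cvg_cst|exact: cvg_harmonic].
apply: (@squeeze_cvgr _ _ _ _ (fun=> 0) _ _ _ _ _ c_cvg); last exact: cvg_cst.
apply: nearW => n; rewrite p0/= pE /c -mulrA ler_wpM2l ?normal_peak_ge0//.
rewrite mulNr expRN invf_ple ?posrE ?expR_gt0 ?mulr_gt0 ?pmulrn_lgt0 ?invr_gt0//.
rewrite (le_trans _ (expR_ge1Dx _))// /harmonic/= invfM invrK.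
rewrite (@le_trans _ _ (n.+1%:R ^+ 2 / (sigma ^+ 2 *+ 2)))//; last by rewrite lerDr.
rewrite mulrC ler_wpM2r ?invr_ge0 ?pmulrn_lge0 ?sqr_ge0//.
by rewrite expr2 ler_peMr// ler1n.
Qed.

(** Integration by parts against the density, whose derivative is
    - x / sigma^2 times itself. *)
Let stein (t : R) : \int[mu]_x (x * sin (th + t * x) * p x) =
  sigma ^+ 2 * t * \int[mu]_x (cos (th + t * x) * p x).
Proof.
pose f x := x * sin (th + t * x) * p x - sigma ^+ 2 * t * (cos (th + t * x) * p x).
pose F x := - sigma ^+ 2 * (sin (th + t * x) * p x).
have dF (x : R) : is_derive x 1 F (f x).
  have dp := is_derive_p x.
  have ds : is_derive x 1 (fun x : R => sin (th + t * x)) (t * cos (th + t * x)).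
    by apply: is_derive_eq; rewrite /GRing.scale/=; ring.
  rewrite /F; apply: is_derive_eq; rewrite /GRing.scale/= /f.
  by field.
have cF : continuous F.
  by move=> x; apply: differentiable_continuous; apply/derivable1_diffP; exact: ex_derive.
have cp : continuous p by exact: continuous_normal_pdf.
have cid : continuous (fun x : R => x) by move=> x; exact: cvg_id.
have ctx : continuous (fun x : R => th + t * x).
  move=> x; apply: cvgD; first exact: cvg_cst.
  by apply: cvgM; [exact: cvg_cst|exact: cvg_id].
have cf : continuous f.
  move=> x; apply: cvgB.
    apply: cvgM; last exact: cp.
    by apply: cvgM; [exact: cvg_id|apply: continuous_comp; [exact: ctx|exact: continuous_sin]].
  apply: cvgM; first exact: cvg_cst.
  by apply: cvgM; [apply: continuous_comp; [exact: ctx|exact: continuous_cos]|exact: cp].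
have if_ : mu.-integrable setT (EFin \o f).
  have h1 := integrableZl measurableT (sigma ^+ 2 * t) (icos t).
  have h2 := integrableB measurableT (ixsin t) h1.
  by apply: eq_integrable h2.
have intf n : (\int[mu]_(x in `[(- n.+1%:R)%R, n.+1%:R%R]) (f x)%:E)%E =
    (F n.+1%:R - F (- n.+1%:R))%:E.
  rewrite EFinB; apply: continuous_FTC2.
  - by rewrite ltrNl (lt_le_trans _ (ler0n _ _))// ltrN10.
  - exact: continuous_subspaceT.
  - split => [x _||]; first exact: ex_derive.
      by apply: cvg_at_right_filter; exact: cF.
    by apply: cvg_at_left_filter; exact: cF.
  - by move=> x _; rewrite derive1E; exact: derive_val.
have Fn n : `|F n.+1%:R - F (- n.+1%:R)| <= 2 * sigma ^+ 2 * p n.+1%:R.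
  have pN : p (- n.+1%:R) = p n.+1%:R by rewrite !pE sqrrN.
  have Fb x : `|F x| <= sigma ^+ 2 * p x.
    rewrite /F !normrM normrN (ger0_norm (ltW s2)) ler_wpM2l ?(ltW s2)//.
    by rewrite (ger0_norm (p0 _)) ler_piMl// sin_max.
  rewrite (le_trans (ler_normB _ _))//; have := Fb n.+1%:R; have := Fb (- n.+1%:R).
  by rewrite pN; lra.
have lim0 : (\int[mu]_(x in `[(- n.+1%:R)%R, n.+1%:R%R]) (f x)%:E)%E @[n --> \oo] --> (0%:E).
  under eq_cvg do rewrite intf.
  apply: cvg_EFin; first exact: nearW.
  apply: norm_cvg0.
  have c_cvg : 2 * sigma ^+ 2 * p n.+1%:R @[n --> \oo] --> (0 : R).
    rewrite -[X in _ --> X](mulr0 (2 * sigma ^+ 2)).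
    by apply: cvgM; first exact: cvg_cst.
  apply: (@squeeze_cvgr _ _ _ _ (fun=> 0) _ _ _ _ _ c_cvg); last exact: cvg_cst.
  by apply: nearW => n; rewrite normr_ge0/= Fn.
have limf : (\int[mu]_(x in `[(- n.+1%:R)%R, n.+1%:R%R]) (f x)%:E)%E @[n --> \oo] -->
    (\int[mu]_x (f x)%:E)%E.
  under eq_cvg do rewrite integral_mkcond.
  apply: (@dominated_cvg _ _ _ mu setT measurableT _ _ (fun x => `|(f x)%:E|%E)).
  - move=> n; apply/(measurable_restrictT _ _).1 => //.
    apply: measurable_funTS; exact: measurable_int if_.
  - move=> x _; apply: cvg_near_cst.
    near=> n; rewrite patchE mem_set//= in_itv/= -ler_norml.
    near: n; exists (Num.Def.archi_bound `|x|) => //= n /= hn.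
    rewrite ltW// (lt_le_trans (archi_boundP _))// ler_nat.
    exact: leqW.
  - by [].
  - exact: integrable_abse.
  - move=> n x _; rewrite patchE; case: ifP => //.
    by rewrite abse0 abse_ge0.
have : (\int[mu]_x (f x)%:E = 0%:E)%E.
  rewrite -(cvg_lim (@ereal_hausdorff R) limf).
  exact: (cvg_lim (@ereal_hausdorff R) lim0).
have -> : (\int[mu]_x (f x)%:E)%E = (\int[mu]_x f x)%:E.
  by rewrite /Rintegral fineK//; exact: integrable_fin_num if_.
move=> [] /eqP.
rewrite RintegralB//; last exact: (integrableZl _ _ (icos t)).
by rewrite RintegralZl// subr_eq0 => /eqP.
Unshelve. all: by end_near. Qed.

Let phi (t : R) := \int[mu]_x (cos (th + t * x) * p x).

Let is_derive_phi (t : R) : is_derive t 1 phi (- (sigma ^+ 2 * t * phi t)).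
Proof.
have It : `](t - 1), (t + 1)[%classic t by rewrite /= in_itv/= ltrBlDr !ltrDl ltr01.
have d1 (x y : R) : is_derive x 1 (fun t : R => cos (th + t * y) * p y) (- (y * sin (th + x * y) * p y)).
  by apply: is_derive_eq; rewrite /GRing.scale/=; ring.
have p1 x y : partial1of2 (fun t y => cos (th + t * y) * p y) x y = - (y * sin (th + x * y) * p y).
  by rewrite partial1of2E; exact: derive_val.
have bound x y : `](t - 1), (t + 1)[%classic x -> setT y ->
    `|partial1of2 (fun t y => cos (th + t * y) * p y) x y| <= `|y| * p y.
  move=> _ _; rewrite p1 normrN !normrM (ger0_norm (p0 y)) ler_wpM2r//.
  by rewrite ler_piMr// sin_max.
have G0 y : 0 <= `|y| * p y by rewrite mulr_ge0.
have dd (x y : R) : `](t - 1), (t + 1)[%classic x -> setT y ->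
  derivable (fun t : R => cos (th + t * y) * p y) x 1 by move=> _ _; exact: ex_derive.
apply: DeriveDef.
  exact: (derivable_under_integral measurableT It (fun x _ => icos x) dd G0 integrable_xp bound).
rewrite -derive1E.
rewrite (differentiation_under_integral measurableT It (fun x _ => icos x) dd G0 integrable_xp bound).
transitivity (\int[mu]_y (- 1 * (y * sin (th + t * y) * p y))).
  by apply: eq_Rintegral => y _; rewrite p1 mulN1r.
by rewrite RintegralZl// stein mulN1r.
Qed.

(** By [is_derive_phi] the product of phi with exp(sigma^2 t^2 / 2) is constant. *)
Let phiE t : phi t = cos th * expR (- (sigma ^+ 2 * t ^+ 2) / 2).
Proof.
pose H t := expR (sigma ^+ 2 * t ^+ 2 / 2) * phi t.
have dH (x : R) : is_derive x 1 H 0.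
  have dphi := is_derive_phi x.
  rewrite /H; apply: is_derive_eq; rewrite /GRing.scale/=.
  by field.
have H0 : H 0 = cos th.
  rewrite /H expr0n/= mulr0 mul0r expR0 mul1r /phi.
  under eq_Rintegral do rewrite mul0r addr0.
  rewrite RintegralZl//.
  by rewrite [X in _ * X]/Rintegral integral_normal_pdf mulr1.
have HE x : H x = cos th.
  have [x0|x0|->//] := ltgtP x 0.
    have [c _] := MVT_real dH x0.
    by rewrite mul0r => /eqP; rewrite subr_eq0 H0 => /eqP.
  have [c _] := MVT_real dH x0.
  by rewrite mul0r => /eqP; rewrite subr_eq0 H0 => /eqP.
by rewrite mulNr expRN -(HE t) /H mulrAC divff ?mul1r// gt_eqF// expR_gt0.
Qed.

Let N : probability _ R := normal_prob 0 sigma.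

Let ge0_integral_normal (f : R -> \bar R) : measurable_fun setT f ->
  (forall x, (0 <= f x)%E) ->
  (\int[N]_x f x = \int[mu]_x (f x * (p x)%:E))%E.
Proof.
move=> mf f0; have dom : N `<< mu by exact: normal_prob_dominates.
rewrite -(Radon_Nikodym_SigmaFinite.change_of_variables dom)//.
apply: ae_eq_integral => //.
- apply: emeasurable_funM => //.
  exact: measurable_int (Radon_Nikodym_SigmaFinite.f_integrable dom).
- by apply: emeasurable_funM => //; exact/measurable_EFinP.
- suff h : ae_eq mu setT (Radon_Nikodym_SigmaFinite.f N mu) (fun x => (p x)%:E).
    by apply: filterS h => x /= h Dx; rewrite h.
  apply: integral_ae_eq => //.
  + exact: Radon_Nikodym_SigmaFinite.f_integrable.
  + exact/measurable_EFinP.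
  + by move=> A _ mA; rewrite -(Radon_Nikodym_SigmaFinite.f_integral dom).
Qed.

Context d (T : measurableType d) {P : probability T R}.

(** One is added to the cosine to make it nonnegative, since the change of
    variables to the density is made for nonnegative functions. *)
Lemma expectR_cos_normal (W : {RV P >-> R}) :
  (forall B, measurable B -> P (W @^-1` B) = normal_prob 0 sigma B) ->
  Rintegral P setT (fun w => cos (th + W w)) = cos th * expR (- sigma ^+ 2 / 2).
Proof.
move=> lawW; have mW : measurable_fun setT W := @measurable_funPT _ _ _ _ W.
have mcW : measurable_fun setT (fun x => cos (th + x)).
  by apply: measurableT_comp; [exact: measurable_cos|exact: measurable_funD].
have icW : integrableR P (fun w => cos (th + W w)).
  apply: (@bounded_integrableR _ _ _ _ _ 1) => [|w]; last exact: cos_max.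
  exact: measurableT_comp mcW mW.
have -> : cos th * expR (- sigma ^+ 2 / 2) = phi 1.
  by rewrite phiE expr1n mulr1.
apply: (addrI 1).
have mf : measurable_fun setT (fun x => (1 + cos (th + x))%:E).
  by apply/measurable_EFinP; exact: measurable_funD.
have f0 x : (0 <= (1 + cos (th + x))%:E)%E.
  by rewrite lee_fin; have := cos_geN1 (th + x); lra.
have : (\int[P]_w (1 + cos (th + W w))%:E = \int[mu]_x ((1 + cos (th + x))%:E * (p x)%:E))%E.
  rewrite -ge0_integral_normal//.
  have mW' : @measurable_fun _ _ T (measurableTypeR R) setT W := mW.
  pose W' : {mfun T >-> measurableTypeR R} :=
    @mfun_Sub _ _ T (measurableTypeR R) _ (mem_set mW').
  rewrite -[LHS](@ge0_integral_distribution _ _ _ (measurableTypeR R) _ P W' _ mf f0).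
  by apply: eq_measure_integral => A mA _; exact: lawW.
move=> /(congr1 fine).
rewrite -[LHS]/(Rintegral P setT (fun w => 1 + cos (th + W w))).
rewrite expectRD// ?expectR_cst; last exact: integrableR_cst.
move=> ->.
transitivity (\int[mu]_x (p x + cos (th + 1 * x) * p x)).
  by congr fine; apply: eq_integral => x _; rewrite -EFinM mulrDl !mul1r.
rewrite RintegralD//; congr (_ + _).
by rewrite /Rintegral integral_normal_pdf.
Qed.

End characteristic_function_of_the_normal_law.

(** * Bernstein polynomials and ramps *)

Section bernstein.
Context {R : realType}.
Implicit Types (g : nat -> R) (x : R).

(** The expectation of g(S_n) for the number S_n of successes in n independent
    trials of probability x, by conditioning on one trial; this is the value at
    x of the Bernstein polynomial of g. *)
Fixpoint bern n g x : R :=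
  if n is m.+1 then x * bern m (fun k => g k.+1) x + (1 - x) * bern m g x
  else g 0%N.

Lemma bern_affine n g a b x :
  bern n (fun k => a * g k + b) x = a * bern n g x + b.
Proof. by elim: n g => [|n ih] g //=; rewrite !ih; ring. Qed.

Lemma le_bern n g1 g2 x : 0 <= x <= 1 -> (forall k, g1 k <= g2 k) ->
  bern n g1 x <= bern n g2 x.
Proof.
move=> /andP[x0 x1]; elim: n g1 g2 => [|n ih] g1 g2 g12 //=.
by rewrite lerD// ler_wpM2l ?subr_ge0//; apply: ih => k; exact: g12.
Qed.

Lemma bern_sqr n c x :
  bern n (fun k => (k%:R - c) ^+ 2) x = n%:R * x * (1 - x) + (n%:R * x - c) ^+ 2.
Proof.
elim: n c => [|n ih] c /=; first by ring.
have -> : (fun k : nat => (k.+1%:R - c) ^+ 2) = fun k => (k%:R - (c - 1)) ^+ 2 :> R.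
  by apply/funext => k; rewrite -natr1; congr (_ ^+ 2); ring.
by rewrite !ih -natr1; ring.
Qed.

(** Chebyshev's argument: K |y - x| is at most the quadratic function
    K ((y - x)^2 / e + e) of y, and the variance of the proportion of successes is
    at most 1 / (n + 1). *)
Lemma bern_lipschitz (f : R -> R) (K e : R) n x : 0 < e -> 0 <= K ->
  (forall x y, `|f x - f y| <= K * `|x - y|) -> 0 <= x <= 1 ->
  `|bern n.+1 (fun k => f (k%:R / n.+1%:R)) x - f x| <=
  K * (e + (e * n.+1%:R)^-1).
Proof.
move=> e0 K0 fK x01; have /andP[x0 x1] := x01.
have n0 : n.+1%:R != 0 :> R by rewrite pnatr_eq0.
pose q k : R := K / e / n.+1%:R ^+ 2 * (k%:R - n.+1%:R * x) ^+ 2 + K * e.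
have fq k : `|f (k%:R / n.+1%:R) - f x| <= q k.
  apply: (le_trans (fK _ _)).
  have -> : q k = K * ((k%:R / n.+1%:R - x) ^+ 2 / e + e).
    by rewrite /q; field; rewrite nat1r n0/= gt_eqF.
  rewrite ler_wpM2l// -lerBlDr ler_pdivlMr//.
  rewrite -[_ ^+ 2]real_normK ?num_real//.
  by set y := `|_|; have := sqr_ge0 (y - e); have : 0 <= y := normr_ge0 _; nra.
have Bq : bern n.+1 q x <= K * (e + (e * n.+1%:R)^-1).
  rewrite bern_affine bern_sqr subrr expr0n addr0.
  have -> : K * (e + (e * n.+1%:R)^-1) = K / e / n.+1%:R + K * e.
    by field; rewrite nat1r n0/= gt_eqF.
  rewrite lerD2r.
  have -> : K / e / n.+1%:R ^+ 2 * (n.+1%:R * x * (1 - x)) =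
    K / e / n.+1%:R * (x * (1 - x)) by field; rewrite nat1r n0/= gt_eqF.
  by rewrite ler_piMr ?mulr_ge0 ?invr_ge0 ?(ltW e0)//; nra.
rewrite ler_norml; apply/andP; split.
  rewrite lerNl opprB (le_trans _ Bq)// lerBlDr -lerBlDl.
  have <- : bern n.+1 (fun k => -1 * q k + f x) x = f x - bern n.+1 q x.
    by rewrite bern_affine mulN1r addrC.
  apply: le_bern => // k; have := fq k; rewrite ler_norml => /andP[].
  by lra.
rewrite lerBlDr (le_trans _ (lerD Bq (lexx _)))//.
have <- : bern n.+1 (fun k => 1 * q k + f x) x = bern n.+1 q x + f x.
  by rewrite bern_affine mul1r.
apply: le_bern => // k; have := fq k; rewrite ler_norml => /andP[].
by lra.
Qed.

End bernstein.

Section ramp.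
Context {R : realType}.
Implicit Types p q s : R.

Definition ramp p q s : R := Num.max 0 (Num.min 1 ((q - s) / (q - p))).

Lemma ramp_ge0 p q s : 0 <= ramp p q s.
Proof. by rewrite /ramp le_max lexx. Qed.

Lemma ramp_le1 p q s : ramp p q s <= 1.
Proof. by rewrite /ramp ge_max ler01 ge_min lexx. Qed.

Lemma ramp1 p q s : p < q -> s <= p -> ramp p q s = 1.
Proof.
move=> pq sp; rewrite /ramp (min_idPl _) ?(max_idPr _)//.
by rewrite ler_pdivlMr ?subr_gt0// mul1r lerD2l lerN2.
Qed.

Lemma ramp0 p q s : p < q -> q <= s -> ramp p q s = 0.
Proof.
move=> pq qs; have h : (q - s) / (q - p) <= 0.
  by rewrite pmulr_lle0 ?invr_gt0 ?subr_gt0// subr_le0.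
by rewrite /ramp (min_idPr _) ?(max_idPl _)// (le_trans h).
Qed.

Lemma ramp_lipschitz p q : p < q -> forall s t,
  `|ramp p q s - ramp p q t| <= (q - p)^-1 * `|s - t|.
Proof.
move=> pq s t.
have hmax (x y : R) : `|Num.max 0 x - Num.max 0 y| <= `|x - y|.
  rewrite /Num.max; have [xy|xy] := leP 0 (x - y);
    rewrite ?(ger0_norm xy) ?(ltr0_norm xy);
    by case: ltP => ?; case: ltP => ?; rewrite ler_norml; apply/andP; split; lra.
have hmin (x y : R) : `|Num.min 1 x - Num.min 1 y| <= `|x - y|.
  rewrite /Num.min; have [xy|xy] := leP 0 (x - y);
    rewrite ?(ger0_norm xy) ?(ltr0_norm xy);
    by case: ltP => ?; case: ltP => ?; rewrite ler_norml; apply/andP; split; lra.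
apply: (le_trans (hmax _ _)); apply: (le_trans (hmin _ _)).
rewrite -mulrBl normrM mulrC ger0_norm ?invr_ge0 ?subr_ge0 ?(ltW pq)//.
by rewrite opprD addrACA subrr add0r opprK addrC distrC.
Qed.

Let scaled_pihalf (M v : R) : 0 < M -> `|v| <= M -> - (pi / 2) <= M^-1 * v <= pi / 2.
Proof.
move=> M0 vM; rewrite -ler_norml normrM ger0_norm ?invr_ge0 ?(ltW M0)//.
by rewrite mulrC (le_trans _ (pihalf_ge1 R))// ler_pdivrMr// mul1r.
Qed.

(** On [-M, M] the sine of v / M increases, so that v can be compared with a
    threshold through this sine. *)
Definition sine_ramp (M a b v : R) := ramp (sin (M^-1 * a)) (sin (M^-1 * b)) (sin (M^-1 * v)).

Lemma lt_sin_scaled (M a b : R) : 0 < M -> `|a| <= M -> `|b| <= M -> a < b ->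
  sin (M^-1 * a) < sin (M^-1 * b).
Proof.
move=> M0 aM bM ab; rewrite ltr_sin ?in_itv/=; [|exact: scaled_pihalf..].
by rewrite ltr_pM2l// invr_gt0.
Qed.

Lemma le_sin_scaled (M a b : R) : 0 < M -> `|a| <= M -> `|b| <= M -> a <= b ->
  sin (M^-1 * a) <= sin (M^-1 * b).
Proof.
move=> M0 aM bM; rewrite le_eqVlt => /predU1P[->//|ab].
by rewrite ltW// lt_sin_scaled.
Qed.

Lemma sine_ramp_lexx (M a b v : R) : 0 < M -> `|a| <= M -> `|b| <= M -> a < b ->
  `|v| <= M -> v <= a -> sine_ramp M a b v = 1.
Proof. by move=> M0 aM bM ab vM va; rewrite /sine_ramp ramp1// ?lt_sin_scaled// le_sin_scaled. Qed.

Lemma sine_ramp_gexx (M a b v : R) : 0 < M -> `|a| <= M -> `|b| <= M -> a < b ->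
  `|v| <= M -> b <= v -> sine_ramp M a b v = 0.
Proof. by move=> M0 aM bM ab vM va; rewrite /sine_ramp ramp0// ?lt_sin_scaled// le_sin_scaled. Qed.

Lemma sine_ramp01 (M a b v : R) : 0 <= sine_ramp M a b v <= 1.
Proof. by rewrite ramp_ge0 ramp_le1. Qed.

Lemma ramp_continuous p q : p < q -> continuous (ramp p q).
Proof.
move=> pq x; apply/cvgrPdist_le => /= e e0; near=> y.
rewrite (le_trans (ramp_lipschitz pq _ _))// mulrC ler_pdivrMr ?subr_gt0//.
near: y; apply/nbhs_normP; exists (e * (q - p)); first by rewrite /= mulr_gt0// subr_gt0.
by move=> y /=; move/ltW.
Unshelve. all: by end_near. Qed.

Lemma measurable_ramp p q : p < q -> measurable_fun setT (ramp p q).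
Proof. by move=> pq; apply: continuous_measurable_fun; exact: ramp_continuous. Qed.

Lemma measurable_sine_ramp (M a b : R) : 0 < M -> `|a| <= M -> `|b| <= M -> a < b ->
  measurable_fun setT (sine_ramp M a b).
Proof.
move=> M0 aM bM ab; apply: measurableT_comp.
  by apply: measurable_ramp; exact: lt_sin_scaled.
by apply: measurableT_comp; [exact: measurable_sin|exact: measurable_funM].
Qed.

(** A difference of two ramps is a bump that is 1 on ]a, b] and vanishes off
    ]a', b'[, as long as v stays in [-M, M]. *)
Lemma sine_ramp_window (M a' a b b' v : R) : 0 < M ->
    `|a'| <= M -> `|a| <= M -> `|b| <= M -> `|b'| <= M ->
    a' < a -> a < b -> b < b' ->
  let B := sine_ramp M b b' v - sine_ramp M a' a v in
  [/\ `|B| <= 1, (a < v <= b)%R%:R <= B + 2 * (M < `|v|)%R%:R &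
     B <= (a' < v < b')%R%:R + (M < `|v|)%R%:R].
Proof.
move=> M0 a'M aM bM b'M a'a ab bb' B.
have /andP[u0 u1] := sine_ramp01 M b b' v.
have /andP[d0 d1] := sine_ramp01 M a' a v.
have B1 : `|B| <= 1 by rewrite /B ler_norml; apply/andP; split; lra.
split => //; move: (B1); rewrite ler_norml => /andP[? ?].
- have [vM|vM] := ltP M `|v|; first by case: (a < v <= b) => /=; lra.
  rewrite mulr0 addr0 /B.
  have [av|va] := ltP a v; have [vb|bv] := leP v b => /=.
  + by rewrite (sine_ramp_lexx _ _ _ bb')// (sine_ramp_gexx _ _ _ a'a) ?(ltW av)// subr0.
  + by rewrite [X in _ - X](sine_ramp_gexx _ _ _ a'a)// ?(ltW av)// subr0.
  + by rewrite (sine_ramp_lexx _ _ _ bb')// subr_ge0.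
  + by have := lt_le_trans bv va; rewrite ltNge (ltW ab).
- have [vM|vM] := ltP M `|v|; first by case: (a' < v < b') => /=; lra.
  have [a'v|va'] := ltP a' v; last first.
    have va := le_trans va' (ltW a'a); have vb := le_trans va (ltW ab).
    by rewrite /B (sine_ramp_lexx _ _ _ bb')// ?(sine_ramp_lexx _ _ _ a'a)// subrr addr0.
  have [vb'|b'v] := ltP v b' => /=; first by lra.
  have bv := le_trans (ltW bb') b'v; have av := le_trans (ltW ab) bv.
  by rewrite /B (sine_ramp_gexx _ _ _ bb')// ?(sine_ramp_gexx _ _ _ a'a)// subrr addr0.
Qed.

(** Here j is a decision that is meant to agree with the comparison of v with a
    threshold between a and b; B dominates the indicator of the zone in which
    nothing is known about j. *)
Lemma norm_cutB_sine_ramp (M a b v B : R) (j : bool) : 0 < M ->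
    `|a| <= M -> `|b| <= M -> a < b ->
    (a < v <= b)%R%:R <= B + 2 * (M < `|v|)%R%:R ->
  `|j%:R - sine_ramp M a b v| <=
  (~~ j && (v <= a))%:R + (j && (b < v))%:R + B + 3 * (M < `|v|)%R%:R.
Proof.
move=> M0 aM bM ab.
have /andP[H0 H1] := sine_ramp01 M a b v.
have JH : `|j%:R - sine_ramp M a b v| <= 1.
  by rewrite ler_norml; apply/andP; split; case: j => /=; lra.
have [vM|vM] := ltP M `|v|.
  have := ler0n R (a < v <= b)%R.
  have := ler0n R (~~ j && (v <= a)%R); have := ler0n R (j && (b < v)%R) => /=.
  by lra.
have [va|av] := leP v a.
  have /ltW bv := le_lt_trans va ab; rewrite (ltNge b) bv andbF andbT.
  rewrite (sine_ramp_lexx _ _ _ ab)//.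
  by case: j {JH}; rewrite /= ?subrr ?sub0r ?normr0 ?normrN ?normr1; lra.
have [vb|bv] := leP v b.
  by rewrite /= !andbF !mulr0 !addr0 add0r => /(le_trans JH).
rewrite andbF andbT (sine_ramp_gexx _ _ _ ab)// ?(ltW bv)//.
by case: j {JH}; rewrite /= ?subr0 ?normr0 ?normr1; lra.
Qed.

Lemma norm_ltB_sine_ramp (M a' a r b b' v : R) : 0 < M ->
    `|a| <= M -> `|b| <= M -> a' <= a -> a < r -> r < b -> b <= b' ->
  `|(v < r)%R%:R - sine_ramp M a b v| <= (a' < v < b')%R%:R + (M < `|v|)%R%:R.
Proof.
move=> M0 aM bM a'a ar rb bb'; have ab := lt_trans ar rb.
have /andP[H0 H1] := sine_ramp01 M a b v.
have JH : `|(v < r)%R%:R - sine_ramp M a b v| <= 1.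
  by rewrite ler_norml; apply/andP; split; case: (v < r) => /=; lra.
have [vM|vM] := ltP M `|v|.
  by rewrite (le_trans JH)// lerDr ler0n.
have [va|av] := leP v a.
  by rewrite (sine_ramp_lexx _ _ _ ab)// (le_lt_trans va ar) subrr normr0 addr0.
have [bv|vb] := leP b v.
  rewrite (sine_ramp_gexx _ _ _ ab)// subr0 ltNge (le_trans (ltW rb) bv).
  by rewrite normr0 addr0.
by rewrite (le_lt_trans a'a av) (lt_le_trans vb bb') addr0.
Qed.

End ramp.

(** * Joint convergence against waves *)

Section testing_functions.
Context d (T : measurableType d) (R : realType) {P : probability T R}
        d' (T' : measurableType d') {Q : probability T' R} (I : finType).
Variables (V : nat -> I -> T -> R) (W : I -> T' -> R).
Hypothesis mV : forall n i, measurable_fun setT (V n i).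
Hypothesis mW : forall i, measurable_fun setT (W i).

Local Notation EP f := (Rintegral P setT f).
Local Notation EQ f := (Rintegral Q setT f).

Definition phase (th : R) (u v : I -> R) := cos (th + \sum_i u i * v i).

Hypothesis V_cvg : forall th u,
  EP (fun w => phase th u (fun i => V n i w)) @[n --> \oo] -->
  EQ (fun w => phase th u (W ^~ w)).

Hypothesis V_tight : forall i e, 0 < e -> exists2 M : R, 0 < M &
  (forall n, EP (fun w => (M < `|V n i w|)%R%:R) <= e) /\
  EQ (fun w => (M < `|W i w|)%R%:R) <= e.

Let mphaseV th u n : measurable_fun setT (fun w => phase th u (fun i => V n i w)).
Proof.
apply: measurableT_comp; first exact: measurable_cos.
apply: measurable_funD => //; apply: measurable_sum => i.
exact: measurable_funM.
Qed.

Let mphaseW th u : measurable_fun setT (fun w => phase th u (W ^~ w)).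
Proof.
apply: measurableT_comp; first exact: measurable_cos.
apply: measurable_funD => //; apply: measurable_sum => i.
exact: measurable_funM.
Qed.

(** Joint convergence of a further bounded variable and of V, tested against
    all waves. Indicators of events are reached by enlarging, one coordinate at a
    time, the family of pairs with this property. *)
Definition tested (G_ : nat -> T -> R) (G : T' -> R) :=
  [/\ forall n, measurable_fun setT (G_ n), measurable_fun setT G,
    exists c : R, (forall n w, `|G_ n w| <= c) /\ (forall w, `|G w| <= c) &
    forall th u, EP (fun w => G_ n w * phase th u (fun i => V n i w)) @[n --> \oo] -->
      EQ (fun w => G w * phase th u (W ^~ w))].

Lemma tested1 : tested (fun _ _ => 1) (fun=> 1).
Proof.
split => //; first by exists 1; split => [n w|w]; rewrite normr1.
move=> th u.
rewrite (_ : EQ _ = EQ (fun w => phase th u (W ^~ w))); last first.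
  by apply: eq_expectR => w; rewrite mul1r.
rewrite (_ : (fun n => _) = fun n => EP (fun w => phase th u (fun i => V n i w)))//.
by apply/funext => n; apply: eq_expectR => w; rewrite mul1r.
Qed.

Let iV (f : T -> R) (c : R) th u n : measurable_fun setT f -> (forall w, `|f w| <= c) ->
  integrableR P (fun w => f w * phase th u (fun i => V n i w)).
Proof.
move=> mf fc; apply: (@integrableRM_bounded _ _ _ _ _ _ 1) => //; last by move=> w; exact: cos_max.
exact: bounded_integrableR fc.
Qed.

Let iW (f : T' -> R) (c : R) th u : measurable_fun setT f -> (forall w, `|f w| <= c) ->
  integrableR Q (fun w => f w * phase th u (W ^~ w)).
Proof.
move=> mf fc; apply: (@integrableRM_bounded _ _ _ _ _ _ 1) => //; last by move=> w; exact: cos_max.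
exact: bounded_integrableR fc.
Qed.

Lemma tested_lin G_ G H_ H (a b : R) : tested G_ G -> tested H_ H ->
  tested (fun n w => a * G_ n w + b * H_ n w) (fun w => a * G w + b * H w).
Proof.
move=> [mG_ mG [c [bG_ bG]] cG] [mH_ mH [k [bH_ bH]] cH]; split.
- by move=> n; apply: measurable_funD; apply: measurable_funM.
- by apply: measurable_funD; apply: measurable_funM.
- exists (`|a| * c + `|b| * k); split => [n w|w];
    by rewrite (le_trans (ler_normD _ _))// !normrM lerD// ler_wpM2l.
- move=> th u.
  have eP n : EP (fun w => (a * G_ n w + b * H_ n w) * phase th u (fun i => V n i w)) =
     a * EP (fun w => G_ n w * phase th u (fun i => V n i w)) +
     b * EP (fun w => H_ n w * phase th u (fun i => V n i w)).
    have i1 := iV th u n (mG_ n) (bG_ n); have i2 := iV th u n (mH_ n) (bH_ n).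
    rewrite -!expectRZ// -expectRD; [|exact: integrableRZ..].
    by apply: eq_expectR => w; rewrite mulrDl !mulrA.
  under eq_cvg do rewrite eP.
  have -> : EQ (fun w => (a * G w + b * H w) * phase th u (W ^~ w)) =
     a * EQ (fun w => G w * phase th u (W ^~ w)) +
     b * EQ (fun w => H w * phase th u (W ^~ w)).
    have i1 := iW th u mG bG; have i2 := iW th u mH bH.
    rewrite -!expectRZ// -expectRD; [|exact: integrableRZ..].
    by apply: eq_expectR => w; rewrite mulrDl !mulrA.
  by apply: cvgD; apply: cvgM => //; exact: cvg_cst.
Qed.

Lemma eq_tested G_ G H_ H : (forall n w, G_ n w = H_ n w) -> G =1 H ->
  tested G_ G -> tested H_ H.
Proof.
move=> GH_ GH; have -> : H_ = G_ by apply/funext => n; apply/funext => w; rewrite GH_.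
by have -> : H = G by apply/funext => w; rewrite GH.
Qed.

Lemma tested_expectR G_ G : tested G_ G -> EP (G_ n) @[n --> \oo] --> EQ G.
Proof.
move=> [_ _ _ /(_ 0 (fun=> 0))].
have p1 (v : I -> R) : phase 0 (fun=> 0) v = 1.
  by rewrite /phase big1 ?addr0 ?cos0// => i _; rewrite mul0r.
have -> : (fun n => EP (fun w => G_ n w * phase 0 (fun=> 0) (fun i => V n i w))) =
    (fun n => EP (G_ n)).
  by apply/funext => n; apply: eq_expectR => w; rewrite p1 mulr1.
have -> : EQ (fun w => G w * phase 0 (fun=> 0) (W ^~ w)) = EQ G.
  by apply: eq_expectR => w; rewrite p1 mulr1.
by [].
Qed.

Let sin_phase (i : I) (s th : R) u v : sin (s * v i) * phase th u v =
  2^-1 * phase (th - pi / 2) (fun j => u j + (j == i)%:R * s) v +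
  - 2^-1 * phase (th - pi / 2) (fun j => u j + (j == i)%:R * (- s)) v.
Proof.
have dE (r : R) : \sum_j (u j + (j == i)%:R * r) * v j = \sum_j u j * v j + r * v i.
  under eq_bigr do rewrite mulrDl; rewrite big_split/=; congr (_ + _).
  rewrite (bigD1 i)//= eqxx mul1r big1 ?addr0// => j /negbTE ->.
  by rewrite !mul0r.
rewrite /phase !dE; set A := \sum_j u j * v j; set B := s * v i.
have cpi (x : R) : cos (x - pi / 2) = sin x.
  by rewrite cosB cos_pihalf sin_pihalf mulr0 mulr1 add0r.
have -> : th - pi / 2 + (A + B) = th + A + B - pi / 2 by ring.
have -> : th - pi / 2 + (A + - s * v i) = th + A - B - pi / 2 by rewrite /B; ring.
by rewrite !cpi sinD sinB; field.
Qed.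

(** A sine times a wave is a difference of two waves with shifted frequencies. *)
Lemma tested_sin (i : I) (s : R) G_ G : tested G_ G ->
  tested (fun n w => G_ n w * sin (s * V n i w)) (fun w => G w * sin (s * W i w)).
Proof.
move=> [mG_ mG [c [bG_ bG]] cG]; split.
- move=> n; apply: measurable_funM => //.
  by apply: measurableT_comp; [exact: measurable_sin|exact: measurable_funM].
- apply: measurable_funM => //.
  by apply: measurableT_comp; [exact: measurable_sin|exact: measurable_funM].
- exists c; split => [n w|w]; rewrite normrM.
    by rewrite (le_trans _ (bG_ n w))// ler_piMr// sin_max.
  by rewrite (le_trans _ (bG w))// ler_piMr// sin_max.
- move=> th u; pose u' (r : R) := fun j => u j + (j == i)%:R * r.
  have eP n : EP (fun w => G_ n w * sin (s * V n i w) * phase th u (fun i => V n i w)) =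
     2^-1 * EP (fun w => G_ n w * phase (th - pi / 2) (u' s) (fun i => V n i w)) +
     - 2^-1 * EP (fun w => G_ n w * phase (th - pi / 2) (u' (- s)) (fun i => V n i w)).
    have i1 r := iV (th - pi / 2) (u' r) n (mG_ n) (bG_ n).
    rewrite -!expectRZ// -expectRD; [|exact: integrableRZ..].
    apply: eq_expectR => w; rewrite -mulrA (sin_phase i s th u (fun i => V n i w)).
    by rewrite -/(u' s) -/(u' (- s)); ring.
  under eq_cvg do rewrite eP.
  have -> : EQ (fun w => G w * sin (s * W i w) * phase th u (W ^~ w)) =
     2^-1 * EQ (fun w => G w * phase (th - pi / 2) (u' s) (W ^~ w)) +
     - 2^-1 * EQ (fun w => G w * phase (th - pi / 2) (u' (- s)) (W ^~ w)).
    have i1 r := iW (th - pi / 2) (u' r) mG bG.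
    rewrite -!expectRZ// -expectRD; [|exact: integrableRZ..].
    apply: eq_expectR => w; rewrite -mulrA (sin_phase i s th u (W ^~ w)).
    by rewrite -/(u' s) -/(u' (- s)); ring.
  by apply: cvgD; apply: cvgM => //; exact: cvg_cst.
Qed.

(** The recursion that defines [bern] multiplies by an affine function of the sine
    at each step. *)
Lemma tested_bern (i : I) (s : R) n (g : nat -> R) G_ G : tested G_ G ->
  tested (fun m w => G_ m w * bern n g ((1 + sin (s * V m i w)) / 2))
         (fun w => G w * bern n g ((1 + sin (s * W i w)) / 2)).
Proof.
elim: n g G_ G => [|n ih] g G_ G tG.
  apply: eq_tested (tested_lin (g 0%N) 0 tG tG) => [n w|w] /=;
    by rewrite mul0r addr0 mulrC.
have tS := tested_sin i s tG.
have t1 := tested_lin 2^-1 2^-1 tG tS.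
have t2 := tested_lin 2^-1 (- 2^-1) tG tS.
apply: eq_tested (tested_lin 1 1 (ih (fun k => g k.+1) _ _ t1) (ih g _ _ t2)) => [m w|w] /=.
  by set x := sin _; field.
by set x := sin _; field.
Qed.

(** An approximation in mean, uniform for large n, is enough. *)
Lemma tested_approx G_ G (J_ : nat -> T -> R) (J : T' -> R) : tested G_ G ->
  (forall n, measurable_fun setT (J_ n)) -> measurable_fun setT J ->
  (forall n w, `|J_ n w| <= 1) -> (forall w, `|J w| <= 1) ->
  (forall e, 0 < e -> exists H_ H,
    [/\ tested (fun n w => G_ n w * H_ n w) (fun w => G w * H w),
      (forall n, measurable_fun setT (H_ n)) /\ measurable_fun setT H,
      (forall n w, `|H_ n w| <= 2) /\ (forall w, `|H w| <= 2),
      \forall n \near \oo, EP (fun w => `|J_ n w - H_ n w|) <= e &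
      EQ (fun w => `|J w - H w|) <= e]) ->
  tested (fun n w => G_ n w * J_ n w) (fun w => G w * J w).
Proof.
move=> [mG_ mG [c [bG_ bG]] cG] mJ_ mJ J_1 J1 app; split.
- by move=> n; exact: measurable_funM.
- exact: measurable_funM.
- exists c; split => [n w|w]; rewrite normrM.
    by rewrite (le_trans _ (bG_ n w))// ler_piMr.
  by rewrite (le_trans _ (bG w))// ler_piMr.
move=> th u; apply/cvgrPdist_le => /= e e0.
have c0 : 0 < `|c| + 1 by rewrite ltr_wpDl.
have cG_ n w : `|G_ n w| <= `|c| + 1.
  by rewrite (le_trans (bG_ n w))// (le_trans (ler_norm c))// lerDl.
have cG' w : `|G w| <= `|c| + 1.
  by rewrite (le_trans (bG w))// (le_trans (ler_norm c))// lerDl.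
pose e' := e / 3 / (`|c| + 1).
have e'0 : 0 < e' by rewrite !divr_gt0.
have [H_ [H [[_ _ _ cGH] [mH_ mH] [H_2 H2] JH_ JH]]] := app e' e'0.
have near_P : \forall n \near \oo,
   `|EP (fun w => G_ n w * J_ n w * phase th u (fun i => V n i w)) -
     EP (fun w => G_ n w * H_ n w * phase th u (fun i => V n i w))| <= e / 3.
  near=> n.
  have i1 : integrableR P (fun w => G_ n w * J_ n w * phase th u (fun i => V n i w)).
    apply: (iV (c := (`|c| + 1) * 1)); first exact: measurable_funM.
    by move=> w; rewrite normrM ler_pM.
  have i2 : integrableR P (fun w => G_ n w * H_ n w * phase th u (fun i => V n i w)).
    apply: (iV (c := (`|c| + 1) * 2)); first exact: measurable_funM.
    by move=> w; rewrite normrM ler_pM.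
  have iJH : integrableR P (fun w => `|J_ n w - H_ n w|).
    apply: integrableR_norm; apply: (@bounded_integrableR _ _ _ _ _ 3) => [|w].
      exact: measurable_funB.
    by rewrite (le_trans (ler_normB _ _))// (le_trans (lerD (J_1 n w) (H_2 n w))).
  rewrite -expectRB//.
  apply: (@le_trans _ _ (EP (fun w => (`|c| + 1) * `|J_ n w - H_ n w|))).
    apply: le_norm_expectR.
    - by apply: measurable_funB; [exact: integrableR_measurable i1|exact: integrableR_measurable i2].
    - exact: integrableRZ.
    - move=> w; rewrite -mulrBl -mulrBr !normrM.
      rewrite (@le_trans _ _ (`|G_ n w| * `|J_ n w - H_ n w|))//; last by rewrite ler_wpM2r.
      by rewrite ler_piMr// cos_max.
  rewrite expectRZ// (@le_trans _ _ ((`|c| + 1) * e'))//.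
    by rewrite ler_wpM2l ?(ltW c0)//; near: n.
  by rewrite /e' mulrC divfK// gt_eqF.
have Q_le : `|EQ (fun w => G w * J w * phase th u (W ^~ w)) -
     EQ (fun w => G w * H w * phase th u (W ^~ w))| <= e / 3.
  have i1 : integrableR Q (fun w => G w * J w * phase th u (W ^~ w)).
    apply: (iW (c := (`|c| + 1) * 1)); first exact: measurable_funM.
    by move=> w; rewrite normrM ler_pM.
  have i2 : integrableR Q (fun w => G w * H w * phase th u (W ^~ w)).
    apply: (iW (c := (`|c| + 1) * 2)); first exact: measurable_funM.
    by move=> w; rewrite normrM ler_pM.
  have iJH : integrableR Q (fun w => `|J w - H w|).
    apply: integrableR_norm; apply: (@bounded_integrableR _ _ _ _ _ 3) => [|w].
      exact: measurable_funB.
    by rewrite (le_trans (ler_normB _ _))// (le_trans (lerD (J1 w) (H2 w))).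
  rewrite -expectRB//.
  apply: (@le_trans _ _ (EQ (fun w => (`|c| + 1) * `|J w - H w|))).
    apply: le_norm_expectR.
    - by apply: measurable_funB; [exact: integrableR_measurable i1|exact: integrableR_measurable i2].
    - exact: integrableRZ.
    - move=> w; rewrite -mulrBl -mulrBr !normrM.
      rewrite (@le_trans _ _ (`|G w| * `|J w - H w|))//; last by rewrite ler_wpM2r.
      by rewrite ler_piMr// cos_max.
  rewrite expectRZ// (@le_trans _ _ ((`|c| + 1) * e'))//.
    by rewrite ler_wpM2l ?(ltW c0).
  by rewrite /e' mulrC divfK// gt_eqF.
have e3 : 0 < e / 3 by rewrite divr_gt0.
have /cvgrPdist_le /(_ _ e3) near_H := cGH th u.
near=> n.
have h1 : `|EP (fun w => G_ n w * J_ n w * phase th u (fun i => V n i w)) -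
     EP (fun w => G_ n w * H_ n w * phase th u (fun i => V n i w))| <= e / 3.
  by near: n.
have h2 : `|EQ (fun w => G w * H w * phase th u (W ^~ w)) -
     EP (fun w => G_ n w * H_ n w * phase th u (fun i => V n i w))| <= e / 3.
  by near: n.
move: Q_le h1 h2; rewrite !ler_norml => /andP[? ?] /andP[? ?] /andP[? ?].
by apply/andP; split; lra.
Unshelve. all: by end_near. Qed.

Let measurable_bern n g : measurable_fun setT (bern n g : R -> R).
Proof.
elim: n g => [|n ih] g //=.
by apply: measurable_funD; apply: measurable_funM => //; exact: measurable_funB.
Qed.

(** The ramp is a Lipschitz function of a sine, hence a uniform limit of Bernstein
    polynomials in that sine. *)
Lemma tested_sine_ramp (i : I) (M a b : R) G_ G : 0 < M -> `|a| <= M -> `|b| <= M ->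
  a < b -> tested G_ G ->
  tested (fun n w => G_ n w * sine_ramp M a b (V n i w))
         (fun w => G w * sine_ramp M a b (W i w)).
Proof.
move=> M0 aM bM ab tG; have mr := measurable_sine_ramp M0 aM bM ab.
have r1 v : `|sine_ramp M a b v| <= 1.
  by have /andP[h0 h1] := sine_ramp01 M a b v; rewrite ger0_norm.
have pq := lt_sin_scaled M0 aM bM ab.
set p := sin (M^-1 * a) in pq; set q := sin (M^-1 * b) in pq.
apply: tested_approx => //.
- by move=> n; exact: measurableT_comp.
- exact: measurableT_comp.
move=> e e0.
(* The interval [-1, 1] of values of the sine is rescaled to [0, 1]. *)
pose f x := ramp p q (2 * x - 1); pose K := 2 / (q - p).
have K0 : 0 <= K by rewrite divr_ge0// subr_ge0 ltW.
have fK x y : `|f x - f y| <= K * `|x - y|.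
  rewrite (le_trans (ramp_lipschitz pq _ _))// /K.
  have -> : 2 * x - 1 - (2 * y - 1) = 2 * (x - y) by ring.
  by rewrite normrM (ger0_norm (ler0n R 2)) mulrCA mulrA.
(* The error is also kept below 1, which bounds the polynomial by 2. *)
pose e' := Num.min 1 e.
have e'0 : 0 < e' by rewrite lt_min ltr01.
have [n nB] : exists n, forall x, 0 <= x <= 1 ->
    `|bern n.+1 (fun k => f (k%:R / n.+1%:R)) x - f x| <= e'.
  pose h := e' / (2 * (K + 1)).
  have K1 : 0 < K + 1 by rewrite ltr_wpDl.
  have h0 : 0 < h by rewrite divr_gt0// mulr_gt0.
  pose n := Num.Def.archi_bound (h ^- 2); exists n => x x01.
  apply: (le_trans (bern_lipschitz n h0 K0 fK x01)).
  have n0 : 0 < n.+1%:R :> R by [].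
  have : (h * n.+1%:R)^-1 <= h.
    rewrite invfM ler_pdivrMr// -ler_pdivrMl// -invfM -expr2.
    apply: (@le_trans _ _ n%:R); last by rewrite ler_nat.
    by rewrite ltW// archi_boundP// invr_ge0 exprn_ge0// ltW.
  move=> hn; have : K * (h + (h * n.+1%:R)^-1) <= (K + 1) * (h + h).
    by set z := _^-1 in hn *; nra.
  move/le_trans; apply; rewrite /h.
  by rewrite le_eqVlt; apply/orP; left; apply/eqP; field; rewrite gt_eqF.
pose Hf v := bern n.+1 (fun k => f (k%:R / n.+1%:R)) ((1 + sin (M^-1 * v)) / 2).
have HfE v : `|sine_ramp M a b v - Hf v| <= e'.
  have x01 : 0 <= (1 + sin (M^-1 * v)) / 2 <= 1.
    by have := sin_le1 (M^-1 * v); have := sin_geN1 (M^-1 * v); move=> ? ?; apply/andP; split; lra.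
  rewrite distrC (le_trans _ (nB _ x01))// /Hf /f /sine_ramp.
  by have -> : 2 * ((1 + sin (M^-1 * v)) / 2) - 1 = sin (M^-1 * v) by field.
have mHf : measurable_fun setT Hf.
  apply: measurableT_comp; first exact: measurable_bern.
  apply: measurable_funM => //; apply: measurable_funD => //.
  by apply: measurableT_comp; [exact: measurable_sin|exact: measurable_funM].
have Hf2 v : `|Hf v| <= 2.
  have -> : Hf v = sine_ramp M a b v - (sine_ramp M a b v - Hf v) by ring.
  rewrite (le_trans (ler_normB _ _))// (_ : 2 = 1 + 1)// lerD//.
  by rewrite (le_trans (HfE v))// ge_min lexx.
exists (fun n w => Hf (V n i w)), (fun w => Hf (W i w)); split.
- exact: tested_bern.
- by split => [m|]; exact: measurableT_comp.
- by split => [m w|w]; exact: Hf2.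
- apply: nearW => m; rewrite (le_trans (ler_norm _))//.
  apply: norm_expectR_le => [|w].
    apply: measurableT_comp => //; apply: measurable_funB; exact: measurableT_comp.
  by rewrite normr_id (le_trans (HfE _))// ge_min lexx orbT.
- rewrite (le_trans (ler_norm _))//.
  apply: norm_expectR_le => [|w].
    apply: measurableT_comp => //; apply: measurable_funB; exact: measurableT_comp.
  by rewrite normr_id (le_trans (HfE _))// ge_min lexx orbT.
Qed.

End testing_functions.

(** * Cutting at a threshold *)

Section cutting.
Context d (T : measurableType d) (R : realType) {P : probability T R}
        d' (T' : measurableType d') {Q : probability T' R} (I : finType).
Variables (V : nat -> I -> T -> R) (W : I -> T' -> R).
Hypothesis mV : forall n i, measurable_fun setT (V n i).
Hypothesis mW : forall i, measurable_fun setT (W i).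

Local Notation EP f := (Rintegral P setT f).
Local Notation EQ f := (Rintegral Q setT f).

Hypothesis V_cvg : forall th u,
  EP (fun w => phase th u (fun i => V n i w)) @[n --> \oo] -->
  EQ (fun w => phase th u (W ^~ w)).

Hypothesis V_tight : forall i e, 0 < e -> exists2 M : R, 0 < M &
  (forall n, EP (fun w => (M < `|V n i w|)%R%:R) <= e) /\
  EQ (fun w => (M < `|W i w|)%R%:R) <= e.

Hypothesis W_atomless : forall i x, EQ (fun w => (W i w == x)%:R) = 0.

Let norm_bool (b : bool) : `|b%:R : R| <= 1.
Proof. by case: b; rewrite ?normr0 ?normr1. Qed.

Let V_tight_ge i e B : 0 < e -> exists M : R, [/\ 0 < M, B <= M,
  (forall n, EP (fun w => (M < `|V n i w|)%R%:R) <= e) &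
  EQ (fun w => (M < `|W i w|)%R%:R) <= e].
Proof.
move=> e0; have [M M0 [VM WM]] := V_tight i e0.
have mM : M <= Num.max B M by rewrite le_max lexx orbT.
exists (Num.max B M); split => //.
- by rewrite lt_max M0 orbT.
- by rewrite le_max lexx.
- move=> n; apply: le_trans (VM n); apply: le_expectR => [||w].
  + by apply: integrableR_pred; apply: measurable_fun_ltr => //; exact: measurableT_comp.
  + by apply: integrableR_pred; apply: measurable_fun_ltr => //; exact: measurableT_comp.
  + by rewrite ler_nat; case: ltP => // h; rewrite (le_lt_trans mM h).
- apply: le_trans WM; apply: le_expectR => [||w].
  + by apply: integrableR_pred; apply: measurable_fun_ltr => //; exact: measurableT_comp.
  + by apply: integrableR_pred; apply: measurable_fun_ltr => //; exact: measurableT_comp.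
  + by rewrite ler_nat; case: ltP => // h; rewrite (le_lt_trans mM h).
Qed.

(** The law of W has no atom at r. *)
Let W_near i r e : 0 < e -> exists2 dl : R, 0 < dl &
  EQ (fun w => (r - dl < W i w < r + dl)%R%:R) <= e.
Proof.
move=> e0.
pose f_ n w : R := (r - n.+1%:R^-1 < W i w < r + n.+1%:R^-1)%R%:R.
have cf : EQ (f_ n) @[n --> \oo] --> EQ (fun w => (W i w == r)%:R).
  apply: (@dominated_cvgR _ _ _ _ f_ _ (fun=> 1)).
  - move=> n; apply: (integrableR_measurable (P := Q)); apply: integrableR_pred.
    by apply: measurable_and; apply: measurable_fun_ltr.
  - exact: integrableR_cst.
  - by move=> n w; exact: norm_bool.
  - move=> w; rewrite /f_; have [->|Wr] := eqVneq (W i w) r.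
      rewrite (_ : (fun n => _) = (fun=> 1)); first exact: cvg_cst.
      by apply/funext => n; rewrite ltrBlDr ltrDl invr_gt0 ltr0n.
    apply: cvg_near_cst.
    have Wr0 : 0 < `|W i w - r| by rewrite normr_gt0 subr_eq0.
    have /cvgrPdist_lt /(_ _ Wr0) := @cvg_harmonic R.
    apply: filterS => n; rewrite /= /harmonic sub0r normrN ger0_norm ?invr_ge0//.
    move=> h; suff -> : (r - n.+1%:R^-1 < W i w < r + n.+1%:R^-1) = false by [].
    by apply/negbTE; rewrite -ltr_distl -leNgt ltW.
rewrite W_atomless in cf.
have /cvgrPdist_le /(_ _ e0) [n _ /(_ n)] := cf.
rewrite /= leqnn sub0r normrN => /(_ isT) h.
by exists n.+1%:R^-1 => //; apply: le_trans h; exact: ler_norm.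
Qed.

(** The events J_n and V_n < r agree up to small probability away from a window
    around r, and the window has little mass since W has no atom there. So J_n is
    close in mean to a ramp of V_n. *)
Lemma tested_cut_fin (i : I) (J : nat -> T -> bool) (r : R) G_ G :
  tested (P := P) (Q := Q) V W G_ G -> (forall n, measurable_fun setT (J n)) ->
  (forall x, x < r -> EP (fun w => (~~ J n w && (V n i w <= x))%:R) @[n --> \oo] --> 0) ->
  (forall x, r < x -> EP (fun w => (J n w && (x < V n i w))%:R) @[n --> \oo] --> 0) ->
  tested (P := P) (Q := Q) V W (fun n w => G_ n w * (J n w)%:R)
    (fun w => G w * (W i w < r)%R%:R).
Proof.
move=> tG mJ Jlo Jhi.
have t1 := tested1 V_cvg.
apply: (tested_approx mV mW) => //.
- by move=> n; apply: (integrableR_measurable (P := P)); exact: integrableR_pred.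
- apply: (integrableR_measurable (P := Q)); apply: integrableR_pred.
  exact: measurable_fun_ltr.
(* One part for each of the two events on which J and V disagree, three for the
   window around r, and three for the tail beyond M. *)
move=> e e0; pose e' := e / 8.
have e'0 : 0 < e' by rewrite divr_gt0.
have [dl dl0 Wdl] := W_near i r e'0; pose h := dl / 2.
have h0 : 0 < h by rewrite divr_gt0.
have hdl : h < dl by rewrite /h; lra.
have [M [M0 BM VM WM]] := V_tight_ge i (`|r| + dl) e'0.
have dlr x : `|x| <= dl -> `|r + x| <= M.
  by move=> xl; rewrite (le_trans (ler_normD _ _))// (le_trans _ BM)// lerD2l.
pose a := r - h; pose b := r + h; pose a' := r - dl; pose b' := r + dl.
have aM : `|a| <= M by apply: dlr; rewrite normrN gtr0_norm// ltW.
have bM : `|b| <= M by apply: dlr; rewrite gtr0_norm// ltW.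
have a'M : `|a'| <= M by apply: dlr; rewrite normrN gtr0_norm.
have b'M : `|b'| <= M by apply: dlr; rewrite gtr0_norm.
have ar : a < r by rewrite gtrBl.
have rb : r < b by rewrite ltrDl.
have ab : a < b := lt_trans ar rb.
have a'a : a' < a by rewrite ltrD2l ltrN2.
have bb' : b < b' by rewrite ltrD2l.
have win v := @sine_ramp_window _ M a' a b b' v M0 a'M aM bM b'M a'a ab bb'.
pose H := sine_ramp M a b.
pose bump v := sine_ramp M b b' v - sine_ramp M a' a v.
have mH : measurable_fun setT H := measurable_sine_ramp M0 aM bM ab.
have H1 v : `|H v| <= 1.
  by have /andP[? ?] := sine_ramp01 M a b v; rewrite ger0_norm.
have tH := tested_sine_ramp mV mW i M0 aM bM ab tG.
have tU := tested_sine_ramp mV mW i M0 bM b'M bb' t1.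
have tD := tested_sine_ramp mV mW i M0 a'M aM a'a t1.
have tB : tested (P := P) (Q := Q) V W (fun n w => bump (V n i w)) (fun w => bump (W i w)).
  by apply: eq_tested (tested_lin mV mW 1 (-1) tU tD) => [n w|w];
    rewrite !mul1r mulN1r.
have bumpE := tested_expectR tB.
have mbump : measurable_fun setT bump.
  by apply: measurable_funB; exact: measurable_sine_ramp.
have bump1 v : `|bump v| <= 1 by have [] := win v.
have iWM : integrableR Q (fun w => (M < `|W i w|)%R%:R).
  by apply: integrableR_pred; apply: measurable_fun_ltr => //; exact: measurableT_comp.
have iWw : integrableR Q (fun w => (a' < W i w < b')%R%:R).
  by apply: integrableR_pred; apply: measurable_and; exact: measurable_fun_ltr.
exists (fun n w => H (V n i w)), (fun w => H (W i w)); split => //.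
- by split => [n|]; exact: measurableT_comp.
- by split => [n w|w]; rewrite (le_trans (H1 _))// ler1n.
- have /cvgrPdist_le /(_ _ e'0) near_lo := Jlo a ar.
  have /cvgrPdist_le /(_ _ e'0) near_hi := Jhi b rb.
  have /cvgrPdist_le /(_ _ e'0) near_bump := bumpE.
  have hW : EQ (fun w => bump (W i w)) <= e' + e'.
    rewrite (le_trans _ (lerD Wdl WM))// -expectRD//; apply: le_expectR.
    + by apply: (@bounded_integrableR _ _ _ _ _ 1) => //; exact: measurableT_comp.
    + exact: integrableRD.
    + by move=> w; have [] := win (W i w).
  near=> n.
  have iL : integrableR P (fun w => (~~ J n w && (V n i w <= a))%:R).
    apply: integrableR_pred; apply: measurable_and; first exact: measurable_neg.
    exact: measurable_fun_ler.
  have iU : integrableR P (fun w => (J n w && (b < V n i w))%:R).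
    by apply: integrableR_pred; apply: measurable_and => //; exact: measurable_fun_ltr.
  have iB : integrableR P (fun w => bump (V n i w)).
    by apply: (@bounded_integrableR _ _ _ _ _ 1) => //; exact: measurableT_comp.
  have iM : integrableR P (fun w => (M < `|V n i w|)%R%:R).
    by apply: integrableR_pred; apply: measurable_fun_ltr => //; exact: measurableT_comp.
  have iJH : integrableR P (fun w => `|(J n w)%:R - H (V n i w)|).
    apply: integrableR_norm; apply: integrableRB; first exact: integrableR_pred.
    by apply: (@bounded_integrableR _ _ _ _ _ 1) => //; exact: measurableT_comp.
  apply: (@le_trans _ _ (EP (fun w => (~~ J n w && (V n i w <= a))%:R
     + (J n w && (b < V n i w))%:R + bump (V n i w) + 3 * (M < `|V n i w|)%R%:R))).
    apply: le_expectR => //.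
    + by do 3?[apply: integrableRD => //]; exact: integrableRZ.
    + by move=> w; apply: norm_cutB_sine_ramp => //; have [] := win (V n i w).
  rewrite 3?expectRD ?expectRZ//; last first.
    + exact: integrableRZ.
    + by do 2?[apply: integrableRD => //].
    + exact: integrableRD.
  have hlo : EP (fun w => (~~ J n w && (V n i w <= a))%:R) <= e'.
    by rewrite (le_trans (ler_norm _))// -normrN -sub0r; near: n.
  have hhi : EP (fun w => (J n w && (b < V n i w))%:R) <= e'.
    by rewrite (le_trans (ler_norm _))// -normrN -sub0r; near: n.
  have hb : EP (fun w => bump (V n i w)) <= e' + e' + e'.
    rewrite (le_trans _ (lerD hW (lexx e')))// -lerBlDl (le_trans (ler_norm _))//.
    by rewrite distrC; near: n.
  have -> : e = e' + e' + (e' + e' + e') + 3 * e' by rewrite /e'; field.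
  by rewrite !lerD// ler_wpM2l.
- have -> : e = 8 * e' by rewrite /e'; field.
  apply: (@le_trans _ _ (e' + e')); last by rewrite (mulr_natl e' 8) -mulr2n ler_wpMn2l// ltW.
  rewrite (le_trans _ (lerD Wdl WM))// -expectRD//; apply: le_expectR.
  + apply: integrableR_norm; apply: integrableRB.
      by apply: integrableR_pred; exact: measurable_fun_ltr.
    by apply: (@bounded_integrableR _ _ _ _ _ 1) => //; exact: measurableT_comp.
  + exact: integrableRD.
  + by move=> w; apply: norm_ltB_sine_ramp => //; exact: ltW.
Unshelve. all: by end_near. Qed.

(** At an infinite threshold the comparison with V is constant, and by tightness
    J agrees with that constant up to small probability. *)
Lemma tested_cut (i : I) (J : nat -> T -> bool) (c : \bar R) G_ G :
  tested (P := P) (Q := Q) V W G_ G -> (forall n, measurable_fun setT (J n)) ->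
  (forall x, (x%:E < c)%E ->
    EP (fun w => (~~ J n w && (V n i w <= x))%:R) @[n --> \oo] --> 0) ->
  (forall x, (c < x%:E)%E ->
    EP (fun w => (J n w && (x < V n i w))%:R) @[n --> \oo] --> 0) ->
  tested (P := P) (Q := Q) V W (fun n w => G_ n w * (J n w)%:R)
    (fun w => G w * ((W i w)%:E < c)%E%:R).
Proof.
move=> tG mJ; case: c => [r||] Jlo Jhi.
- have := @tested_cut_fin i J r G_ G tG mJ; apply => x xr.
    by apply: Jlo; rewrite lte_fin.
  by apply: Jhi; rewrite lte_fin.
- apply: (tested_approx mV mW) => //.
  + by move=> n; apply: (integrableR_measurable (P := P)); exact: integrableR_pred.
  + by rewrite (_ : (fun _ => _) = fun=> 1)//; apply/funext => w; rewrite ltry.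
  move=> e e0; have e2 : 0 < e / 2 by rewrite divr_gt0.
  have [M [M0 _ VM _]] := V_tight_ge i 0 e2.
  exists (fun _ _ => 1), (fun=> 1); split => //.
  + by apply: eq_tested tG => [n w|w]; rewrite mulr1.
  + by split => [n w|w]; rewrite normr1; lra.
  + have /cvgrPdist_le /(_ _ e2) near_lo := Jlo M (ltry _).
    near=> n.
    have iM : integrableR P (fun w => (M < `|V n i w|)%R%:R).
      by apply: integrableR_pred; apply: measurable_fun_ltr => //; exact: measurableT_comp.
    have iL : integrableR P (fun w => (~~ J n w && (V n i w <= M))%:R).
      apply: integrableR_pred; apply: measurable_and; first exact: measurable_neg.
      exact: measurable_fun_ler.
    apply: (@le_trans _ _ (EP (fun w => (~~ J n w && (V n i w <= M))%:R
     + (M < `|V n i w|)%R%:R))).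
      apply: le_expectR; [|exact: integrableRD|].
        apply: integrableR_norm; apply: integrableRB; first exact: integrableR_pred.
        exact: integrableR_cst.
      move=> w; have [vM|vM] := leP (V n i w) M; case: (J n w) => /=;
       rewrite ?subrr ?sub0r ?normrN ?normr0 ?normr1 ?addr_ge0//.
      + by rewrite lerDl.
      + by rewrite (lt_le_trans vM (ler_norm _)) add0r.
    rewrite expectRD//.
    have hlo : `|0 - EP (fun w => (~~ J n w && (V n i w <= M))%:R)| <= e / 2 by near: n.
    by have := VM n; move: hlo; rewrite ler_norml => /andP[? ?]; lra.
  + rewrite (@eq_expectR _ _ _ _ _ (fun=> 0)) ?expectR_cst ?ltW// => w.
    by rewrite ltry subrr normr0.
- apply: (tested_approx mV mW) => //.
  + by move=> n; apply: (integrableR_measurable (P := P)); exact: integrableR_pred.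
  move=> e e0; have e2 : 0 < e / 2 by rewrite divr_gt0.
  have [M [M0 _ VM _]] := V_tight_ge i 0 e2.
  exists (fun _ _ => 0), (fun=> 0); split => //.
  + by apply: eq_tested (tested_lin mV mW 0 0 tG tG) => [n w|w]; ring.
  + by split => [n w|w]; rewrite normr0.
  + have /cvgrPdist_le /(_ _ e2) near_hi := Jhi (- M - 1) (ltNyr _).
    near=> n.
    have iM : integrableR P (fun w => (M < `|V n i w|)%R%:R).
      by apply: integrableR_pred; apply: measurable_fun_ltr => //; exact: measurableT_comp.
    have iL : integrableR P (fun w => (J n w && (- M - 1 < V n i w))%:R).
      by apply: integrableR_pred; apply: measurable_and => //; exact: measurable_fun_ltr.
    apply: (@le_trans _ _ (EP (fun w => (J n w && (- M - 1 < V n i w))%:R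
     + (M < `|V n i w|)%R%:R))).
      apply: le_expectR; [|exact: integrableRD|].
        apply: integrableR_norm; apply: integrableRB; first exact: integrableR_pred.
        exact: integrableR_cst.
      move=> w; rewrite subr0; case: (J n w) => /=; rewrite ?normr0 ?normr1 ?addr_ge0//.
      have [vM|vM] := ltP (- M - 1) (V n i w); first by rewrite lerDl.
      have -> : M < `|V n i w| by rewrite ltr_normr; apply/orP; right; lra.
      by rewrite add0r.
    rewrite expectRD//.
    have hlo : `|0 - EP (fun w => (J n w && (- M - 1 < V n i w))%:R)| <= e / 2 by near: n.
    by have := VM n; move: hlo; rewrite ler_norml => /andP[? ?]; lra.
  + by rewrite (@eq_expectR _ _ _ _ _ (fun=> 0)) ?expectR_cst ?ltW// => w; rewrite subr0 normr0.
Unshelve. all: by end_near. Qed.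
End cutting.

(** * Continuity on a finite product *)

Section continuity_on_products.
Context {R : realType} {I : finType}.
Variable f : (I -> R) -> R.
Hypothesis f_cont : forall x e, 0 < e ->
  exists2 dl : R, 0 < dl & forall y, (forall i, `|x i - y i| < dl) -> `|f x - f y| < e.

(** Points of the product are read as row vectors, whose closed boxes are compact. *)
Lemma heine_cantor_box (L e : R) : 0 < e -> exists2 dl : R, 0 < dl &
  forall x y, (forall i, `|x i| <= L) -> (forall i, `|x i - y i| < dl) ->
    `|f x - f y| < e.
Proof.
move=> e0.
pose fr (v : 'rV[R]_#|I|) : I -> R := fun i => v ord0 (enum_rank i).
pose Pr (dl : R) (v : 'rV[R]_#|I|) :=
  forall y, (forall i, `|fr v i - y i| < dl) -> `|f (fr v) - f y| < e.
have cK : compact [set v : 'rV[R]_#|I| | forall i, `[- L, L]%classic (v ord0 i)].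
  by apply: (@rV_compact R _ (fun=> `[- L, L]%classic)) => i; exact: segment_compact.
have /compact_near_coveringP cov := cK.
have [|dl /= dl0 H] := cov R (0^'+)%R Pr _.
  move=> v _; have e2 : 0 < e / 2 by rewrite divr_gt0.
  have [dl dl0 H] := f_cont (fr v) e2.
  have dl2 : 0 < dl / 2 by rewrite divr_gt0.
  exists (ball v (dl / 2), [set h | h < dl / 2]) => /=.
    by split; [exact: nbhsx_ballx|exact: nbhs_right_lt].
  move=> [v' h] /= [[_ vv'] hdl] y vy.
  have v'v i : `|fr v i - fr v' i| < dl / 2 by exact: vv'.
  rewrite (splitr e) (le_lt_trans (ler_distD (f (fr v)) _ _))// ltrD//.
    rewrite distrC; apply: H => i; rewrite (lt_trans (v'v i))//; lra.
  apply: H => i; rewrite (le_lt_trans (ler_distD (fr v' i) _ _))//.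
  by rewrite (splitr dl) ltrD// (lt_trans (vy i)).
exists (dl / 2); first by rewrite divr_gt0.
move=> x y xL xy.
have := H (dl / 2); rewrite /ball_/= sub0r normrN gtr0_norm ?divr_gt0//.
have -> : dl / 2 < dl by lra.
move=> /(_ isT isT (\row_j x (enum_val j))).
rewrite /Pr; have -> : fr (\row_j x (enum_val j)) = x.
  by apply/funext => i; rewrite /fr mxE enum_rankK.
apply => //= i; rewrite mxE in_itv/= -ler_norml; exact: xL.
Qed.

(** Rounding the coordinates to a grid gives functions with countably many values,
    which converge pointwise by continuity. *)
Lemma measurable_fun_prod d (T : measurableType d) (Z : I -> T -> R) :
  (forall i, measurable_fun setT (Z i)) -> measurable_fun setT (fun w => f (Z ^~ w)).
Proof.
move=> mZ.
pose rnd n (x : R) : R := (Num.floor (n.+1%:R * x))%:~R / n.+1%:R.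
have rndP n x : `|x - rnd n x| <= n.+1%:R^-1.
  have n0 : 0 < n.+1%:R :> R by [].
  have /andP[lo hi] := floor_itv (n.+1%:R * x).
  rewrite -(ler_pM2l n0) divff ?gt_eqF// -[X in X * `|_|](gtr0_norm n0) -normrM.
  rewrite mulrBr /rnd mulrCA divff ?gt_eqF// mulr1 ger0_norm ?subr_ge0// lerBlDl.
  by rewrite intrD in hi; exact: ltW.
apply: (@measurable_fun_cvg _ _ _ _ (fun n w => f (fun i => rnd n (Z i w)))).
- move=> n _ B mB; rewrite setTI.
  pose C (k : {ffun I -> int}) := [set w | B (f (fun i => (k i)%:~R / n.+1%:R))] `&`
     \bigcap_(i in [set: I]) [set w | (k i)%:~R <= n.+1%:R * Z i w < (k i + 1)%:~R].
  rewrite (_ : _ @^-1` _ = \bigcup_k C k).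
    apply: countable_bigcupT_measurable => [|k]; first exact: countableP.
    apply: measurableI.
      have [Bf|Bf] := pselect (B (f (fun i => (k i)%:~R / n.+1%:R))).
        by rewrite (_ : [set _ | _] = setT)//; apply/seteqP; split.
      by rewrite (_ : [set _ | _] = set0)//; apply/seteqP; split.
    apply: fin_bigcap_measurable => // i _; rewrite -[X in measurable X]setTI.
    have mb : measurable_fun setT
        (fun w => (k i)%:~R <= n.+1%:R * Z i w < (k i + 1)%:~R).
      by apply: measurable_and; [apply: measurable_fun_ler|apply: measurable_fun_ltr];
        rewrite //; exact: measurable_funM.
    exact: (mb measurableT [set true]).
  apply/seteqP; split => w /=.
    move=> Bw; exists [ffun i => Num.floor (n.+1%:R * Z i w)] => //; split => /=.
      by under eq_fun do rewrite ffunE.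
    by move=> i _ /=; rewrite ffunE; exact: floor_itv.
  move=> [k _ [/= Bk kZ]]; rewrite /rnd.
  suff -> : (fun i => (Num.floor (n.+1%:R * Z i w))%:~R / n.+1%:R) =
    (fun i => (k i)%:~R / n.+1%:R :> R) by [].
  apply/funext => i; congr (_%:~R / _); apply: floor_def; exact: (kZ i Logic.I).
- move=> w _; apply/cvgrPdist_lt => /= e e0.
  have [dl dl0 H] := f_cont (Z ^~ w) e0.
  have /cvgrPdist_lt /(_ _ dl0) := @cvg_harmonic R.
  apply: filterS => n; rewrite /= /harmonic sub0r normrN ger0_norm ?invr_ge0// => h.
  by apply: H => i; exact: le_lt_trans (rndP n _) h.
Qed.

End continuity_on_products.

(** * Cells of a grid *)

Section cells.
Context {R : realType} {I : finType}.

(** The product over the coordinates of the increments of N-step staircases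
    expands into a sum over the cells of the grid. *)
Lemma sum_cells (N : nat) (A : I -> nat -> R) :
  \sum_(k : {ffun I -> 'I_N}) \prod_i (A i (k i).+1 - A i (k i)) =
  \prod_i (A i N - A i 0%N).
Proof.
rewrite -(bigA_distr_bigA (fun i (j : 'I_N) => A i j.+1 - A i j)).
apply: eq_bigr => i _; rewrite -(big_mkord xpredT (fun j => A i j.+1 - A i j)).
by rewrite telescope_sumr.
Qed.

Variables (N : nat) (A : I -> nat -> bool).
Hypothesis A_mono : forall i j, A i j -> A i j.+1.

Definition cell (k : {ffun I -> 'I_N}) : R :=
  \prod_i ((A i (k i).+1)%:R - (A i (k i))%:R).

Definition box : R := \prod_i ((A i N)%:R - (A i 0%N)%:R).

Lemma sum_cell : \sum_k cell k = box.
Proof. exact: (@sum_cells N (fun i j => (A i j)%:R)). Qed.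

Lemma cell_ge0 k : 0 <= cell k.
Proof.
apply: prodr_ge0 => i _; rewrite subr_ge0 ler_nat.
by case: (A i (k i)) (@A_mono i (k i)) => // ->.
Qed.

Lemma cell_neq0 k i : cell k != 0 -> A i (k i).+1 && ~~ A i (k i).
Proof.
move=> /prodf_neq0 /(_ i isT); have := @A_mono i (k i).
by case: (A i (k i)) => /= h; [rewrite h// subrr eqxx|case: (A i _) => //; rewrite subrr eqxx].
Qed.

Let A_0N i : A i 0%N -> A i N.
Proof. by elim: N => // n ih /ih; exact: A_mono. Qed.

Lemma box01 : 0 <= box <= 1.
Proof.
have h i : 0 <= ((A i N)%:R - (A i 0%N)%:R : R) <= 1.
  by have := @A_0N i; case: (A i 0%N) => [->//|_]; case: (A i N);
    rewrite ?subrr ?subr0 ?ler01 ?lexx.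
rewrite prodr_ge0/=; last by move=> i _; have /andP[] := h i.
by apply: prodr_ile1 => i _.
Qed.

(** A point outside the box violates one of the bounds in some coordinate. *)
Lemma oneB_box_le : 1 - box <= \sum_i ((~~ A i N)%:R + (A i 0%N)%:R).
Proof.
have [/forallP b|] := boolP [forall i, A i N && ~~ A i 0%N].
  rewrite /box big1 ?subrr ?sumr_ge0// => i _.
  by have /andP[-> /negbTE ->] := b i; rewrite subr0.
rewrite negb_forall => /existsP[i]; rewrite negb_and negbK => bi.
have /andP[b0 _] := box01.
rewrite (le_trans (_ : _ <= 1)) ?lerBlDr ?lerDl//.
rewrite (bigD1 i)//= (le_trans (_ : _ <= (~~ A i N)%:R + (A i 0%N)%:R))//.
  by rewrite -natrD ler1n addn_gt0; case/orP: bi => ->; rewrite ?orbT.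
by rewrite lerDl sumr_ge0.
Qed.

(** The indicators of the cells sum to the indicator of the box, and the values of
    g on the cells that do not contain the point have weight 0. *)
Lemma cell_approx (g : {ffun I -> 'I_N} -> R) (x e K : R) : 0 <= e -> `|x| <= K ->
  (forall k, cell k != 0 -> `|x - g k| <= e) ->
  `|x - \sum_k g k * cell k| <= e + K * (1 - box).
Proof.
move=> e0 xK xg; have /andP[b0 b1] := box01.
have -> : x - \sum_k g k * cell k = \sum_k (x - g k) * cell k + x * (1 - box).
  under [X in _ = X + _]eq_bigr do rewrite mulrBl.
  by rewrite sumrB -mulr_sumr sum_cell; ring.
rewrite (le_trans (ler_normD _ _))// lerD//; last first.
  by rewrite normrM ler_pM// ger0_norm ?subr_ge0.
rewrite (le_trans (ler_norm_sum _ _ _))//.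
rewrite (@le_trans _ _ (\sum_k e * cell k))//; last first.
  by rewrite -mulr_sumr sum_cell ler_piMr.
apply: ler_sum => k _; rewrite normrM (ger0_norm (cell_ge0 k)).
have [->|c0] := eqVneq (cell k) 0; first by rewrite !mulr0.
by rewrite ler_wpM2r ?cell_ge0// xg.
Qed.

Lemma cell_bound (g : {ffun I -> 'I_N} -> R) (x K : R) : `|x| <= K ->
  (forall k, `|g k| <= K) -> `|x - \sum_k g k * cell k| <= 2 * K.
Proof.
move=> xK gK; have /andP[b0 b1] := box01; have K0 := le_trans (normr_ge0 x) xK.
rewrite (le_trans (ler_normB _ _))// mulr_natl mulr2n lerD//.
rewrite (le_trans (ler_norm_sum _ _ _))//.
rewrite (@le_trans _ _ (\sum_k K * cell k))//; last first.
  by rewrite -mulr_sumr sum_cell ler_piMr.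
by apply: ler_sum => k _; rewrite normrM (ger0_norm (cell_ge0 k)) ler_wpM2r ?cell_ge0.
Qed.

End cells.

(** * Convergence in distribution by cells *)

Section convergence_by_cells.
Context d (T : measurableType d) (R : realType) {P : probability T R}
        d' (T' : measurableType d') {Q : probability T' R} (I : finType).
Variables (V : nat -> I -> T -> R) (W : I -> T' -> R).
Variables (Z : nat -> I -> T -> R) (z : I -> T' -> R) (psi : I -> R -> \bar R).
Hypothesis mV : forall n i, measurable_fun setT (V n i).
Hypothesis mW : forall i, measurable_fun setT (W i).
Hypothesis mZ : forall n i, measurable_fun setT (Z n i).
Hypothesis mz : forall i, measurable_fun setT (z i).

Local Notation EP f := (Rintegral P setT f).
Local Notation EQ f := (Rintegral Q setT f).

Hypothesis V_cvg : forall th u,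
  EP (fun w => phase th u (fun i => V n i w)) @[n --> \oo] -->
  EQ (fun w => phase th u (W ^~ w)).

Hypothesis V_tight : forall i e, 0 < e -> exists2 M : R, 0 < M &
  (forall n, EP (fun w => (M < `|V n i w|)%R%:R) <= e) /\
  EQ (fun w => (M < `|W i w|)%R%:R) <= e.

Hypothesis W_atomless : forall i x, EQ (fun w => (W i w == x)%:R) = 0.

Hypothesis psi_nd : forall i s t, s <= t -> (psi i s <= psi i t)%E.
Hypothesis psi_y : forall i, psi i t @[t --> +oo] --> +oo%E.
Hypothesis psi_Ny : forall i, psi i t @[t --> -oo] --> -oo%E.
Hypothesis z_gt : forall i t w, t < z i w -> (psi i t <= (W i w)%:E)%E.
Hypothesis z_lt : forall i t w, z i w < t -> ((W i w)%:E <= psi i t)%E.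

Hypothesis cut_lo : forall i t x, (x%:E < psi i t)%E ->
  EP (fun w => ((t < Z n i w) && (V n i w <= x))%R%:R) @[n --> \oo] --> 0.
Hypothesis cut_hi : forall i t x, (psi i t < x%:E)%E ->
  EP (fun w => ((Z n i w <= t) && (x < V n i w))%R%:R) @[n --> \oo] --> 0.

Let tested_integrable G_ G : tested (P := P) (Q := Q) V W G_ G ->
  (forall n, integrableR P (G_ n)) /\ integrableR Q G.
Proof.
by move=> [mG_ mG [c [bG_ bG]] _]; split => [n|]; exact: (@bounded_integrableR _ _ _ _ _ c).
Qed.

(** The increments are multiplied in one coordinate at a time, each indicator of
    Z <= t being a cut of the previous products. *)
Let tested_increments (s : seq I) (l u : I -> R) :
  tested (P := P) (Q := Q) V W
    (fun n w => \prod_(i <- s) ((Z n i w <= u i)%R%:R - (Z n i w <= l i)%R%:R))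
    (fun w => \prod_(i <- s)
      (((W i w)%:E < psi i (u i))%E%:R - ((W i w)%:E < psi i (l i))%E%:R)).
Proof.
elim: s => [|i s ih].
  by apply: eq_tested (tested1 V_cvg) => [n w|w]; rewrite big_nil.
have cut t := @tested_cut _ _ _ P _ _ Q I V W mV mW V_cvg V_tight W_atomless i
  (fun n w => Z n i w <= t) (psi i t) _ _ ih.
have h t : tested (P := P) (Q := Q) V W
    (fun n w => \prod_(i <- s) ((Z n i w <= u i)%R%:R - (Z n i w <= l i)%R%:R) *
       (Z n i w <= t)%R%:R)
    (fun w => \prod_(i <- s)
      (((W i w)%:E < psi i (u i))%E%:R - ((W i w)%:E < psi i (l i))%E%:R) *
       ((W i w)%:E < psi i t)%E%:R).
  apply: cut => [n|x xt|x tx]; first exact: measurable_fun_ler.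
    rewrite (_ : (fun n => _) =
      fun n => EP (fun w => ((t < Z n i w) && (V n i w <= x))%R%:R)); last first.
      by apply/funext => n; apply: eq_expectR => w; rewrite -ltNge.
    exact: cut_lo.
  exact: cut_hi.
by apply: eq_tested (tested_lin mV mW 1 (-1) (h (u i)) (h (l i))) => [n w|w];
  rewrite big_cons; ring.
Qed.

Variable f : (I -> R) -> R.
Hypothesis f_cont : forall x e, 0 < e ->
  exists2 dl : R, 0 < dl & forall y, (forall i, `|x i - y i| < dl) -> `|f x - f y| < e.
Hypothesis f_bounded : exists K, forall x, `|f x| <= K.

(** Both expectations are close to the same combination of probabilities of cells,
    which converge. On the limit side this fails only when W hits a value of psi
    at a point of the grid, a null event. *)
Lemma cvg_by_cells : EP (fun w => f (fun i => Z n i w)) @[n --> \oo] -->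
  EQ (fun w => f (z ^~ w)).
Proof.
have [K fK] := f_bounded.
have K0 : 0 <= K := le_trans (normr_ge0 _) (fK (fun=> 0)).
have mfZ n := measurable_fun_prod f_cont (mZ n).
have mfz := measurable_fun_prod f_cont mz.
apply/cvgrPdist_le => /= e6 e60; pose e := e6 / 6.
have e0 : 0 < e by rewrite divr_gt0.
(* The grid lives in a box outside of which W has little mass. *)
pose e1 := e / (2 * (#|I|%:R + 1) * (K + 1)).
have I1 : 0 < #|I|%:R + 1 :> R by rewrite ltr_wpDl.
have K1 : 0 < K + 1 by rewrite ltr_wpDl.
have e10 : 0 < e1 by rewrite divr_gt0// !mulr_gt0.
have /choice[M HM] i : exists M : R, EQ (fun w => (M < `|W i w|)%R%:R) <= e1.
  by have [M _ [_ ?]] := V_tight i e10; exists M.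
have [L [L0 psiL psiNL]] : exists L : R, [/\ 0 < L,
    forall i, ((M i)%:E < psi i L)%E & forall i, (psi i (- L) < (- M i)%:E)%E].
  have h1 : \forall t \near +oo, forall i, ((M i)%:E < psi i t)%E.
    apply: filter_forall => i; have := @psi_y i.
    by move=> /cvgey_gt /(_ (M i)).
  have h2 : \forall t \near -oo, forall i, (psi i t < (- M i)%:E)%E.
    apply: filter_forall => i; have := @psi_Ny i.
    by move=> /cvgeNy_lt /(_ (- M i)).
  case: h1 => A1 [_ H1]; case: h2 => A2 [_ H2].
  exists (`|A1| + `|A2| + 1); split.
  - by rewrite ltr_wpDl// addr_ge0.
  - by apply: H1; rewrite (le_lt_trans (ler_norm _))// -addrA ltrDl ltr_wpDl.
  - apply: H2; rewrite ltrNl (le_lt_trans (ler_norm _))// normrN.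
    by rewrite addrAC ltrDr ltr_wpDl.
have [dl dl0 unif] := heine_cantor_box f_cont L e0.
pose N := (Num.Def.archi_bound (2 * L / dl)).+1.
have N0 : 0 < N%:R :> R by rewrite ltr0n.
pose h := 2 * L / N%:R.
have h0 : 0 < h by rewrite divr_gt0// mulr_gt0.
have hdl : h < dl.
  rewrite /h ltr_pdivrMr// [ltRHS]mulrC -ltr_pdivrMr//.
  apply: (@lt_trans _ _ (Num.Def.archi_bound (2 * L / dl))%:R); last by rewrite ltr_nat.
  by rewrite archi_boundP// divr_ge0// ?mulr_ge0// ltW.
pose t j : R := - L + j%:R * h.
have t0 : t 0%N = - L by rewrite /t mul0r addr0.
have tN : t N = L by rewrite /t /h; field; rewrite gt_eqF.
have tS j : t j.+1 = t j + h by rewrite /t -natr1; ring.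
have tle j : t j <= t j.+1 by rewrite tS lerDl ltW.
have tL (j : 'I_N) : `|t j| <= L.
  rewrite ler_norml /t lerDl mulr_ge0 ?(ltW h0)//= -[leRHS]tN /t lerD2l ler_pM2r//.
  by rewrite ler_nat ltnW.
pose g (k : {ffun I -> 'I_N}) := f (fun i => t (k i)).
pose AP n w (i : I) j := Z n i w <= t j.
pose AQ w (i : I) j := ((W i w)%:E < psi i (t j))%E.
have AP_mono n w i j : AP n w i j -> AP n w i j.+1.
  by rewrite /AP => /le_trans; apply; exact: tle.
have AQ_mono w i j : AQ w i j -> AQ w i j.+1.
  by rewrite /AQ => /lt_le_trans; apply; apply: psi_nd.
pose cP n w (k : {ffun I -> 'I_N}) : R := cell (AP n w) k.
pose cQ w (k : {ffun I -> 'I_N}) : R := cell (AQ w) k.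
pose bP n w : R := box N (AP n w).
pose bQ w : R := box N (AQ w).
have tcell k : tested (P := P) (Q := Q) V W (fun n w => cP n w k) (fun w => cQ w k).
  exact: (tested_increments (index_enum I) (fun i => t (k i)) (fun i => t (k i).+1)).
have tbox : tested (P := P) (Q := Q) V W bP bQ.
  exact: (tested_increments (index_enum I) (fun=> t 0%N) (fun=> t N)).
have cell_cvg k := tested_expectR (tcell k).
have box_cvg := tested_expectR tbox.
have icP n k : integrableR P (fun w => cP n w k) := (tested_integrable (tcell k)).1 n.
have icQ k : integrableR Q (fun w => cQ w k) := (tested_integrable (tcell k)).2.
have ibP n : integrableR P (bP n) := (tested_integrable tbox).1 n.
have ibQ : integrableR Q bQ := (tested_integrable tbox).2.
have ifZ n : integrableR P (fun w => f (fun i => Z n i w)).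
  exact: bounded_integrableR (fun w => fK _).
have ifz : integrableR Q (fun w => f (z ^~ w)).
  exact: bounded_integrableR (fun w => fK _).
have isP n : integrableR P (fun w => \sum_k g k * cP n w k).
  by apply: integrableR_sum => k; exact: integrableRZ.
have isQ : integrableR Q (fun w => \sum_k g k * cQ w k).
  by apply: integrableR_sum => k; exact: integrableRZ.
have sP n : EP (fun w => \sum_k g k * cP n w k) = \sum_k g k * EP (fun w => cP n w k).
  rewrite expectR_sum => [|k]; last exact: integrableRZ.
  by apply: eq_bigr => k _; rewrite expectRZ.
have sQ : EQ (fun w => \sum_k g k * cQ w k) = \sum_k g k * EQ (fun w => cQ w k).
  rewrite expectR_sum => [|k]; last exact: integrableRZ.
  by apply: eq_bigr => k _; rewrite expectRZ.
have s_cvg : EP (fun w => \sum_k g k * cP n w k) @[n --> \oo] -->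
    EQ (fun w => \sum_k g k * cQ w k).
  rewrite sQ; under eq_cvg do rewrite sP.
  apply: cvg_big => [|k _]; first exact: add_continuous.
  by apply: cvgM => //; exact: cvg_cst.
have tk (k : {ffun I -> 'I_N}) i x : t (k i) <= x -> x <= t (k i).+1 ->
    `|t (k i) - x| < dl.
  move=> tx xt; rewrite distrC ger0_norm ?subr_ge0// (le_lt_trans _ hdl)//.
  by rewrite lerBlDl -tS.
have hP n : `|EP (fun w => f (fun i => Z n i w)) - EP (fun w => \sum_k g k * cP n w k)| <=
    e + K * (1 - EP (bP n)).
  have i1 : integrableR P (fun w => 1 - bP n w).
    by apply: integrableRB => //; exact: integrableR_cst.
  have i2 : integrableR P (fun w => K * (1 - bP n w)) by exact: integrableRZ.
  have -> : e + K * (1 - EP (bP n)) = EP (fun w => e + K * (1 - bP n w)).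
    rewrite expectRD ?expectRZ ?expectRB ?expectR_cst//; exact: integrableR_cst.
  rewrite -expectRB//; apply: le_norm_expectR.
  - by apply: (integrableR_measurable (P := P)); exact: integrableRB.
  - by apply: integrableRD => //; exact: integrableR_cst.
  move=> w; apply: (cell_approx (AP_mono n w)); [exact: ltW|exact: fK|].
  move=> k ck; rewrite distrC; apply/ltW/unif => [i|i]; first exact: tL.
  have /andP[/= h1 h2] := cell_neq0 (AP_mono n w) i ck.
  by apply: tk => //; rewrite ltW// ltNge.
(* Off this event, the cell that W selects contains z. *)
pose bad w : R := \sum_i \sum_(j < N) ((W i w)%:E == psi i (t j))%:R.
have mbad i j : measurable_fun setT (fun w => (W i w)%:E == psi i (t j)).
  case: (psi i (t j)) => [r||]; last 2 first; [exact: measurable_cst..|].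
  rewrite (_ : (fun w => _) = fun w => W i w == r); last by apply/funext => w; rewrite eqe.
  exact: measurable_fun_eqr.
have ibad1 i j : integrableR Q (fun w => ((W i w)%:E == psi i (t j))%:R).
  exact: integrableR_pred.
have ibad : integrableR Q bad by do 2?apply: integrableR_sum => ?.
have bad0 : EQ bad = 0.
  rewrite expectR_sum => [|i]; last by apply: integrableR_sum => j.
  rewrite big1// => i _; rewrite expectR_sum// big1// => j _.
  case: (psi i (t j)) => [r||]; last 2 first.
  - by rewrite (@eq_expectR _ _ _ _ _ (fun=> 0)) ?expectR_cst.
  - by rewrite (@eq_expectR _ _ _ _ _ (fun=> 0)) ?expectR_cst.
  by rewrite -[RHS](W_atomless i r); apply: eq_expectR => w; rewrite eqe.
have hQ : `|EQ (fun w => f (z ^~ w)) - EQ (fun w => \sum_k g k * cQ w k)| <=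
    e + K * (1 - EQ bQ).
  have i1 : integrableR Q (fun w => 1 - bQ w).
    by apply: integrableRB => //; exact: integrableR_cst.
  have i2 : integrableR Q (fun w => K * (1 - bQ w)) by exact: integrableRZ.
  have i3 : integrableR Q (fun w => 2 * K * bad w) by exact: integrableRZ.
  have i4 : integrableR Q (fun w => e + K * (1 - bQ w)).
    by apply: integrableRD => //; exact: integrableR_cst.
  have -> : e + K * (1 - EQ bQ) = EQ (fun w => e + K * (1 - bQ w) + 2 * K * bad w).
    rewrite expectRD// [X in _ = _ + X]expectRZ// bad0 mulr0 addr0.
    rewrite expectRD ?expectRZ ?expectRB ?expectR_cst//; exact: integrableR_cst.
  rewrite -expectRB//; apply: le_norm_expectR.
  - by apply: (integrableR_measurable (P := Q)); exact: integrableRB.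
  - exact: integrableRD.
  move=> w; have bad_ge0 : 0 <= bad w by do 2?apply: sumr_ge0 => ? _.
  have /andP[b0 b1] := @box01 R _ N _ (AQ_mono w).
  have [/existsP[i /existsP[j ij]]|] :=
    boolP [exists i, [exists j : 'I_N, (W i w)%:E == psi i (t j)]].
    have bad1 : 1 <= bad w.
      rewrite /bad (bigD1 i)//= (bigD1 j)//= ij -addrA lerDl addr_ge0//.
        exact: sumr_ge0.
      by apply: sumr_ge0 => ? _; exact: sumr_ge0.
    apply: (@le_trans _ _ (2 * K)); first by apply: (cell_bound (AQ_mono w)) => [|k]; exact: fK.
    rewrite -[leLHS]add0r lerD//; last by rewrite ler_peMr// mulr_ge0.
    by rewrite addr_ge0 ?mulr_ge0 ?subr_ge0// ltW.
  rewrite negb_exists => /forallP good.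
  rewrite -[leLHS]addr0 lerD ?mulr_ge0//.
  apply: (cell_approx (AQ_mono w)); [exact: ltW|exact: fK|].
  move=> k ck; rewrite distrC; apply/ltW/unif => [i|i]; first exact: tL.
  have /andP[/= h1 h2] := cell_neq0 (AQ_mono w) i ck.
  have {h2} h2 : (psi i (t (k i)) < (W i w)%:E)%E.
    rewrite lt_neqAle leNgt h2 andbT eq_sym.
    by have := good i; rewrite negb_exists => /forallP /(_ (k i)).
  apply: tk; rewrite leNgt; apply/negP.
    by move=> /z_lt; rewrite leNgt h2.
  by move=> /z_gt; rewrite leNgt => /negP; apply; exact: h1.
have tail : K * (1 - EQ bQ) <= e.
  have i1 : integrableR Q (fun w => 1 - bQ w).
    by apply: integrableRB => //; exact: integrableR_cst.
  have iM i : integrableR Q (fun w => (M i < `|W i w|)%R%:R).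
    by apply: integrableR_pred; apply: measurable_fun_ltr => //; exact: measurableT_comp.
  have : 1 - EQ bQ <= \sum_(i : I) 2 * e1.
    rewrite -[X in X - _](@expectR_cst _ _ _ Q) -expectRB//; last exact: integrableR_cst.
    apply: (@le_trans _ _ (EQ (fun w => \sum_i 2 * (M i < `|W i w|)%R%:R))).
      apply: le_expectR => //; first by apply: integrableR_sum => i; exact: integrableRZ.
      move=> w; apply: (le_trans (@oneB_box_le R I N _ (AQ_mono w))).
      apply: ler_sum => i _; rewrite /AQ tN t0.
      have W1 : ~~ ((W i w)%:E < psi i L)%E -> M i < `|W i w|.
        rewrite -leNgt => /(lt_le_trans (psiL i)); rewrite lte_fin => /lt_le_trans; apply.
        exact: ler_norm.
      have W2 : ((W i w)%:E < psi i (- L))%E -> M i < `|W i w|.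
        move=> /lt_trans /(_ (psiNL i)); rewrite lte_fin ltrNr => /lt_le_trans; apply.
        by rewrite -normrN ler_norm.
      rewrite mulr_natl mulr2n lerD// ler_nat.
        by case: (~~ _) W1 => // ->.
      by case: (_ < psi i (- L))%E W2 => // ->.
    rewrite expectR_sum => [|i]; last exact: integrableRZ.
    by apply: ler_sum => i _; rewrite expectRZ// ler_wpM2l.
  move=> /(ler_wpM2l K0) /le_trans; apply.
  have -> : \sum_(i : I) 2 * e1 = 2 * e1 * #|I|%:R by rewrite sumr_const -[LHS]mulr_natr.
  rewrite /e1.
  have -> : K * (2 * (e / (2 * (#|I|%:R + 1) * (K + 1))) * #|I|%:R) =
     e * (K / (K + 1)) * (#|I|%:R / (#|I|%:R + 1)).
    by field; rewrite !gt_eqF.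
  have q1 (x : R) : 0 <= x -> x / (x + 1) <= 1.
    by move=> x0; rewrite ler_pdivrMr ?ltr_wpDl// mul1r lerDl.
  rewrite -mulrA ler_piMr ?(ltW e0)// mulr_ile1 ?q1 ?divr_ge0 ?addr_ge0//.
have e'0 : 0 < e / (K + 1) by rewrite divr_gt0.
have /cvgrPdist_le /(_ _ e0) near_s := s_cvg.
have /cvgrPdist_le /(_ _ e'0) near_b := box_cvg.
near=> n.
have h1 : `|EQ (fun w => \sum_k g k * cQ w k) - EP (fun w => \sum_k g k * cP n w k)| <= e.
  by near: n.
have h2 : `|EQ bQ - EP (bP n)| <= e / (K + 1) by near: n.
have h3 : K * (1 - EP (bP n)) <= e + e.
  have -> : K * (1 - EP (bP n)) = K * (1 - EQ bQ) + K * (EQ bQ - EP (bP n)) by ring.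
  rewrite lerD// (le_trans (ler_norm _))// normrM (ger0_norm K0).
  rewrite (le_trans (ler_wpM2l K0 h2))// mulrCA ler_piMr ?(ltW e0)//.
  by rewrite ler_pdivrMr// mul1r lerDl.
have h4 := hP n.
rewrite (le_trans (ler_distD (EQ (fun w => \sum_k g k * cQ w k)) _ _))//.
have -> : e6 = (e + e) + (e + (e + (e + e))) by rewrite /e; field.
rewrite lerD//; first by rewrite (le_trans hQ)// lerD2l.
rewrite (le_trans (ler_distD (EP (fun w => \sum_k g k * cP n w k)) _ _))// lerD//.
by rewrite distrC (le_trans h4)// lerD2l.
Unshelve. all: by end_near. Qed.
End convergence_by_cells.

(** * Minimum contrast estimators *)

Section hinge.
Context {R : realType}.
Implicit Types x y z : R.

Definition hinge x y : R := (y <= x)%R%:R * (x - y).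

Lemma hinge_ge0 x y : 0 <= hinge x y.
Proof. by rewrite /hinge; case: (leP y x) => xy; rewrite ?mul0r ?mul1r ?subr_ge0. Qed.

(** The indicator of y <= x is a subgradient at x of the convex function
    x |-> (x - y)^+. *)
Lemma hinge_subgradient x y z : hinge x y + (z - x) * (y <= x)%R%:R <= hinge z y.
Proof.
have := hinge_ge0 z y; rewrite /hinge.
by case: (leP y x) => xy; case: (leP y z) => zy; rewrite ?mul1r ?mul0r ?mulr0 ?mulr1; lra.
Qed.

End hinge.

Section min_contrast_estimator.
Context {R : realType} (calG : R -> R) (alpha : R) (n : nat) (y : nat -> R) (q e : R).
Hypothesis calGP : scoring_generator calG.
Hypothesis alpha01 : 0 < alpha < 1.
Hypothesis minq : min_contrast calG alpha n y q e.

Let G : R -> R := calG^`()%classic.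

Let dcalG (x : R) : is_derive x 1 calG (G x).
Proof.
case: calGP => d _ _ _; apply: DeriveDef; first exact: (d 0%N isT x).
by rewrite /G derive1E.
Qed.

Let dG (x : R) : is_derive x 1 G (calG^`(2)%classic x).
Proof.
case: calGP => d _ _ _; apply: DeriveDef; first exact: (d 1%N isT x).
by rewrite derive1nS derive1n1 derive1E.
Qed.

(** The function G increases from its limit 0. *)
Let G_ge0 x : 0 <= G x.
Proof.
case: calGP => _ _ G'0 G0; rewrite leNgt; apply/negP => Gx.
have G2 : 0 < - G x / 2 by rewrite divr_gt0// oppr_gt0.
have /cvgrPdist_lt /(_ _ G2) near_G := G0.
case: near_G => A [_ /= HA]; pose t := Num.min A x - 1.
have tA : t < A by rewrite ltrBlDr (@le_lt_trans _ _ A) ?ge_min ?lexx// ltrDl.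
have tx : t < x by rewrite ltrBlDr (@le_lt_trans _ _ x) ?ge_min ?lexx ?orbT// ltrDl.
have [c _ Gc] := MVT_real dG tx.
have : 0 < G x - G t by rewrite Gc mulr_gt0// subr_gt0.
have := HA t tA; rewrite sub0r normrN -/G ltr_norml => /andP[? _]; lra.
Qed.

Let pinball x := \sum_(i < n) ((y i <= x)%R%:R - alpha) * (x - y i).

Let pinballE x : pinball x =
  \sum_(i < n) hinge x (y i) - alpha * (n%:R * x - \sum_(i < n) y i).
Proof.
rewrite /pinball (_ : n%:R * x = \sum_(i < n) x); last first.
  by rewrite sumr_const card_ord mulr_natl.
rewrite -sumrB mulr_sumr -sumrB; apply: eq_bigr => i _.
by rewrite /hinge; ring.
Qed.

Let sum_score x1 x2 : \sum_(i < n) score calG alpha x1 x2 (y i) =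
  (1 + alpha^-1 * G x2) * pinball x1 + G x2 * (n%:R * x2 - \sum_(i < n) y i)
   - n%:R * calG x2.
Proof.
rewrite /pinball mulr_sumr (_ : n%:R * x2 = \sum_(i < n) x2); last first.
  by rewrite sumr_const card_ord mulr_natl.
rewrite -sumrB mulr_sumr -big_split/= (_ : n%:R * calG x2 = \sum_(i < n) calG x2); last first.
  by rewrite sumr_const card_ord mulr_natl.
by rewrite -sumrB; apply: eq_bigr => i _; rewrite /score -/G; ring.
Qed.

(** The derivative of the score in its second argument is calG'' times the
    difference of the two sides, and calG'' > 0. *)
Lemma min_contrast_es :
  n%:R * e = n%:R * q - alpha^-1 * \sum_(i < n) hinge q (y i).
Proof.
have /andP[a0 _] := alpha01.
pose Y := \sum_(i < n) y i.
pose phi (t : R) : R := (1 + alpha^-1 * G t) * pinball q + G t * (n%:R * t - Y)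
   - n%:R * calG t.
pose phi' (t : R) : R := calG^`(2)%classic t * (alpha^-1 * pinball q + (n%:R * t - Y)).
have dphi (t : R) : is_derive t 1 phi (phi' t).
  have dg := dG t; have dc := dcalG t.
  apply: is_derive_eq; rewrite /GRing.scale/= /phi'.
  rewrite -[calG^`(2)%classic t]/((calG^`())^`()%classic t); ring.
have e_itv : e \in `]e - 1, e + 1[%R by rewrite in_itv/=; apply/andP; split; lra.
have e_le : e - 1 <= e + 1 by lra.
have phie t : phi e <= phi t by rewrite /phi -!sum_score; exact: minq.
have d0 : is_derive e 1 phi 0.
  by apply: derive1_at_min e_le _ e_itv _ => t _ //; have [] := dphi t.
have : phi' e = 0 by rewrite -(@derive_val _ _ _ _ _ _ _ (dphi e)) (@derive_val _ _ _ _ _ _ _ d0).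
case: calGP => _ _ G'0 _; have G'e := G'0 e.
move=> /eqP; rewrite /phi' mulf_eq0 (gt_eqF G'e) orFb => /eqP.
rewrite pinballE mulrBr mulrA mulVf ?gt_eqF// mul1r -/Y; lra.
Qed.

Let D x := \sum_(i < n) (y i <= x)%R%:R - alpha * n%:R.

Let pinball_subgradient x z : pinball x + (z - x) * D x <= pinball z.
Proof.
have : \sum_(i < n) (hinge x (y i) + (z - x) * (y i <= x)%R%:R) <= \sum_(i < n) hinge z (y i).
  by apply: ler_sum => i _; exact: hinge_subgradient.
by rewrite big_split/= -mulr_sumr !pinballE /D; lra.
Qed.

Let pinball_min z : pinball q <= pinball z.
Proof.
have := minq z e; rewrite !sum_score !lerD2r ler_pM2l// ltr_wpDr//.
by case/andP: alpha01 => a0 _; rewrite mulr_ge0// invr_ge0 ltW.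
Qed.

(** The slope of a convex function has the sign of the distance to a minimiser. *)
Let min_sign z : (q - z) * D z <= 0.
Proof.
have := pinball_subgradient z q; have := pinball_min z => h /le_trans /(_ h).
by rewrite gerDl.
Qed.

Lemma min_contrast_lt x : x < q -> \sum_(i < n) (y i <= x)%R%:R <= alpha * n%:R.
Proof.
move=> xq; rewrite -subr_le0 -/(D x).
by have := min_sign x; rewrite pmulr_rle0// subr_gt0.
Qed.

(** The slope is only nonnegative to the right of q, but the empirical distribution
    function is right-continuous. *)
Lemma min_contrast_le x : q <= x -> alpha * n%:R <= \sum_(i < n) (y i <= x)%R%:R.
Proof.
move=> qx.
have [x' xx' ->] : exists2 x', x < x' &
    \sum_(i < n) (y i <= x)%R%:R = \sum_(i < n) (y i <= x')%R%:R :> R.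
  have : \forall x' \near x^'+, forall i : 'I_n, (y i <= x') = (y i <= x).
    apply: filter_forall => i; have [yx|xy] := leP (y i) x; near=> x'.
      by rewrite (le_trans yx)// ltW.
    by apply/negbTE; rewrite -ltNge; near: x'; exact: nbhs_right_lt.
  move=> /(filterI (nbhs_right_gt x)) /filter_ex[x' [xx' h]]; exists x' => //.
  by apply: eq_bigr => i _; rewrite h.
rewrite -subr_ge0 -/(D x').
by have := min_sign x'; rewrite nmulr_rle0// subr_lt0 (le_lt_trans qx).
Unshelve. all: by end_near. Qed.

(** The function H is concave and maximal at q, since it differs from a negative
    multiple of the pinball loss by a constant. *)
Lemma min_contrast_remainder x :
  let H t := n%:R * t - alpha^-1 * \sum_(i < n) hinge t (y i) in
  0 <= H q - H x /\ H q - H x <= alpha^-1 * `|q - x| * `|\sum_(i < n) (y i <= x)%R%:R - alpha * n%:R|.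
Proof.
have /andP[a0 _] := alpha01.
move=> H; have -> : H q - H x = alpha^-1 * (pinball x - pinball q).
  by rewrite !pinballE /H; field; rewrite gt_eqF.
split; first by rewrite mulr_ge0 ?invr_ge0 ?subr_ge0 ?(ltW a0)//=.
rewrite -mulrA ler_wpM2l ?invr_ge0 ?(ltW a0)// -normrM -normrN.
rewrite (le_trans _ (ler_norm _))// -/(D x) lerBlDr.
by have := pinball_subgradient x q; lra.
Qed.

End min_contrast_estimator.

(** * Quantiles and the quantile transform *)

Section quantiles.
Context d (T : measurableType d) (R : realType) {P : probability T R}.
Variable Y : {RV P >-> R}.
Hypothesis Y1 : integrableR P Y.

Local Notation E f := (Rintegral P setT f).
Local Notation F := (dist_fun Y).
Local Notation q a := (quantile F a).
Local Notation es a := (lower_es F a).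

Lemma dist_fun_EFin x : (F x)%:E = cdf Y x.
Proof. by rewrite /dist_fun fineK// fin_num_measure. Qed.

Lemma dist_funE x : F x = E (fun w => (Y w <= x)%R%:R).
Proof.
apply: EFin_inj; by rewrite dist_fun_EFin expectR_pred//; exact: measurable_fun_ler.
Qed.

Lemma dist_fun_nd x y : x <= y -> F x <= F y.
Proof. by move=> xy; rewrite -lee_fin !dist_fun_EFin; exact: cdf_nondecreasing. Qed.

Lemma dist_fun_ge0 x : 0 <= F x.
Proof. by rewrite -lee_fin dist_fun_EFin cdf_ge0. Qed.

(** The infimum in the definition of the quantile is attained, by right continuity. *)
Lemma quantile_le u x : 0 < u < 1 -> (q u <= x) = (u <= F x).
Proof.
move=> /andP[u0 u1].
pose S := [set x | u <= F x].
have S0 : S !=set0.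
  have Fy : F y @[y --> +oo] --> (1 : R) by apply: fine_cvg; exact: cvg_cdfy1.
  have /cvgr_gt /(_ _ u1) [A [_ /(_ (A + 1))]] := Fy.
  by rewrite ltrDl => /(_ ltr01) /ltW ?; exists (A + 1).
have [m Sm] : exists m, lbound S m.
  have Fy : F y @[y --> -oo] --> (0 : R) by apply: fine_cvg; exact: cvg_cdfNy0.
  have /cvgr_lt /(_ _ u0) [A [_ /(_ (A - 1))]] := Fy.
  rewrite ltrBlDr ltrDl => /(_ ltr01) FA; exists (A - 1) => y Sy.
  rewrite leNgt; apply/negP => /ltW /dist_fun_nd FyA.
  by have := lt_le_trans FA (le_trans Sy FyA); rewrite ltxx.
have hS : has_inf S by split => //; exists m.
apply/idP/idP => [qx|Sx]; last by apply: ge_inf => //; exists m.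
have Sq y : q u < y -> u <= F y.
  by move=> /(inf_lt S0)[z Sz /ltW /dist_fun_nd]; exact: le_trans.
rewrite leNgt; apply/negP => Fxu.
have Fx : F y @[y --> x^'+] --> F x.
  by apply: fine_cvg; rewrite dist_fun_EFin; exact: cdf_right_continuous.
have /cvgr_lt /(_ _ Fxu) near_x := Fx.
move: near_x => /(filterI (nbhs_right_gt x)) /filter_ex[y [xy /=]].
by rewrite ltNge Sq// (le_lt_trans qx).
Qed.

Lemma quantile_nd u v : 0 < u < 1 -> 0 < v < 1 -> u <= v -> q u <= q v.
Proof. by move=> u01 v01 uv; rewrite quantile_le// (le_trans uv)// -quantile_le. Qed.

Lemma dist_fun_quantile u : 0 < u < 1 -> {for q u, continuous F} -> F (q u) = u.
Proof.
move=> u01 Fc; apply/eqP; rewrite eq_le -[X in _ && X]quantile_le// lexx andbT leNgt.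
apply/negP => uF.
have /cvgr_gt /(_ _ uF) [e /= e0 H] := Fc.
have := H (q u - e / 2); rewrite /= opprB addrCA subrr addr0 gtr0_norm ?divr_gt0//.
have -> : e / 2 < e by lra.
move=> /(_ isT) /ltW; rewrite -quantile_le//; lra.
Qed.

Let hinge_integrable x : integrableR P (fun w => hinge x (Y w)).
Proof.
apply: (@le_integrableR _ _ _ _ _ (fun w => `|x| + `|Y w|)).
- apply: measurable_funM; last exact: measurable_funB.
  apply: (integrableR_measurable (P := P)); apply: integrableR_pred.
  exact: measurable_fun_ler.
- by apply: integrableRD; [exact: integrableR_cst|exact: integrableR_norm].
- move=> w; rewrite /hinge normrM (le_trans _ (ler_normB _ _))//.
  by case: (Y w <= x); rewrite ?normr0 ?normr1 ?mul0r ?mul1r.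
Qed.

(** The quantile function of a uniform variable on ]0, 1[ has the law of Y, and it
    is at most q(a) exactly on ]0, a]. *)
Lemma expectR_hinge_quantile a : 0 < a < 1 -> F (q a) = a ->
  E (fun w => hinge (q a) (Y w)) = a * (q a - es a).
Proof.
move=> a01 Fq; have /andP[a0 a1] := a01.
pose mu := @lebesgue_measure R.
pose Qt : R -> R := (fun u => q u) \_ `]0, 1[.
have mq : measurable_fun (`]0, 1[%classic : set (measurableTypeR R)) (fun u => q u).
  apply: (measurability (@RGenOInfty.G R)) => [|/= _ [_] [r] -> <-].
    exact: RGenOInfty.measurableE.
  rewrite (_ : _ `&` _ = `]F r, 1[%classic)//.
  apply/seteqP; split => u /=; rewrite !in_itv/= andbT.
    by move=> [u01]; rewrite !ltNge quantile_le// -!ltNge => ->; case/andP: u01.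
  move=> /andP[Fu u1]; have u01 : 0 < u < 1 by rewrite u1 (le_lt_trans _ Fu)// dist_fun_ge0.
  by split => //; rewrite ltNge quantile_le// -ltNge.
have mQt : measurable_fun [set: measurableTypeR R] (Qt : measurableTypeR R -> R).
  exact: (proj1 (measurable_restrictT _ _)).
pose U := uniform_prob (@ltr01 R) : probability (measurableTypeR R) R.
pose QU : {RV U >-> R} := @mfun_Sub _ _ (measurableTypeR R) R _ (mem_set mQt).
have ge0_integralU (f : R -> \bar R) : measurable_fun [set: measurableTypeR R] f ->
    (forall x, (0 <= f x)%E) ->
    (\int[U]_x f x = \int[mu]_(x in `]0%R, 1%R[) f x)%E.
  move=> mf f0; rewrite integral_uniform// subr0 invr1 mul1e.
  by rewrite integral_itv_bndoo//; exact: measurable_funS mf.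
have law B : measurable B -> U (QU @^-1` B) = P (Y @^-1` B).
  apply: eq_cdf_law => x.
  rewrite -[RHS]dist_fun_EFin.
  have mZ : measurable (QU @^-1` `]-oo, x]%classic : set (measurableTypeR R)).
    by rewrite -[X in measurable X]setTI; apply: (@measurable_funPT _ _ _ _ QU).
  set A : set R := QU @^-1` _ in mZ *.
  transitivity (mu (A `&` `]0, 1[%classic)).
    transitivity (\int[U]_x (\1_A x)%:E)%E; first by rewrite integral_indic// setIT.
    rewrite ge0_integralU//; last by apply/measurable_EFinP; exact: measurable_indic.
    by rewrite integral_indic.
  rewrite /A.
  have [F1|F1] := ltP (F x) 1.
    rewrite (_ : _ `&` _ = `]0, F x]%classic) /mu ?lebesgue_measure_itv/=.
      by rewrite lte_fin EFinN oppe0 adde0; case: ltgtP (dist_fun_ge0 x) => // <-.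
    apply/seteqP; split => u /=; rewrite !in_itv/=.
      move=> [+ u01]; rewrite /Qt patchE mem_set ?in_itv//= quantile_le//.
      by case/andP: u01 => ->.
    move=> /andP[u0 uF]; have u01 : 0 < u < 1 by rewrite u0 (le_lt_trans uF).
    by split => //; rewrite /Qt patchE mem_set ?in_itv//= quantile_le.
  rewrite (_ : _ `&` _ = `]0, 1[%classic) /mu ?lebesgue_measure_itv/=.
    rewrite lte_fin ltr01 EFinN oppe0 adde0; congr EFin; apply/eqP; rewrite eq_le F1/=.
    by rewrite -lee_fin dist_fun_EFin cdf_le1.
  apply/seteqP; split => u /=; rewrite !in_itv/=; first by case.
  move=> u01; split => //; rewrite /Qt patchE mem_set ?in_itv//= quantile_le//.
  by rewrite (le_trans _ F1)//; case/andP: u01 => _ /ltW.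
have mh : measurable_fun [set: R] (hinge (q a)).
  apply: measurable_funM; last exact: measurable_funB.
  apply: (measurable_comp (F := setT)) => //; exact: measurable_fun_ler.
have iQ := eq_law_integrableR law mh (hinge_integrable (q a)).
have e1 : (\int[mu]_(u in `]0%R, a]) (q a - q u)%:E)%E = (E (fun w => hinge (q a) (Y w)))%:E.
  rewrite -(eq_law_expectR law mh (hinge_integrable (q a))) expectR_EFin//.
  rewrite ge0_integralU; last first.
  - by move=> u; rewrite lee_fin hinge_ge0.
  - by apply/measurable_EFinP; exact: (measurableT_comp mh).
  rewrite -(_ : `]0, 1[ `&` `]0, a] = `]0, a]%classic) ?integral_mkcondr.
    apply: eq_integral => u; rewrite inE/= in_itv/= => u01.
    rewrite /= /Qt !patchE (mem_set (A := `]0, 1[)) ?in_itv//=.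
    case: ifPn; rewrite ?inE ?notin_setE/= in_itv/= => ua.
      by rewrite /hinge quantile_le// Fq; case/andP: ua => _ ->; rewrite mul1r.
    rewrite /hinge quantile_le// Fq; case: (u <= a) ua; rewrite ?mul0r//.
    by case/andP: u01 => -> _ [].
  apply/seteqP; split => u /=; rewrite !in_itv/=; first by case.
  by move=> /andP[u0 ua]; rewrite u0 (le_lt_trans ua).
have a01S : `]0, a]%classic `<=` (`]0, 1[%classic : set R).
  by move=> u /=; rewrite !in_itv/= => /andP[-> ua]; exact: le_lt_trans ua a1.
have mqa : measurable_fun (`]0, a]%classic : set (measurableTypeR R)) (fun u => q a - q u).
  by apply: measurable_funB => //; exact: measurable_funS a01S mq.
have mu_a : mu `]0, a]%classic = a%:E.
  by rewrite /mu lebesgue_measure_itv/= lte_fin a0 EFinN oppe0 adde0.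
have i1 : mu.-integrable `]0, a]%classic (EFin \o (fun u => q a - q u)).
  apply/integrableP; split; first exact/measurable_EFinP.
  rewrite (_ : integral _ _ _ = (E (fun w => hinge (q a) (Y w)))%:E) ?ltry//.
  rewrite -e1; apply: eq_integral => u; rewrite inE/= in_itv/= => /andP[u0 ua]; rewrite /= ger0_norm// subr_ge0.
  by rewrite quantile_nd// u0 (le_lt_trans ua).
have i2 : mu.-integrable `]0, a]%classic (EFin \o (fun=> q a)).
  apply/integrableP; split; first exact/measurable_EFinP.
  by rewrite /= integral_cst// [X in (_ * X < _)%E]mu_a ltry.
have e2 : \int[mu]_(u in `]0%R, a]) q u = q a * a - E (fun w => hinge (q a) (Y w)).
  rewrite -[X in _ = _ - X]/(fine (E (fun w => hinge (q a) (Y w)))%:E) -e1.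
  rewrite -[X in _ = _ - X]/(Rintegral mu `]0%R, a] (fun u => q a - q u)).
  rewrite -[X in _ = X - _]/(q a * fine a%:E) -mu_a -Rintegral_cst//.
  by rewrite -RintegralB//; apply: eq_Rintegral => u _; rewrite subKr.
by rewrite /lower_es e2; field; rewrite gt_eqF.
Qed.
End quantiles.

(** * Influence functions and their covariances *)

Section influence_functions.
Context d (T : measurableType d) (R : realType) {P : probability T R}.
Variables (Y : {RV P >-> R}) (k : nat) (alpha : 'I_k -> R).
Hypothesis Y1 : integrableR P Y.
Hypothesis Y2 : integrableR P (fun w => (Y w <= 0)%R%:R * Y w ^+ 2).
Hypothesis alpha01 : forall m, 0 < alpha m < 1.

Local Notation E f := (Rintegral P setT f).
Local Notation F := (dist_fun Y).
Local Notation q m := (quantile F (alpha m)).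
Local Notation es m := (lower_es F (alpha m)).

Hypothesis Fq : forall m, F (q m) = alpha m.

Let mY : measurable_fun setT Y := @measurable_funPT _ _ _ _ Y.

(** The first order effect of one observation on the quantile estimator, before
    division by the local slope of F, and on the expected shortfall estimator. *)
Definition influence (i : 'I_k * 'I_2) (y : R) : R :=
  if i.2 == 0 then alpha i.1 - (y <= q i.1)%R%:R
  else - (alpha i.1)^-1 * (hinge (q i.1) y - alpha i.1 * (q i.1 - es i.1)).

Lemma measurable_le_cst (c : R) : measurable_fun setT (fun y : R => (y <= c)%R%:R : R).
Proof.
apply: (measurableT_comp (f := fun b : bool => b%:R : R)) => //.
exact: measurable_fun_ler.
Qed.

Lemma measurable_hinge (c : R) : measurable_fun setT (hinge c).
Proof. by apply: measurable_funM; [exact: measurable_le_cst|exact: measurable_funB]. Qed.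

Lemma measurable_influence i : measurable_fun setT (influence i).
Proof.
rewrite /influence; case: (_ == 0).
  by apply: measurable_funB => //; exact: measurable_le_cst.
by apply: measurable_funM => //; apply: measurable_funB => //; exact: measurable_hinge.
Qed.

Let below m w : R := (Y w <= q m)%R%:R.

Let mbelow m : measurable_fun setT (below m).
Proof. exact: (measurableT_comp (measurable_le_cst _) mY). Qed.

Let i0 m : integrableR P (below m).
Proof. by apply: integrableR_pred; exact: measurable_fun_ler. Qed.

Let i1 m : integrableR P (fun w => below m w * Y w).
Proof.
under eq_fun do rewrite mulrC.
apply: (@integrableRM_bounded _ _ _ _ _ _ 1) => // w.
by rewrite /below; case: (Y w <= _); rewrite ?normr0 ?normr1.
Qed.

Let i2 m : integrableR P (fun w => below m w * Y w ^+ 2).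
Proof.
apply: (@le_integrableR _ _ _ _ _ (fun w => (Y w <= 0)%R%:R * Y w ^+ 2 + (q m) ^+ 2)).
- by apply: measurable_funM => //; exact: measurable_funX.
- by apply: integrableRD => //; exact: integrableR_cst.
- move=> w; rewrite /below; have [Yq|_] := leP (Y w) (q m); last first.
    by rewrite mul0r normr0 addr_ge0 ?sqr_ge0// mulr_ge0// sqr_ge0.
  rewrite mul1r ger0_norm ?sqr_ge0//; have [Y0|Y0] := leP (Y w) 0.
    by rewrite mul1r lerDl sqr_ge0.
  by rewrite mul0r add0r lerXn2r// nnegrE ltW// (lt_le_trans Y0).
Qed.

Let E0 m : E (below m) = alpha m.
Proof. by rewrite -[RHS]Fq dist_funE. Qed.

Let E1 m : E (fun w => below m w * Y w) = alpha m * es m.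
Proof.
have h := expectR_hinge_quantile Y1 (alpha01 m) (Fq m).
have : E (fun w => hinge (q m) (Y w)) = q m * alpha m - E (fun w => below m w * Y w).
  rewrite -[X in _ * X - _](E0 m) -expectRZ// -expectRB//; last exact: integrableRZ.
  by apply: eq_expectR => w; rewrite /hinge /below; ring.
by rewrite h => e; lra.
Qed.

Let lower (s t : 'I_k) := if alpha s <= alpha t then s else t.

Let alpha_lower s t : alpha (lower s t) = Num.min (alpha s) (alpha t).
Proof. by rewrite /lower minElt; case: ltgtP. Qed.

(** Products of indicators and hinges at two levels reduce to moments below the
    lower quantile. *)
Let belowM s t w : below s w * below t w = below (lower s t) w.
Proof.
have nd s' t' : alpha s' <= alpha t' -> q s' <= q t' by exact: quantile_nd.
rewrite /lower; have [/nd st|/ltW/nd ts] := leP (alpha s) (alpha t); rewrite /below.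
  case: (leP (Y w) (q s)) => Ys; last by rewrite mul0r.
  by rewrite (le_trans Ys st) mulr1.
case: (leP (Y w) (q t)) => Yt; last by rewrite mulr0.
by rewrite (le_trans Yt ts) mulr1.
Qed.

Let hingeE s w : hinge (q s) (Y w) = below s w * (q s - Y w).
Proof. by []. Qed.

Let ihinge s : integrableR P (fun w => hinge (q s) (Y w)).
Proof.
rewrite (_ : (fun w => _) = fun w => q s * below s w - below s w * Y w).
  by apply: integrableRB => //; exact: integrableRZ.
by apply/funext => w; rewrite hingeE; ring.
Qed.

Let bh s t w : below s w * hinge (q t) (Y w) =
  q t * below (lower s t) w - below (lower s t) w * Y w.
Proof. by rewrite hingeE -belowM; ring. Qed.

Let hh s t w : hinge (q s) (Y w) * hinge (q t) (Y w) =
  q s * q t * below (lower s t) w - (q s + q t) * (below (lower s t) w * Y w)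
  + below (lower s t) w * Y w ^+ 2.
Proof. by rewrite !hingeE -belowM; ring. Qed.

Let ibh s t : integrableR P (fun w => below s w * hinge (q t) (Y w)).
Proof.
under eq_fun do rewrite bh; by apply: integrableRB => //; exact: integrableRZ.
Qed.

Let ihh s t : integrableR P (fun w => hinge (q s) (Y w) * hinge (q t) (Y w)).
Proof.
under eq_fun do rewrite hh; apply: integrableRD => //.
by apply: integrableRB; exact: integrableRZ.
Qed.

Let Ebb s t : E (fun w => below s w * below t w) = Num.min (alpha s) (alpha t).
Proof. by rewrite -alpha_lower -E0; apply: eq_expectR => w; rewrite belowM. Qed.

Let Ebh s t : E (fun w => below s w * hinge (q t) (Y w)) =
  Num.min (alpha s) (alpha t) * (q t - lower_es F (Num.min (alpha s) (alpha t))).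
Proof.
rewrite -alpha_lower (eq_expectR (bh s t)) expectRB//; last exact: integrableRZ.
by rewrite expectRZ// E0 E1; ring.
Qed.

Let Ehh s t : E (fun w => hinge (q s) (Y w) * hinge (q t) (Y w)) =
  Num.min (alpha s) (alpha t) *
    (q s * q t - (q s + q t) * lower_es F (Num.min (alpha s) (alpha t)))
  + E (fun w => (Y w <= quantile F (Num.min (alpha s) (alpha t)))%R%:R * Y w ^+ 2).
Proof.
rewrite -alpha_lower (eq_expectR (hh s t)) expectRD//; last first.
  by apply: integrableRB; exact: integrableRZ.
rewrite expectRB; [|exact: integrableRZ..].
by rewrite !expectRZ// E0 E1; ring.
Qed.

Let Eh s : E (fun w => hinge (q s) (Y w)) = alpha s * (q s - es s).
Proof. exact: expectR_hinge_quantile. Qed.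

Lemma expectR_influence i : E (fun w => influence i (Y w)) = 0.
Proof.
have ic c : integrableR P (fun=> c) by exact: integrableR_cst.
rewrite /influence; case: (_ == 0).
  by rewrite expectRB ?expectR_cst ?E0 ?subrr//; exact: i0.
rewrite expectRZ ?expectRB ?expectR_cst ?Eh ?subrr ?mulr0//.
exact: integrableRB.
Qed.

Lemma integrableR_influence_sqr i : integrableR P (fun w => influence i (Y w) ^+ 2).
Proof.
have ic c : integrableR P (fun=> c) by exact: integrableR_cst.
rewrite /influence; case: (_ == 0).
  apply: (@bounded_integrableR _ _ _ _ _ 1) => [|w].
    by apply: measurable_funX; apply: measurable_funB => //; exact: mbelow.
  have /andP[a0 a1] := alpha01 i.1.
  rewrite normrX exprn_ile1// ler_norml.
  by case: (Y w <= _) => /=; apply/andP; split; lra.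
set b := _^-1; set c := _ * (_ - _).
rewrite (_ : (fun w => _) = fun w => b ^+ 2 * (hinge (q i.1) (Y w) * hinge (q i.1) (Y w)
   - 2 * c * hinge (q i.1) (Y w) + c ^+ 2)); last by apply/funext => w; ring.
by apply: integrableRZ; apply: integrableRD => //; apply: integrableRB => //; exact: integrableRZ.
Qed.

Lemma expectR_influenceM i j :
  E (fun w => influence i (Y w) * influence j (Y w)) = limit_cov Y alpha i j.
Proof.
have ic c : integrableR P (fun=> c) by exact: integrableR_cst.
have a0 m : alpha m != 0 by rewrite gt_eqF//; case/andP: (alpha01 m).
have Ec s c : E (fun w => (alpha s - below s w) * c) = 0.
  under eq_expectR do rewrite mulrC.
  by rewrite expectRZ ?expectRB ?expectR_cst ?E0 ?subrr ?mulr0//; exact: integrableRB.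
have ibc s c : integrableR P (fun w => (alpha s - below s w) * c).
  by under eq_fun do rewrite mulrC; apply: integrableRZ; exact: integrableRB.
have qe s t : E (fun w => (alpha s - below s w) *
      (- (alpha t)^-1 * (hinge (q t) (Y w) - alpha t * (q t - es t)))) = cov_qe Y alpha s t.
  transitivity (E (fun w => (alpha t)^-1 * (below s w * hinge (q t) (Y w)
     - alpha s * hinge (q t) (Y w) + (alpha s - below s w) * (alpha t * (q t - es t))))).
    by apply: eq_expectR => w; ring.
  rewrite expectRZ; last first.
    by apply: integrableRD => //; apply: integrableRB => //; exact: integrableRZ.
  rewrite expectRD//; last by apply: integrableRB => //; exact: integrableRZ.
  rewrite expectRB//; last exact: integrableRZ.
  by rewrite expectRZ// Ec// addr0 Ebh Eh /cov_qe; field.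
have qq s t : E (fun w => (alpha s - below s w) * (alpha t - below t w)) = cov_qq alpha s t.
  have ibb : integrableR P (fun w => below s w * below t w).
    by under eq_fun do rewrite belowM.
  transitivity (E (fun w => below s w * below t w - alpha s * below t w
      + (alpha s - below s w) * alpha t)).
    by apply: eq_expectR => w; ring.
  rewrite expectRD//; last by apply: integrableRB => //; exact: integrableRZ.
  rewrite expectRB//; last exact: integrableRZ.
  by rewrite expectRZ// Ec// addr0 Ebb E0.
have ee s t : E (fun w => (- (alpha s)^-1 * (hinge (q s) (Y w) - alpha s * (q s - es s))) *
      (- (alpha t)^-1 * (hinge (q t) (Y w) - alpha t * (q t - es t)))) = cov_ee Y alpha s t.
  transitivity (E (fun w => (alpha s * alpha t)^-1 * (hinge (q s) (Y w) * hinge (q t) (Y w)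
     - alpha t * (q t - es t) * hinge (q s) (Y w)
     - alpha s * (q s - es s) * hinge (q t) (Y w)
     + alpha s * (q s - es s) * (alpha t * (q t - es t))))).
    by apply: eq_expectR => w; rewrite invfM; ring.
  have iz s' c : integrableR P (fun w => c * hinge (q s') (Y w)) by exact: integrableRZ.
  have im : integrableR P (fun w => hinge (q s) (Y w) * hinge (q t) (Y w)
     - alpha t * (q t - es t) * hinge (q s) (Y w)) by exact: integrableRB.
  have im2 : integrableR P (fun w => hinge (q s) (Y w) * hinge (q t) (Y w)
     - alpha t * (q t - es t) * hinge (q s) (Y w)
     - alpha s * (q s - es s) * hinge (q t) (Y w)) by exact: integrableRB.
  rewrite expectRZ; last exact: integrableRD.
  rewrite expectRD// expectR_cst expectRB// expectRB// !expectRZ// !Eh Ehh.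
  rewrite /cov_ee unlock -[fine _]/(E (fun w => _)).
  by field; rewrite !a0.
rewrite /influence /limit_cov; case: ifP => _; case: ifP => _.
- exact: qq.
- exact: qe.
- by rewrite -qe; apply: eq_expectR => w; rewrite mulrC.
- exact: ee.
Qed.

End influence_functions.

(** * Gaussian vectors and the multivariate central limit theorem *)

Lemma tight_real d (T : measurableType d) (R : realType) (P : probability T R)
    (W : T -> R) (e : R) : measurable_fun setT W -> 0 < e ->
  exists2 M : R, 0 < M & Rintegral P setT (fun w => (M < `|W w|)%R%:R) <= e.
Proof.
move=> mW e0; pose f_ n w : R := (n.+1%:R < `|W w|)%R%:R.
have cf : Rintegral P setT (f_ n) @[n --> \oo] --> Rintegral P setT (fun=> 0).
  apply: (@dominated_cvgR _ _ _ _ f_ _ (fun=> 1)).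
  - move=> n; apply: (integrableR_measurable (P := P)); apply: integrableR_pred.
    by apply: measurable_fun_ltr => //; exact: measurableT_comp.
  - exact: integrableR_cst.
  - by move=> n w; rewrite /f_; case: (_ < `|W w|); rewrite ?normr0 ?normr1.
  - move=> w; rewrite /f_; apply: cvg_near_cst.
    exists (Num.Def.archi_bound `|W w|) => // n /= Nn.
    suff -> : (n.+1%:R < `|W w|) = false by [].
    apply/negbTE; rewrite -leNgt (le_trans (ltW (archi_boundP (normr_ge0 _))))//.
    by rewrite ler_nat (leq_trans Nn).
rewrite expectR_cst in cf.
have /cvgrPdist_le /(_ _ e0) [n _ /(_ n)] := cf.
rewrite /= leqnn sub0r normrN => /(_ isT) h.
by exists n.+1%:R => //; apply: le_trans h; exact: ler_norm.
Qed.

Section gaussian_vectors.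
Context d (T : measurableType d) (R : realType) {P : probability T R} (I : finType).
Variables (W : I -> {RV P >-> R}) (Sigma : I -> I -> R).
Hypothesis W_gauss : centered_gaussian W Sigma.

Local Notation E f := (Rintegral P setT f).

Let mW i : measurable_fun setT (W i) := @measurable_funPT _ _ _ _ (W i).

Let lin (u : I -> R) w : R := \sum_i u i * W i w.

Let mlin u : measurable_fun setT (lin u).
Proof. by apply: measurable_sum => i; exact: measurable_funM. Qed.

(** A linear combination with variance 0 is almost surely 0; otherwise it has a
    density. *)
Lemma gaussian_phase th u : E (fun w => phase th u (fun i => W i w)) =
  cos th * expR (- (\sum_i \sum_j u i * u j * Sigma i j) / 2).
Proof.
have [_ /(_ u)] := W_gauss; set v := \sum_i _ => -[v0 law].
pose L : {RV P >-> R} := mfun_Sub (mem_set (mlin u)).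
have [v_eq0|v_neq0] := eqVneq v 0; last first.
  have sv : Num.sqrt v != 0 by rewrite sqrtr_eq0 -ltNge lt_neqAle eq_sym v_neq0.
  rewrite -[v in RHS]sqr_sqrtr//.
  apply: (expectR_cos_normal th sv (W := L)) => B mB.
  by have := law B mB; rewrite /centered_normal (negbTE v_neq0).
rewrite v_eq0 oppr0 mul0r expR0 mulr1.
have m0 : measurable_fun setT (fun w => lin u w == 0) by exact: measurable_fun_eqr.
have L0 : E (fun w => (lin u w == 0)%:R) = 1.
  apply: EFin_inj; rewrite expectR_pred//.
  have := law [set 0] (measurable_set1 0).
  rewrite /centered_normal v_eq0 eqxx diracE mem_set// => <-.
  by congr (P _); apply/seteqP; split => w /= /eqP.
rewrite -[RHS]mulr1 -L0 -expectRZ; last exact: integrableR_pred.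
apply/eqP; rewrite -subr_eq0 -normr_eq0 eq_le normr_ge0 andbT.
have i1 : integrableR P (fun w => phase th u (fun i => W i w)).
  apply: (@bounded_integrableR _ _ _ _ _ 1) => [|w]; last exact: cos_max.
  apply: measurableT_comp; first exact: measurable_cos.
  by apply: measurable_funD; [exact: measurable_cst|exact: mlin].
have i2 : integrableR P (fun w => cos th * (lin u w == 0)%:R).
  by apply: integrableRZ; exact: integrableR_pred.
rewrite -expectRB//.
apply: (@le_trans _ _ (E (fun w => 1 - (lin u w == 0)%:R))).
  apply: le_norm_expectR.
  - by apply: (integrableR_measurable (P := P)); exact: integrableRB.
  - by apply: integrableRB; [exact: integrableR_cst|exact: integrableR_pred].
  - move=> w; rewrite /phase -/(lin u w); have [->|_] := eqVneq (lin u w) 0.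
      by rewrite addr0 mulr1 !subrr normr0.
    by rewrite mulr0 !subr0 cos_max.
by rewrite expectRB ?expectR_cst ?L0 ?subrr//; [exact: integrableR_cst|exact: integrableR_pred].
Qed.

Lemma gaussian_atomless i x : Sigma i i != 0 -> E (fun w => (W i w == x)%:R) = 0.
Proof.
move=> Sii; have [_ /(_ (fun j => (j == i)%:R))] := W_gauss.
have -> : \sum_a \sum_b (a == i)%:R * (b == i)%:R * Sigma a b = Sigma i i.
  rewrite (bigD1 i)//= [X in _ + X]big1 ?addr0; last first.
    by move=> a /negbTE ->; rewrite big1// => b _; rewrite !mul0r.
  rewrite (bigD1 i)//= eqxx !mul1r big1 ?addr0// => b /negbTE ->.
  by rewrite mulr0 mul0r.
move=> [S0 /(_ [set x] (measurable_set1 x))].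
have -> : [set w | [set x] (\sum_a (a == i)%:R * W a w)] = [set w | W i w == x].
  apply/seteqP; split => w /=; (have -> : \sum_a (a == i)%:R * W a w = W i w by
    rewrite (bigD1 i)//= eqxx mul1r big1 ?addr0// => a /negbTE ->; rewrite mul0r).
    by move=> ->.
  by move/eqP.
rewrite /centered_normal (negbTE Sii) /normal_prob integral_set1 => h.
apply: EFin_inj; rewrite expectR_pred//; exact: measurable_fun_eqr.
Qed.

End gaussian_vectors.

Section iid_chebyshev.
Context d (T : measurableType d) (R : realType) {P : probability T R}.
Variables (Y : {RV P >-> R}) (X : nat -> {RV P >-> R}).
Hypothesis indep : mutually_independent X.
Hypothesis law : forall i x, cdf (X i) x = cdf Y x.

Local Notation E f := (Rintegral P setT f).

Lemma iid_chebyshev (h : R -> R) n c : measurable_fun setT h ->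
  integrableR P (fun w => h (Y w) ^+ 2) -> E (fun w => h (Y w)) = 0 -> 0 < c ->
  E (fun w => (c <= `|\sum_(j < n) h (X j w)|)%R%:R) <=
  n%:R * E (fun w => h (Y w) ^+ 2) / c ^+ 2.
Proof.
move=> mh h2 h0 c0.
have i2 := integrableR_iid_sum_sqr law mh h2 n.
have c2 : 0 < c ^+ 2 by rewrite exprn_gt0.
rewrite -(expectR_iid_sum_sqr indep law mh h2 n h0).
rewrite -(eq_expectR (f := fun w => (c ^+ 2 <= (\sum_(j < n) h (X j w)) ^+ 2)%R%:R)).
  by apply: expectR_markov => // w; exact: sqr_ge0.
by move=> w; rewrite -[X in _ <= X]real_normK ?num_real// ler_sqr// nnegrE ltW.
Qed.

End iid_chebyshev.

Section multivariate_clt.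
Context d (T : measurableType d) (R : realType) {P : probability T R} (I : finType).
Variables (Y : {RV P >-> R}) (X : nat -> {RV P >-> R}).
Hypothesis indep : mutually_independent X.
Hypothesis law : forall i x, cdf (X i) x = cdf Y x.
Variable xi : I -> R -> R.
Hypothesis mxi : forall i, measurable_fun setT (xi i).
Hypothesis xi2 : forall i, integrableR P (fun w => xi i (Y w) ^+ 2).
Hypothesis xi0 : forall i, Rintegral P setT (fun w => xi i (Y w)) = 0.

Local Notation E f := (Rintegral P setT f).

Definition normalized_sum (n : nat) (i : I) (w : T) : R :=
  (Num.sqrt n%:R)^-1 * \sum_(j < n) xi i (X j w).

Lemma measurable_normalized_sum n i : measurable_fun setT (normalized_sum n i).
Proof.
apply: measurable_funM => //; apply: measurable_sum => j.
by apply: measurableT_comp.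
Qed.

Let ixi i : integrableR P (fun w => xi i (Y w)).
Proof. by apply: integrableR_sqr => //; exact: measurableT_comp. Qed.

Let ixiM i j : integrableR P (fun w => xi i (Y w) * xi j (Y w)).
Proof. by apply: integrableRM_sqr => //; exact: measurableT_comp. Qed.

(** A linear combination of the normalised sums is the normalised sum of the
    linear combination of the summands. *)
Lemma multivariate_clt th u :
  E (fun w => phase th u (fun i => normalized_sum n i w)) @[n --> \oo] -->
  cos th * expR (- (\sum_i \sum_j u i * u j * E (fun w => xi i (Y w) * xi j (Y w))) / 2).
Proof.
pose g (y : R) : R := \sum_i u i * xi i y.
have mg : measurable_fun setT g.
  by apply: measurable_sum => i; apply: measurable_funM.
have g2E w : g (Y w) ^+ 2 = \sum_i \sum_j u i * u j * (xi i (Y w) * xi j (Y w)).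
  rewrite expr2 /g big_distrlr/=; apply: eq_bigr => i _; apply: eq_bigr => j _; ring.
have ig2 : integrableR P (fun w => g (Y w) ^+ 2).
  under eq_fun do rewrite g2E.
  by do 2?apply: integrableR_sum => ?; exact: integrableRZ.
have g0 : E (g \o Y) = 0.
  rewrite /g/= expectR_sum => [|i]; last exact: integrableRZ.
  by rewrite big1// => i _; rewrite expectRZ// xi0 mulr0.
have cl := clt_cos indep law mg ig2 g0 (th := th).
have vE : \sum_i \sum_j u i * u j * E (fun w => xi i (Y w) * xi j (Y w)) =
    E (fun w => g (Y w) ^+ 2).
  rewrite (eq_expectR g2E) expectR_sum => [|i]; last first.
    by apply: integrableR_sum => j; exact: integrableRZ.
  apply: eq_bigr => i _; rewrite expectR_sum => [|j]; last exact: integrableRZ.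
  by apply: eq_bigr => j _; rewrite expectRZ.
rewrite vE; apply: cvg_trans cl; apply: near_eq_cvg; apply: nearW => n.
apply: eq_expectR => w; congr (cos (th + _)).
rewrite -mulr_sumr; under [RHS]eq_bigr do rewrite /normalized_sum mulrCA mulr_sumr.
by rewrite -mulr_sumr exchange_big.
Qed.

Lemma normalized_sum_tight i (e : R) : 0 < e -> exists2 M : R, 0 < M &
  forall n, E (fun w => (M < `|normalized_sum n i w|)%R%:R) <= e.
Proof.
(* Chebyshev's inequality bounds the probability by v / M^2, and v / e <= M <= M^2. *)
move=> e0; pose v := E (fun w => xi i (Y w) ^+ 2); pose M := v / e + 1.
have v0 : 0 <= v by apply: expectR_ge0 => w; exact: sqr_ge0.
have ve0 : 0 <= v / e by rewrite divr_ge0// ltW.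
have M1 : 1 <= M by rewrite lerDr.
have M0 : 0 < M := lt_le_trans ltr01 M1.
have mV n : measurable_fun setT (normalized_sum n i) := measurable_normalized_sum n i.
exists M => // -[|n].
  rewrite (@eq_expectR _ _ _ _ _ (fun=> 0)) ?expectR_cst ?ltW// => w.
  by rewrite /normalized_sum big_ord0 mulr0 normr0 ltNge ltW.
have n0 : 0 < n.+1%:R :> R by rewrite ltr0n.
have s0 : 0 < Num.sqrt n.+1%:R :> R by rewrite sqrtr_gt0.
have c0 : 0 < M * Num.sqrt n.+1%:R by rewrite mulr_gt0.
have := @iid_chebyshev _ _ _ P Y X indep law (xi i) n.+1 (M * Num.sqrt n.+1%:R)
  (mxi i) (xi2 i) (xi0 i) c0.
have -> : n.+1%:R * v / (M * Num.sqrt n.+1%:R) ^+ 2 = v / M ^+ 2.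
  rewrite exprMn sqr_sqrtr ?ler0n//; field; by rewrite nat1r pnatr_eq0 gt_eqF.
move=> h; apply: (@le_trans _ _ (v / M ^+ 2)); last first.
  rewrite ler_pdivrMr ?exprn_gt0//; have : v = (M - 1) * e.
    by rewrite /M addrK divfK// gt_eqF.
  move=> ->; rewrite mulrC ler_wpM2l ?(ltW e0)//.
  by rewrite expr2; nra.
apply: le_trans h; apply: le_expectR => [||w].
- by apply: integrableR_pred; apply: measurable_fun_ltr => //; exact: measurableT_comp.
- apply: integrableR_pred; apply: measurable_fun_ler => //; apply: measurableT_comp => //.
  by apply: measurable_sum => j; exact: measurableT_comp.
- rewrite ler_nat /normalized_sum normrM ger0_norm ?invr_ge0 ?(ltW s0)//.
  by rewrite -ltr_pdivrMl ?invr_gt0// invrK mulrC; case: ltP => // /ltW ->.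
Qed.

End multivariate_clt.

(** * The influence functions are not degenerate *)

Section influence_variance.
Context d (T : measurableType d) (R : realType) {P : probability T R}.
Variables (Y : {RV P >-> R}) (k : nat) (alpha : 'I_k -> R).
Hypothesis Y1 : integrableR P Y.
Hypothesis Y2 : integrableR P (fun w => (Y w <= 0)%R%:R * Y w ^+ 2).
Hypothesis alpha01 : forall m, 0 < alpha m < 1.

Local Notation E f := (Rintegral P setT f).
Local Notation F := (dist_fun Y).
Local Notation q m := (quantile F (alpha m)).
Local Notation es m := (lower_es F (alpha m)).

Hypothesis Fc : forall m, {for q m, continuous F}.

Let Fq m : F (q m) = alpha m.
Proof. exact: dist_fun_quantile. Qed.

(** For the quantile the variance is alpha (1 - alpha). For the expected shortfall,
    the influence function is a constant on the event Y > q, which has probability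
    1 - alpha, and this constant is positive because F > 0 somewhere below q. *)
Lemma limit_cov_diag_neq0 i : limit_cov Y alpha i i != 0.
Proof.
have /andP[a0 a1] := alpha01 i.1; set m := i.1 in a0 a1.
rewrite -(expectR_influenceM Y1 Y2 alpha01 Fq).
have [i0|i0] := eqVneq i.2 0.
  rewrite (expectR_influenceM Y1 Y2 alpha01 Fq) /limit_cov i0 eqxx /cov_qq minxx.
  by rewrite -[X in X - _]mulr1 -mulrBr mulf_neq0 ?gt_eqF// subr_gt0.
pose c := alpha m * (q m - es m).
have c0 : 0 < c.
  have Fq0 : 0 < F (q m) by rewrite Fq.
  have /cvgr_gt /(_ _ Fq0) [e /= e0 H] := Fc (m := m).
  pose x := q m - e / 2.
  have Fx : 0 < F x by apply: H; rewrite /= opprB addrCA subrr addr0 gtr0_norm ?divr_gt0//; lra.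
  rewrite /c -(expectR_hinge_quantile Y1 (alpha01 m) (Fq m)).
  apply: (@lt_le_trans _ _ (e / 2 * F x)); first by rewrite mulr_gt0// divr_gt0.
  rewrite dist_funE -expectRZ; last by apply: integrableR_pred; exact: measurable_fun_ler.
  apply: le_expectR => [||w].
  - by apply: integrableRZ; apply: integrableR_pred; exact: measurable_fun_ler.
  - apply: (@le_integrableR _ _ _ _ _ (fun w => `|q m| + `|Y w|)).
    + by apply: measurableT_comp => //; exact: measurable_hinge.
    + by apply: integrableRD; [exact: integrableR_cst|exact: integrableR_norm].
    + move=> w; rewrite /hinge normrM (le_trans _ (ler_normB _ _))//.
      by case: (Y w <= q m); rewrite ?normr0 ?normr1 ?mul0r ?mul1r.
  - have [Yx|_] := leP (Y w) x; last by rewrite mulr0 hinge_ge0.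
    have e2 : 0 < e / 2 by rewrite divr_gt0.
    have -> : hinge (q m) (Y w) = q m - Y w.
      by rewrite /hinge (le_trans Yx) ?mul1r// /x gerBl ltW.
    by rewrite mulr1; move: Yx; rewrite /x; lra.
have b0 : 0 < ((alpha m)^-1 * c) ^+ 2 by rewrite exprn_gt0// mulr_gt0// invr_gt0.
rewrite gt_eqF// (lt_le_trans (y := ((alpha m)^-1 * c) ^+ 2 * (1 - alpha m)))//.
  by rewrite mulr_gt0// subr_gt0.
have ib : integrableR P (fun w => (Y w <= q m)%R%:R).
  by apply: integrableR_pred; exact: measurable_fun_ler.
rewrite -[X in _ * (_ - X)](Fq m) dist_funE -[X in _ * (X - _)](@expectR_cst _ _ _ P).
have ic : integrableR P (fun=> 1) by exact: integrableR_cst.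
rewrite -expectRB// -expectRZ; last exact: integrableRB.
apply: le_expectR => [||w].
- by apply: integrableRZ; exact: integrableRB.
- by under eq_fun do rewrite -expr2; apply: integrableR_influence_sqr.
- have [_|Yq] := leP (Y w) (q m); first by rewrite subrr mulr0 -expr2 sqr_ge0.
  have hq : hinge (q m) (Y w) = 0 by rewrite /hinge leNgt Yq mul0r.
  by rewrite subr0 mulr1 /influence (negbTE i0) -/m hq sub0r mulrNN -expr2.
Qed.

End influence_variance.

(** * The generalised inverse of the limit function *)

Section generalised_inverse.
Context {R : realType} (psi : R -> \bar R).
Hypothesis psi_nd : forall s t, s <= t -> (psi s <= psi t)%E.
Hypothesis psi0 : psi 0 = 0%E.
Hypothesis psi_y : psi t @[t --> +oo] --> +oo%E.
Hypothesis psi_Ny : psi t @[t --> -oo] --> -oo%E.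

Let lo x := [set t | t <= 0 /\ (x%:E <= psi t)%E].
Let hi x := [set t | 0 <= t /\ (psi t <= x%:E)%E].

Let lo_inf x : x < 0 -> has_inf (lo x).
Proof.
move=> x0; split; first by exists 0; split => //; rewrite psi0 lee_fin ltW.
have /cvgeNy_lt /(_ x) [A [_ H]] := psi_Ny.
exists (A - 1) => t [_ xt]; rewrite leNgt; apply/negP => tA.
have /H : t < A by rewrite (lt_trans tA)// ltrBlDr ltrDl.
by rewrite ltNge xt.
Qed.

Let hi_sup x : 0 < x -> has_sup (hi x).
Proof.
move=> x0; split; first by exists 0; split => //; rewrite psi0 lee_fin ltW.
have /cvgey_gt /(_ x) [A [_ H]] := psi_y.
exists (A + 1) => t [_ tx]; rewrite leNgt; apply/negP => tA.
have /H : A < t by rewrite (lt_trans _ tA)// ltrDl.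
by rewrite ltNge tx.
Qed.

(** Convergence is deduced from this inequality and [psi_inv_lt] alone. Both hold
    whatever point is chosen where psi is flat. *)
Lemma psi_inv_gt x t : t < psi_inv psi x -> (psi t <= x%:E)%E.
Proof.
rewrite /psi_inv; case: (ltgtP x 0) => [x0|x0|->].
- move=> tz; have t0 : t <= 0.
    rewrite (le_trans (ltW tz))//; apply: ge_inf; first by have [] := lo_inf x0.
    by split => //; rewrite psi0 lee_fin ltW.
  rewrite leNgt; apply/negP => /ltW xt; move: tz; rewrite ltNge => /negP; apply.
  by apply: ge_inf => //; have [] := lo_inf x0.
- move=> /(sup_gt (hi_sup x0).1)[s [_ sx] /ltW/psi_nd ts]; exact: le_trans ts sx.
- by move=> /ltW /psi_nd; rewrite psi0.
Qed.

Lemma psi_inv_lt x t : psi_inv psi x < t -> (x%:E <= psi t)%E.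
Proof.
rewrite /psi_inv; case: (ltgtP x 0) => [x0|x0|->].
- by move=> /(inf_lt (lo_inf x0).1)[s [_ xs] /ltW/psi_nd st]; exact: le_trans xs st.
- move=> zt; have z_ub s : hi x s -> s <= sup (hi x).
    by move=> xs; apply: ub_le_sup => //; have [] := hi_sup x0.
  have t0 : 0 <= t.
    by rewrite (le_trans _ (ltW zt))// z_ub//; split => //; rewrite psi0 lee_fin ltW.
  rewrite leNgt; apply/negP => /ltW tx; move: zt; rewrite ltNge => /negP; apply.
  exact: z_ub.
- by move=> /ltW /psi_nd; rewrite psi0.
Qed.

Lemma psi_inv_nd x y : x <= y -> psi_inv psi x <= psi_inv psi y.
Proof.
rewrite le_eqVlt => /predU1P[->//|xy]; rewrite leNgt; apply/negP => yx.
pose t := (psi_inv psi y + psi_inv psi x) / 2.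
have /psi_inv_lt yt : psi_inv psi y < t by rewrite /t; lra.
have /psi_inv_gt tx : t < psi_inv psi x by rewrite /t; lra.
by have := le_trans yt tx; rewrite lee_fin leNgt xy.
Qed.

Lemma measurable_psi_inv : measurable_fun setT (psi_inv psi).
Proof. by apply: nondecreasing_measurable => // x y; exact: psi_inv_nd. Qed.

End generalised_inverse.

(** * The estimators at one level *)

Lemma ereal_between {R : realType} (x y : \bar R) : (x < y)%E ->
  exists2 c : R, (x < c%:E)%E & (c%:E < y)%E.
Proof.
case: x => [r|//|]; case: y => [s||] //.
- rewrite lte_fin => rs; exists ((r + s) / 2); rewrite lte_fin; lra.
- by move=> _; exists (r + 1); rewrite ?ltry// lte_fin ltrDl.
- by move=> _; exists (s - 1); rewrite ?ltNyr// lte_fin gtrBl.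
- by move=> _; exists 0; rewrite ?ltNyr ?ltry.
Qed.

Section one_level.
Context d (T : measurableType d) (R : realType) {P : probability T R}.
Variables (Y : {RV P >-> R}) (X : nat -> {RV P >-> R}).
Hypothesis indep : mutually_independent X.
Hypothesis law : forall i x, cdf (X i) x = cdf Y x.
Variables (alpha : R) (calG : R -> R) (qhat eshat : nat -> {RV P >-> R}).
Hypothesis alpha01 : 0 < alpha < 1.

Local Notation E f := (Rintegral P setT f).
Local Notation F := (dist_fun Y).
Local Notation q := (quantile F alpha).
Local Notation es := (lower_es F alpha).

Hypothesis Fc : {for q, continuous F}.
Hypothesis F_incr : strictly_increasing_at F q.
Hypothesis calGP : scoring_generator calG.
Hypothesis minq : forall n w,
  min_contrast calG alpha n (fun i => X i w) (qhat n w) (eshat n w).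

Let mX i : measurable_fun setT (X i) := @measurable_funPT _ _ _ _ (X i).
Let mY : measurable_fun setT Y := @measurable_funPT _ _ _ _ Y.
Let Fq : F q = alpha.
Proof. exact: dist_fun_quantile. Qed.

Let xiq (y : R) : R := alpha - (y <= q)%R%:R.
Let xie (y : R) : R := - alpha^-1 * (hinge q y - alpha * (q - es)).
Let Vq n w : R := (Num.sqrt n%:R)^-1 * \sum_(j < n) xiq (X j w).
Let Ve n w : R := (Num.sqrt n%:R)^-1 * \sum_(j < n) xie (X j w).

Let mVq n : measurable_fun setT (Vq n).
Proof.
apply: measurable_funM => //; apply: measurable_sum => j; apply: measurable_funB => //.
exact: (measurableT_comp (measurable_le_cst _) (mX _)).
Qed.

Let icdf x : integrableR P (fun w => (Y w <= x)%R%:R).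
Proof. by apply: integrableR_pred; exact: measurable_fun_ler. Qed.

(** The increment of the indicator is a Bernoulli variable up to sign, and its
    variance is at most its mean. *)
Lemma expectR_cdf_increment_sqr x y :
  E (fun w => ((Y w <= y)%R%:R - (Y w <= x)%R%:R - (F y - F x)) ^+ 2) <= `|F y - F x|.
Proof.
wlog xy : x y / x <= y => [H|].
  have [/H//|/ltW/H] := leP x y; rewrite distrC => /(le_trans _); apply.
  rewrite le_eqVlt; apply/orP; left; apply/eqP; apply: eq_expectR => w; ring.
have iD : integrableR P (fun w => (Y w <= y)%R%:R - (Y w <= x)%R%:R : R) by exact: integrableRB.
rewrite ger0_norm ?subr_ge0 ?dist_fun_nd//; set D := F y - F x.
have ED : E (fun w => (Y w <= y)%R%:R - (Y w <= x)%R%:R) = D.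
  by rewrite expectRB// -!dist_funE.
apply: (@le_trans _ _ (E (fun w => ((Y w <= y)%R%:R - (Y w <= x)%R%:R) * (1 - 2 * D) + D ^+ 2))).
  rewrite le_eqVlt; apply/orP; left; apply/eqP; apply: eq_expectR => w.
  have [Yx|_] := leP (Y w) x; first by rewrite (le_trans Yx xy) /=; ring.
  by case: (Y w <= y) => /=; ring.
have iZ : integrableR P (fun w => ((Y w <= y)%R%:R - (Y w <= x)%R%:R) * (1 - 2 * D)).
  by under eq_fun do rewrite mulrC; exact: integrableRZ.
rewrite expectRD//; last exact: integrableR_cst.
rewrite expectR_cst; under eq_expectR do rewrite mulrC.
rewrite expectRZ// ED.
have : 0 <= D ^+ 2 by exact: sqr_ge0.
by rewrite !expr2; lra.
Qed.

Let isq x y : integrableR P (fun w => ((Y w <= y)%R%:R - (Y w <= x)%R%:R - (F y - F x)) ^+ 2).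
Proof.
apply: (@bounded_integrableR _ _ _ _ _ (2 ^+ 2)) => [|w].
  apply: measurable_funX; apply: measurable_funB => //.
  by apply: (integrableR_measurable (P := P)); exact: integrableRB.
rewrite normrX lerXn2r ?nnegrE//.
have := dist_fun_ge0 Y x; have := dist_fun_ge0 Y y.
have F1 z : F z <= 1 by rewrite -lee_fin dist_fun_EFin cdf_le1.
have := F1 x; have := F1 y; rewrite ler_norml.
by case: (Y w <= y); case: (Y w <= x) => /= ? ? ? ?; apply/andP; split; lra.
Qed.

Let E0 x y : E (fun w => (Y w <= y)%R%:R - (Y w <= x)%R%:R - (F y - F x)) = 0.
Proof.
rewrite expectRB; [|exact: integrableRB|exact: integrableR_cst].
by rewrite expectR_cst expectRB// -!dist_funE subrr.
Qed.

(** The variance of the increments tends to 0 by continuity of F at q, so the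
    empirical process is asymptotically the same at q and at y_n. *)
Lemma increment_in_probability (y_ : nat -> R) (dl : R) : 0 < dl ->
  y_ n @[n --> \oo] --> q ->
  E (fun w => (dl * Num.sqrt n%:R <= `|\sum_(j < n)
    ((X j w <= y_ n)%R%:R - (X j w <= q)%R%:R - (F (y_ n) - F q))|)%R%:R)
    @[n --> \oo] --> 0.
Proof.
move=> dl0 yq.
have Fy : `|F (y_ n) - F q| / dl ^+ 2 @[n --> \oo] --> 0.
  rewrite -(mul0r (dl ^- 2)); apply: cvgM; last exact: cvg_cst.
  rewrite -(normr0 R) -[X in `|X|](subrr (F q)).
  apply: cvg_norm; apply: cvgB; last exact: cvg_cst.
  exact: (cvg_comp _ _ yq Fc).
apply: (@squeeze_cvgr _ _ _ _ (fun=> 0) _ _ _ _ _ Fy); last exact: cvg_cst.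
near=> n; rewrite expectR_ge0//=.
have n0 : 0 < n%:R :> R by rewrite ltr0n; near: n; exact: nbhs_infty_gt.
have s0 : 0 < Num.sqrt n%:R :> R by rewrite sqrtr_gt0.
pose eta (x : R) : R := (x <= y_ n)%R%:R - (x <= q)%R%:R - (F (y_ n) - F q).
have meta : measurable_fun setT eta.
  by apply: measurable_funB => //; apply: measurable_funB; exact: measurable_le_cst.
have := @iid_chebyshev _ _ _ P Y X indep law eta n (dl * Num.sqrt n%:R) meta
  (isq _ _) (E0 _ _) (mulr_gt0 dl0 s0).
move/le_trans; apply.
have -> : n%:R * E (fun w => eta (Y w) ^+ 2) / (dl * Num.sqrt n%:R) ^+ 2 =
    E (fun w => eta (Y w) ^+ 2) / dl ^+ 2.
  by rewrite exprMn sqr_sqrtr ?ler0n//; field; rewrite !gt_eqF.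
by rewrite ler_pM2r ?invr_gt0 ?exprn_gt0//; exact: expectR_cdf_increment_sqr.
Unshelve. all: by end_near. Qed.

Lemma fixed_point_in_probability x (c : R) : 0 < c ->
  E (fun w => (c * n%:R <= `|\sum_(j < n) ((X j w <= x)%R%:R - F x)|)%R%:R)
    @[n --> \oo] --> 0.
Proof.
move=> c0.
have Fy : c ^- 2 * n.+1%:R^-1 @[n --> \oo] --> 0.
  rewrite -(mulr0 (c ^- 2)); apply: cvgM; [exact: cvg_cst|exact: cvg_harmonic].
rewrite -(cvg_shiftS (fun n => E (fun w =>
  (c * n%:R <= `|\sum_(j < n) ((X j w <= x)%R%:R - F x)|)%R%:R))).
apply: (@squeeze_cvgr _ _ _ _ (fun=> 0) _ _ _ _ _ Fy); last exact: cvg_cst.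
apply: nearW => n; rewrite expectR_ge0//=.
have F1 : F x <= 1 by rewrite -lee_fin dist_fun_EFin cdf_le1.
have F0 := dist_fun_ge0 Y x.
pose eta (y : R) : R := (y <= x)%R%:R - F x.
have meta : measurable_fun setT eta.
  by apply: measurable_funB => //; exact: measurable_le_cst.
have meta2 : measurable_fun setT (fun w => eta (Y w) ^+ 2).
  by apply: measurable_funX; exact: measurableT_comp.
have eta1 w : `|eta (Y w) ^+ 2| <= 1.
  rewrite normrX exprn_ile1// /eta ler_norml.
  by case: (Y w <= x) => /=; apply/andP; split; lra.
have eta0 : E (fun w => eta (Y w)) = 0.
  by rewrite expectRB ?expectR_cst -?dist_funE ?subrr//; exact: integrableR_cst.
have c0' : 0 < c * n.+1%:R by rewrite mulr_gt0.
have i2 : integrableR P (fun w => eta (Y w) ^+ 2) := bounded_integrableR meta2 eta1.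
have := @iid_chebyshev _ _ _ P Y X indep law eta n.+1 _ meta i2 eta0 c0'.
move/le_trans; apply.
have -> : n.+1%:R * E (fun w => eta (Y w) ^+ 2) / (c * n.+1%:R) ^+ 2 =
    c ^- 2 * n.+1%:R^-1 * E (fun w => eta (Y w) ^+ 2).
  by field; rewrite nat1r pnatr_eq0/= gt_eqF.
rewrite ler_piMr ?mulr_ge0 ?invr_ge0 ?exprn_ge0 ?(ltW c0)//.
rewrite -[leRHS](@expectR_cst _ _ _ P); apply: le_expectR => //; first exact: integrableR_cst.
by move=> w; rewrite (le_trans (ler_norm _)).
Qed.

(** At a point x > q the distribution function exceeds alpha, so that qhat > x
    forces the empirical distribution function below its mean by a fixed amount;
    points x < q are treated in the same way. *)
Lemma qhat_consistent (g : R) : 0 < g ->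
  E (fun w => (g <= `|qhat n w - q|)%R%:R) @[n --> \oo] --> 0.
Proof.
move=> g0; have [F_lt F_gt] := F_incr.
(* A strict inequality between qhat and x1 is needed, hence the half. *)
pose x1 := q + g / 2; pose x2 := q - g.
have c1 : 0 < F x1 - alpha by rewrite subr_gt0 -Fq F_gt// ltrDl divr_gt0.
have c2 : 0 < alpha - F x2 by rewrite subr_gt0 -Fq F_lt// gtrBl.
pose bound x c n w : R := (c * n%:R <= `|\sum_(j < n) ((X j w <= x)%R%:R - F x)|)%R%:R.
have ib x c n : integrableR P (bound x c n).
  apply: integrableR_pred; apply: measurable_fun_ler => //.
  apply: measurableT_comp => //; apply: measurable_sum => j; apply: measurable_funB => //.
  exact: (measurableT_comp (measurable_le_cst _) (mX _)).
have lim : E (bound x1 (F x1 - alpha) n) + E (bound x2 (alpha - F x2) n) @[n --> \oo] --> 0.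
  by rewrite -(addr0 0); apply: cvgD; exact: fixed_point_in_probability.
apply: (@squeeze_cvgr _ _ _ _ (fun=> 0) _ _ _ _ _ lim); last exact: cvg_cst.
apply: nearW => n; rewrite expectR_ge0//= -expectRD//.
have iq : integrableR P (fun w => (g <= `|qhat n w - q|)%R%:R).
  apply: integrableR_pred; apply: measurable_fun_ler => //.
  by apply: measurableT_comp => //; exact: measurable_funB.
apply: le_expectR => // [|w]; first exact: integrableRD.
have [gq|_] := leP g `|qhat n w - q|; last by rewrite addr_ge0.
have sumE x : \sum_(j < n) ((X j w <= x)%R%:R - F x) =
    \sum_(j < n) (X j w <= x)%R%:R - n%:R * F x.
  by rewrite sumrB sumr_const card_ord mulr_natl.
move: gq; rewrite ler_normr => /orP[gq|gq].
  have : x1 < qhat n w by rewrite /x1; lra.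
  move/(min_contrast_lt calGP alpha01 (minq n w)) => h.
  suff -> : bound x1 (F x1 - alpha) n w = 1 by rewrite lerDl.
  rewrite /bound sumE; suff -> : (F x1 - alpha) * n%:R <=
     `|\sum_(j < n) (X j w <= x1)%R%:R - n%:R * F x1| by [].
  by rewrite ler_normr; apply/orP; right; rewrite mulrBl; lra.
have : qhat n w <= x2 by rewrite /x2; lra.
move/(min_contrast_le calGP alpha01 (minq n w)) => h.
suff -> : bound x2 (alpha - F x2) n w = 1 by rewrite lerDr.
rewrite /bound sumE; suff -> : (alpha - F x2) * n%:R <=
   `|\sum_(j < n) (X j w <= x2)%R%:R - n%:R * F x2| by [].
by rewrite ler_normr; apply/orP; left; rewrite mulrBl; lra.
Qed.

Section quantile_cuts.
Variables (a : nat -> R) (psi : R -> \bar R).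
Hypothesis a_gt0 : forall n, 0 < a n.
Hypothesis a_y : a n @[n --> \oo] --> +oo.
Hypothesis a_psi : forall t, (Num.sqrt n%:R * (F (q + t / a n) - F q))%:E @[n --> \oo] --> psi t.

Let y_cvg t : q + t / a n @[n --> \oo] --> q.
Proof.
rewrite -[X in _ --> X](addr0 q); apply: cvgD; first exact: cvg_cst.
rewrite -(mulr0 t); apply: cvgM; first exact: cvg_cst.
by apply/gtr0_cvgV0 => //; exact: nearW.
Qed.

Let eta t n w : R := \sum_(j < n)
  ((X j w <= q + t / a n)%R%:R - (X j w <= q)%R%:R - (F (q + t / a n) - F q)).

Let ieta t c n : integrableR P (fun w => (c <= `|eta t n w|)%R%:R).
Proof.
apply: integrableR_pred; apply: measurable_fun_ler => //; apply: measurableT_comp => //.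
apply: measurable_sum => j; apply: measurable_funB => //.
by apply: measurable_funB; exact: (measurableT_comp (measurable_le_cst _) (mX _)).
Qed.

Let VqE t n w : (0 < n)%N -> Num.sqrt n%:R * Vq n w =
  eta t n w + n%:R * (F (q + t / a n) - F q) +
  (alpha * n%:R - \sum_(j < n) (X j w <= q + t / a n)%R%:R).
Proof.
move=> n0; rewrite /Vq mulrA divff ?gt_eqF ?sqrtr_gt0 ?ltr0n// mul1r /eta /xiq.
have cst c : n%:R * c = \sum_(j < n) c :> R by rewrite sumr_const card_ord mulr_natl.
rewrite cst [alpha * _]mulrC cst -sumrB -!big_split/=; apply: eq_bigr => j _.
by set f1 := F _; set f2 := F _; ring.
Qed.

(** On this event F_n(q + t / a_n) <= alpha, where F_n is the empirical
    distribution function. So Vq = sqrt n (alpha - F_n(q)) is at least sqrt n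
    times the increment of F_n from q to q + t / a_n, which is close to psi(t) by
    [increment_in_probability], while x < psi(t). *)
Lemma quantile_cut_lo t x : (x%:E < psi t)%E ->
  E (fun w => ((t < a n * (qhat n w - q)) && (Vq n w <= x))%R%:R) @[n --> \oo] --> 0.
Proof.
move=> xpsi.
have [x' + x'psi] := ereal_between xpsi; rewrite lte_fin => xx'.
have dl0 : 0 < x' - x by rewrite subr_gt0.
have lim := increment_in_probability dl0 (y_cvg t).
apply: (@squeeze_cvgr _ _ _ _ (fun=> 0) _ _ _ _ _ lim); last exact: cvg_cst.
have near_psi : \forall n \near \oo, x' < Num.sqrt n%:R * (F (q + t / a n) - F q).
  have : \forall n \near \oo, (x'%:E < (Num.sqrt n%:R * (F (q + t / a n) - F q))%:E)%E.
    exact: (a_psi (open_ereal_gt' x'psi)).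
  by apply: filterS => n; rewrite lte_fin.
near=> n; rewrite expectR_ge0//=.
have n0 : (0 < n)%N by near: n; exact: nbhs_infty_gt.
have s0 : 0 < Num.sqrt n%:R :> R by rewrite sqrtr_gt0 ltr0n.
have sn : x' < Num.sqrt n%:R * (F (q + t / a n) - F q) by near: n.
apply: le_expectR => [||w].
- apply: integrableR_pred; apply: measurable_and; last exact: measurable_fun_ler.
  by apply: measurable_fun_ltr => //; apply: measurable_funM => //; exact: measurable_funB.
- exact: ieta.
rewrite -/(eta t n w) ler_nat; case: (boolP (_ && _)) => // /andP[tz Vx].
have qy : q + t / a n < qhat n w by rewrite -ltrBrDl ltr_pdivrMr// mulrC.
have h := min_contrast_lt calGP alpha01 (minq n w) qy.
suff -> : (x' - x) * Num.sqrt n%:R <= `|eta t n w| by [].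
rewrite ler_normr; apply/orP; right.
have -> : - eta t n w = n%:R * (F (q + t / a n) - F q) - Num.sqrt n%:R * Vq n w +
    (alpha * n%:R - \sum_(j < n) (X j w <= q + t / a n)%R%:R).
  by rewrite (VqE t w n0) opprD addrA opprD; ring.
move: sn => /ltW/(ler_wpM2l (ltW s0)); rewrite mulrA -expr2 sqr_sqrtr ?ler0n// => sn.
rewrite -[leLHS]addr0 lerD ?subr_ge0// mulrC mulrBr lerB//.
by rewrite ler_wpM2l// ltW.
Unshelve. all: by end_near. Qed.

Lemma quantile_cut_hi t x : (psi t < x%:E)%E ->
  E (fun w => ((a n * (qhat n w - q) <= t) && (x < Vq n w))%R%:R) @[n --> \oo] --> 0.
Proof.
move=> psix.
have [x' psix'] := ereal_between psix; rewrite lte_fin => x'x.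
have dl0 : 0 < x - x' by rewrite subr_gt0.
have lim := increment_in_probability dl0 (y_cvg t).
apply: (@squeeze_cvgr _ _ _ _ (fun=> 0) _ _ _ _ _ lim); last exact: cvg_cst.
have near_psi : \forall n \near \oo, Num.sqrt n%:R * (F (q + t / a n) - F q) < x'.
  have : \forall n \near \oo, ((Num.sqrt n%:R * (F (q + t / a n) - F q))%:E < x'%:E)%E.
    exact: (a_psi (open_ereal_lt' psix')).
  by apply: filterS => n; rewrite lte_fin.
near=> n; rewrite expectR_ge0//=.
have n0 : (0 < n)%N by near: n; exact: nbhs_infty_gt.
have s0 : 0 < Num.sqrt n%:R :> R by rewrite sqrtr_gt0 ltr0n.
have sn : Num.sqrt n%:R * (F (q + t / a n) - F q) < x' by near: n.
apply: le_expectR => [||w].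
- apply: integrableR_pred; apply: measurable_and; last exact: measurable_fun_ltr.
  by apply: measurable_fun_ler => //; apply: measurable_funM => //; exact: measurable_funB.
- exact: ieta.
rewrite -/(eta t n w) ler_nat; case: (boolP (_ && _)) => // /andP[zt xV].
have qy : qhat n w <= q + t / a n by rewrite -lerBlDl ler_pdivlMr// mulrC.
have h := min_contrast_le calGP alpha01 (minq n w) qy.
suff -> : (x - x') * Num.sqrt n%:R <= `|eta t n w| by [].
rewrite ler_normr; apply/orP; left.
have -> : eta t n w = Num.sqrt n%:R * Vq n w - n%:R * (F (q + t / a n) - F q) +
    (\sum_(j < n) (X j w <= q + t / a n)%R%:R - alpha * n%:R).
  by rewrite (VqE t w n0); ring.
move: sn => /ltW/(ler_wpM2l (ltW s0)); rewrite mulrA -expr2 sqr_sqrtr ?ler0n// => sn.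
rewrite -[leLHS]addr0 lerD ?subr_ge0// mulrC mulrBr lerB//.
by rewrite ler_wpM2l// ltW.
Unshelve. all: by end_near. Qed.

Lemma limit_nd s t : s <= t -> (psi s <= psi t)%E.
Proof.
move=> st; rewrite leNgt; apply/negP => /ereal_between[c tc cs].
pose u r n := (Num.sqrt n%:R * (F (q + r / a n) - F q))%:E.
have near_t : \forall n \near \oo, (u t n < c%:E)%E := a_psi (open_ereal_lt' tc).
have near_s : \forall n \near \oo, (c%:E < u s n)%E := a_psi (open_ereal_gt' cs).
have [n [h1 h2]] : exists n, (u t n < c%:E)%E /\ (c%:E < u s n)%E.
  suff : \forall n \near \oo, (u t n < c%:E)%E /\ (c%:E < u s n)%E by move=> /filter_ex.
  exact: filterI.
have := lt_trans h1 h2; rewrite lte_fin ltNge ler_wpM2l ?sqrtr_ge0//.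
by rewrite lerD2r dist_fun_nd// lerD2l ler_pM2r// invr_gt0.
Qed.

Lemma limit_at0 : psi 0 = 0%E.
Proof.
have := a_psi (t := 0); rewrite (_ : (fun n => _) = fun=> 0%E); last first.
  by apply/funext => n; rewrite mul0r addr0 subrr mulr0.
by move=> h; apply/esym; apply: (cvg_unique _ (cvg_cst _) h); exact: ereal_hausdorff.
Qed.

End quantile_cuts.

Let Vq_tight (e : R) : 0 < e -> exists2 M : R, 0 < M &
  forall n, E (fun w => (M < `|Vq n w|)%R%:R) <= e.
Proof.
have [a0 a1] := andP alpha01.
apply: (@normalized_sum_tight _ _ _ P unit Y X indep law (fun=> xiq) _ _ _ tt) => _.
- by apply: measurable_funB => //; exact: measurable_le_cst.
- apply: (@bounded_integrableR _ _ _ _ _ 1) => [|w].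
    apply: measurable_funX; apply: measurable_funB => //.
    exact: (measurableT_comp (measurable_le_cst _) mY).
  rewrite normrX exprn_ile1// /xiq ler_norml.
  by case: (Y w <= q) => /=; apply/andP; split; lra.
- rewrite /xiq expectRB//; last exact: integrableR_cst.
  by rewrite expectR_cst -dist_funE Fq subrr.
Qed.

(** The estimator is the maximum of a concave function whose value at q
    linearises to Ve. It exceeds this value by at most the distance from q to the
    maximiser times the slope at q, which is proportional to Vq. *)
Let es_remainder n w : (0 < n)%N ->
  0 <= Num.sqrt n%:R * (eshat n w - es) - Ve n w <= alpha^-1 * `|qhat n w - q| * `|Vq n w|.
Proof.
move=> n0; have [a0 a1] := andP alpha01.
have nR : 0 < n%:R :> R by rewrite ltr0n.
have s0 : 0 < Num.sqrt n%:R :> R by rewrite sqrtr_gt0.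
have [lo hi] := min_contrast_remainder calGP alpha01 (minq n w) q.
have cst c : n%:R * c = \sum_(j < n) c :> R by rewrite sumr_const card_ord mulr_natl.
have eE := min_contrast_es calGP alpha01 (minq n w).
have VeE : Num.sqrt n%:R * Ve n w =
    n%:R * q - alpha^-1 * \sum_(i < n) hinge q (X i w) - n%:R * es.
  rewrite /Ve mulrA divff ?gt_eqF// mul1r !cst mulr_sumr -!sumrB; apply: eq_bigr => j _.
  by rewrite /xie; field; rewrite gt_eqF.
have VqE' : `|\sum_(i < n) (X i w <= q)%R%:R - alpha * n%:R| = Num.sqrt n%:R * `|Vq n w|.
  rewrite -[X in _ = X * _](gtr0_norm s0) -normrM /Vq mulrA divff ?gt_eqF// mul1r distrC.
  by rewrite mulrC cst -sumrB.
have key : Num.sqrt n%:R * (Num.sqrt n%:R * (eshat n w - es) - Ve n w) =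
    (n%:R * qhat n w - alpha^-1 * \sum_(i < n) hinge (qhat n w) (X i w)) -
    (n%:R * q - alpha^-1 * \sum_(i < n) hinge q (X i w)).
  rewrite mulrBr VeE mulrA -expr2 sqr_sqrtr ?ler0n// mulrBr eE.
  by set A := _ * \sum_(i < n) _; set B := _ * \sum_(i < n) _; ring.
rewrite -(pmulr_rge0 _ s0) -[X in _ && X](ler_pM2l s0) key lo/=.
by rewrite (le_trans hi)// VqE' mulrCA.
Qed.

Lemma es_cut_hi t x : t < x ->
  E (fun w => ((Num.sqrt n%:R * (eshat n w - es) <= t) && (x < Ve n w))%R%:R)
    @[n --> \oo] --> 0.
Proof.
move=> tx; apply: cvg_near_cst; near=> n.
have n0 : (0 < n)%N by near: n; exact: nbhs_infty_gt.
rewrite (@eq_expectR _ _ _ _ _ (fun=> 0)) ?expectR_cst// => w.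
have /andP[r0 _] := es_remainder w n0.
case: (boolP (_ && _)) => // /andP[zt xV].
by have := lt_trans tx xV; rewrite ltNge (le_trans _ zt)// -subr_ge0.
Unshelve. all: by end_near. Qed.

(** The remainder is small: qhat is consistent and Vq is tight. *)
Lemma es_cut_lo t x : x < t ->
  E (fun w => ((t < Num.sqrt n%:R * (eshat n w - es)) && (Ve n w <= x))%R%:R)
    @[n --> \oo] --> 0.
Proof.
move=> xt; have [a0 a1] := andP alpha01; have dl0 : 0 < t - x by rewrite subr_gt0.
apply/cvgrPdist_le => /= e e0; have e2 : 0 < e / 2 by rewrite divr_gt0.
have [M M0 VM] := Vq_tight e2.
(* So that the remainder is at most g M / alpha = t - x when Vq is at most M. *)
pose g := alpha * (t - x) / M.
have g0 : 0 < g by rewrite divr_gt0// mulr_gt0.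
have /cvgrPdist_le /(_ _ e2) near_q := qhat_consistent g0.
near=> n.
have n0 : (0 < n)%N by near: n; exact: nbhs_infty_gt.
have hq : `|0 - E (fun w => (g <= `|qhat n w - q|)%R%:R)| <= e / 2 by near: n.
have iq : integrableR P (fun w => (g <= `|qhat n w - q|)%R%:R).
  apply: integrableR_pred; apply: measurable_fun_ler => //.
  by apply: measurableT_comp => //; exact: measurable_funB.
have iV : integrableR P (fun w => (M < `|Vq n w|)%R%:R).
  by apply: integrableR_pred; apply: measurable_fun_ltr => //; exact: measurableT_comp.
rewrite sub0r normrN ger0_norm ?expectR_ge0//.
apply: (@le_trans _ _ (E (fun w => (g <= `|qhat n w - q|)%R%:R + (M < `|Vq n w|)%R%:R))).
  apply: le_expectR => [||w].
  - apply: integrableR_pred; apply: measurable_and.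
      apply: measurable_fun_ltr => //; apply: measurable_funM => //.
      by apply: measurable_funB.
    apply: measurable_fun_ler => //; apply: measurable_funM => //.
    apply: measurable_sum => j; apply: measurable_funM => //; apply: measurable_funB => //.
    exact: (measurableT_comp (measurable_hinge _) (mX _)).
  - exact: integrableRD.
  case: (boolP (_ && _)) => [/andP[tz Vx]|_]; last by rewrite addr_ge0.
  have [gq|qg] := leP g `|qhat n w - q|; first by rewrite lerDl.
  have [MV|VM'] := ltP M `|Vq n w|; first by rewrite lerDr.
  have /andP[_ hi] := es_remainder w n0.
  have : t - x < Num.sqrt n%:R * (eshat n w - es) - Ve n w by rewrite ltr_leB.
  rewrite ltNge (le_trans hi)//.
  apply: (@le_trans _ _ (alpha^-1 * g * M)); last first.
    by rewrite le_eqVlt; apply/orP; left; apply/eqP; rewrite /g; field; rewrite !gt_eqF.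
  rewrite ler_pM ?mulr_ge0 ?invr_ge0 ?(ltW a0)//.
  by rewrite ler_wpM2l ?invr_ge0 ?(ltW a0)// ltW.
rewrite expectRD// (splitr e) lerD//.
by move: hq; rewrite sub0r normrN; apply: le_trans; exact: ler_norm.
Unshelve. all: by end_near. Qed.

End one_level.

(** * The limit theorem *)

Lemma continuous_matrix_entries (R : realType) (k l : nat) (f : 'M[R]_(k, l) -> R) :
  continuous f -> forall (x : 'I_k * 'I_l -> R) e, 0 < e -> exists2 dl : R, 0 < dl &
    forall y, (forall i, `|x i - y i| < dl) ->
      `|f (\matrix_(m, j) x (m, j)) - f (\matrix_(m, j) y (m, j))| < e.
Proof.
move=> f_cont x e e0.
have /cvgrPdist_lt /(_ _ e0) := f_cont (\matrix_(m, j) x (m, j)).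
move=> /nbhs_ballP[dl /= dl0 H]; exists dl => // y xy.
by apply: H; split => // m j; rewrite !mxE; exact: xy.
Qed.

Theorem theorem5 (R : realType)
  (d : measure_display) (T : measurableType d) (P : probability T R)
  (Y : {RV P >-> R}) (X : nat -> {RV P >-> R})
  (k : nat) (alpha : 'I_k -> R) (calG : R -> R)
  (qhat eshat : 'I_k -> nat -> {RV P >-> R})
  (a : 'I_k -> nat -> R) (psi : 'I_k -> R -> \bar R)
  (d' : measure_display) (T' : measurableType d') (Q : probability T' R)
  (W : 'I_k * 'I_2 -> {RV Q >-> R}) :
  let F := dist_fun Y in
  let q := fun m => quantile F (alpha m) in
  let es := fun m => lower_es F (alpha m) in
  ('E_P[fun w => (`|Y w|)%R] < +oo)%E ->
  mutually_independent X ->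
  (forall i x, cdf (X i) x = cdf Y x) ->
  injective alpha ->
  (forall m, 0 < alpha m < 1) ->
  (forall m, {for q m, continuous F} /\ strictly_increasing_at F (q m)) ->
  scoring_generator calG ->
  (forall m n w,
     min_contrast calG (alpha m) n (fun i => X i w) (qhat m n w) (eshat m n w)) ->
  (forall m,
     [/\ forall n, 0 < a m n,
         a m n @[n --> \oo] --> +oo,
         psi m t @[t --> +oo] --> +oo%E,
         psi m t @[t --> -oo] --> -oo%E &
         forall t : R,
           (Num.sqrt n%:R * (F (q m + t / a m n) - F (q m)))%:E
             @[n --> \oo] --> psi m t]) ->
  ('E_P[fun w => ((Y w <= 0)%R%:R * Y w ^+ 2)%R] < +oo)%E ->
  centered_gaussian W (limit_cov Y alpha) ->
  cvg_in_distribution P Q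
    (fun n w => \matrix_(m < k, j < 2)
       if j == 0 then a m n * (qhat m n w - q m)
       else Num.sqrt n%:R * (eshat m n w - es m))
    (fun w => \matrix_(m < k, j < 2)
       if j == 0 then psi_inv (psi m) (W (m, 0) w) else W (m, 1) w).
Proof.
move=> F q es EY indep law _ alpha01 F_reg calGP minq aP EY2 W_gauss f f_cont f_bnd.
have mY : measurable_fun setT Y := @measurable_funPT _ _ _ _ Y.
have Y1 : integrableR P Y.
  apply/integrableP; split; first exact/measurable_EFinP.
  by move: EY; rewrite unlock.
have Y2 : integrableR P (fun w => (Y w <= 0)%R%:R * Y w ^+ 2).
  apply/integrableP; split.
    apply/measurable_EFinP; apply: measurable_funM; last exact: measurable_funX.
    exact: (measurableT_comp (measurable_le_cst _) mY).
  move: EY2; rewrite unlock; apply: le_lt_trans.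
  rewrite le_eqVlt; apply/orP; left; apply/eqP; apply: eq_integral => w _ /=.
  by rewrite ger0_norm// mulr_ge0// sqr_ge0.
have Fc m : {for q m, continuous F} := (F_reg m).1.
have Fq m : F (q m) = alpha m by exact: (dist_fun_quantile (alpha01 m) (Fc m)).
have a_gt0 m n : 0 < a m n by have [] := aP m.
have a_y m : a m n @[n --> \oo] --> +oo by have [] := aP m.
have psi_y m : psi m t @[t --> +oo] --> +oo%E by have [] := aP m.
have psi_Ny m : psi m t @[t --> -oo] --> -oo%E by have [] := aP m.
have a_psi m t : (Num.sqrt n%:R * (F (q m + t / a m n) - F (q m)))%:E
             @[n --> \oo] --> psi m t by have [] := aP m.
have psi_nd m s t : s <= t -> (psi m s <= psi m t)%E.
  exact: (limit_nd (a_gt0 m) (a_psi m)).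
have psi0 m : psi m 0 = 0%E by exact: (limit_at0 (a_psi m)).
pose xi := influence Y alpha.
pose V n (i : 'I_k * 'I_2) w := normalized_sum X xi n i w.
pose Z n (i : 'I_k * 'I_2) w : R := if i.2 == 0 then a i.1 n * (qhat i.1 n w - q i.1)
  else Num.sqrt n%:R * (eshat i.1 n w - es i.1).
pose z (i : 'I_k * 'I_2) w := if i.2 == 0 then psi_inv (psi i.1) (W (i.1, 0) w) else W (i.1, 1) w.
(* The expected shortfall error is its own normalisation: its limit is W. *)
pose ps (i : 'I_k * 'I_2) t : \bar R := if i.2 == 0 then psi i.1 t else t%:E.
pose g (x : 'I_k * 'I_2 -> R) := f (\matrix_(m, j) x (m, j)).
have i2_1 (j : 'I_2) : j != 0 -> j = 1 by case: j => -[|[|//]] // ? _; exact: val_inj.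
have mW i : measurable_fun setT (W i) := @measurable_funPT _ _ _ _ (W i).
have mxi i : measurable_fun setT (xi i) by exact: measurable_influence.
have xi2 i : integrableR P (fun w => xi i (Y w) ^+ 2) by exact: integrableR_influence_sqr.
have xi0 i : Rintegral P setT (fun w => xi i (Y w)) = 0 by exact: expectR_influence.
have mV n i : measurable_fun setT (V n i) by exact: measurable_normalized_sum.
have mZ n i : measurable_fun setT (Z n i).
  by rewrite /Z; case: (_ == 0); apply: measurable_funM => //; exact: measurable_funB.
have mz i : measurable_fun setT (z i).
  rewrite /z; case: (_ == 0) => //; apply: measurableT_comp => //.
  exact: measurable_psi_inv (psi_nd _) (psi0 _) (psi_y _) (psi_Ny _).
have V_cvg th u : Rintegral P setT (fun w => phase th u (fun i => V n i w)) @[n --> \oo] -->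
    Rintegral Q setT (fun w => phase th u (fun i => W i w)).
  rewrite (gaussian_phase W_gauss).
  under eq_bigr => i _ do under eq_bigr => j _ do
    rewrite -(expectR_influenceM Y1 Y2 alpha01 Fq i j).
  exact: multivariate_clt.
have V_tight i e : 0 < e -> exists2 M : R, 0 < M &
    (forall n, Rintegral P setT (fun w => (M < `|V n i w|)%R%:R) <= e) /\
    Rintegral Q setT (fun w => (M < `|W i w|)%R%:R) <= e.
  move=> e0; have [M1 M10 H1] := normalized_sum_tight indep law mxi xi2 xi0 i e0.
  have [M2 M20 H2] := tight_real Q (mW i) e0.
  exists (Num.max M1 M2); first by rewrite lt_max M10.
  have le_ind (M M' v : R) : M <= M' -> ((M' < v)%R%:R : R) <= (M < v)%R%:R.
    by move=> MM'; rewrite ler_nat; case: (ltP M' v) => // /(le_lt_trans MM') ->.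
  split => [n|].
    apply: le_trans (H1 n); apply: le_expectR => [||w].
    - by apply: integrableR_pred; apply: measurable_fun_ltr => //; exact: measurableT_comp.
    - by apply: integrableR_pred; apply: measurable_fun_ltr => //; exact: measurableT_comp.
    - by apply: le_ind; rewrite le_max lexx.
  apply: le_trans H2; apply: le_expectR => [||w].
  - by apply: integrableR_pred; apply: measurable_fun_ltr => //; exact: measurableT_comp.
  - by apply: integrableR_pred; apply: measurable_fun_ltr => //; exact: measurableT_comp.
  - by apply: le_ind; rewrite le_max lexx orbT.
have W_atomless i x : Rintegral Q setT (fun w => (W i w == x)%:R) = 0.
  by apply: (gaussian_atomless W_gauss); exact: limit_cov_diag_neq0.
have ps_nd i s t : s <= t -> (ps i s <= ps i t)%E.
  by rewrite /ps; case: (_ == 0) => // st; exact: psi_nd.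
have ps_y i : ps i t @[t --> +oo] --> +oo%E.
  by rewrite /ps; case: (_ == 0) => //; apply/cvgeryP; exact: cvg_id.
have ps_Ny i : ps i t @[t --> -oo] --> -oo%E.
  by rewrite /ps; case: (_ == 0) => //; apply/cvgerNyP; exact: cvg_id.
have z_gt i t w : t < z i w -> (ps i t <= (W i w)%:E)%E.
  case: i => m j; rewrite /z /ps/=; have [->|/i2_1 ->] := eqVneq j 0.
    by apply: psi_inv_gt => // s r; exact: psi_nd.
  by rewrite lee_fin => /ltW.
have z_lt i t w : z i w < t -> ((W i w)%:E <= ps i t)%E.
  case: i => m j; rewrite /z /ps/=; have [->|/i2_1 ->] := eqVneq j 0.
    by apply: psi_inv_lt => // s r; exact: psi_nd.
  by rewrite lee_fin => /ltW.
have cut_lo i t x : (x%:E < ps i t)%E ->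
    Rintegral P setT (fun w => ((t < Z n i w) && (V n i w <= x))%R%:R) @[n --> \oo] --> 0.
  case: i => m j; rewrite /ps /Z /V /=; have [->|/i2_1 ->] := eqVneq j 0.
    exact: (quantile_cut_lo indep law (alpha01 m) (Fc m) calGP (minq m) (a_gt0 m) (a_y m) (a_psi m)).
  rewrite lte_fin => xt.
  exact: (es_cut_lo indep law (alpha01 m) (Fc m) (F_reg m).2 calGP (minq m) xt).
have cut_hi i t x : (ps i t < x%:E)%E ->
    Rintegral P setT (fun w => ((Z n i w <= t) && (x < V n i w))%R%:R) @[n --> \oo] --> 0.
  case: i => m j; rewrite /ps /Z /V /=; have [->|/i2_1 ->] := eqVneq j 0.
    exact: (quantile_cut_hi indep law (alpha01 m) (Fc m) calGP (minq m) (a_gt0 m) (a_y m) (a_psi m)).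
  rewrite lte_fin => tx.
  exact: (es_cut_hi Y (alpha01 m) calGP (minq m) tx).
have g_cont := continuous_matrix_entries f_cont.
have [K fK] : exists K : R, forall x, `|f x| <= K.
  by case: f_bnd => M [_ /(_ (M + 1))]; rewrite ltrDl => /(_ ltr01) H; exists (M + 1) => x; exact: H.
have g_bnd : exists K : R, forall x, `|g x| <= K by exists K => x; exact: fK.
have main := cvg_by_cells mV mW mZ mz V_cvg V_tight W_atomless ps_nd ps_y ps_Ny z_gt z_lt
  cut_lo cut_hi g_cont g_bnd.
have mgZ n := measurable_fun_prod g_cont (mZ n).
have mgz := measurable_fun_prod g_cont mz.
rewrite unlock.
have -> : (\int[Q]_w (f (\matrix_(m, j) if j == 0 then psi_inv (psi m) (W (m, 0) w) else W (m, 1) w))%:E)%E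
   = (Rintegral Q setT (fun w => g (z ^~ w)))%:E.
  by rewrite expectR_EFin//; apply: (bounded_integrableR mgz) => w; exact: fK.
have EZ n : (\int[P]_w (f (\matrix_(m, j) if j == 0 then a m n * (qhat m n w - q m)
      else Num.sqrt n%:R * (eshat m n w - es m)))%:E)%E =
    (Rintegral P setT (fun w => g (fun i => Z n i w)))%:E.
  by rewrite expectR_EFin//; apply: (bounded_integrableR (mgZ n)) => w; exact: fK.
under eq_cvg do rewrite EZ.
by apply: cvg_EFin; [exact: nearW|exact: main].
Qed.
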